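(* There is a unique action of $\mathcal H(S;\underline{\tilde t};q)$ on $F$ such that the generators $\widetilde z$, $\widetilde T_0$, $\widetilde T_1$ of $\mathcal H(S;\underline{\tilde t};q)$ act as the linear endomorphisms of $F$ given, for $g\in F$, $\gamma\in\sigma'$, by $(\widetilde zg)(\gamma)=\gamma g(\gamma)$, $$(\widetilde T_0g)(\gamma)=u_1g(\gamma)+u_1^{-1}\frac{(1-u_0u_1q^{1/2}\gamma^{-1})(1+u_0^{-1}u_1q^{1/2}\gamma^{-1})}{1-q\gamma^{-2}}\bigl(g(s_0\gamma)-g(\gamma)\bigr),$$ $$(\widetilde T_1g)(\gamma)=k_1g(\gamma)+k_1^{-1}\frac{(1-k_0k_1\gamma)(1+k_0^{-1}k_1\gamma)}{1-\gamma^2}\bigl(g(s_1\gamma)-g(\gamma)\bigr).$$ Furthermore, with respect to this action, the non-symmetric Askey-Wilson transform $\mathcal F:\mathcal A\to F$ satisfies $$\mathcal F(Xf)=\mu(X)\mathcal F(f),\qquad X\in\mathcal H(S;\underline t;q),\ f\in\mathcal A,$$ where $\mu:\mathcal H(S;\underline t;q)\to\mathcal H(S;\underline{\tilde t};q)$ is the duality isomorphism.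
   Context: Parameters: $q\in\mathbb C$ with $0<|q|<1$ and a fixed square root $q^{1/2}$; $\underline t=(k_0,k_1,u_0,u_1)$ nonzero complex numbers with $k_0^2,k_1^2,u_1^2\notin\{\pm q^j:j\in\mathbb Z\}$. Set $a=k_1u_1$, $b=-k_1u_1^{-1}$, $c=q^{1/2}k_0u_0$, $d=-q^{1/2}k_0u_0^{-1}$; dual parameters $\underline{\tilde t}=(u_1,k_1,u_0,k_0)$ ($k_0$ and $u_1$ interchanged), $\tilde a=k_0k_1$, $\tilde b=-k_1k_0^{-1}$, $\tilde c=q^{1/2}u_0u_1$, $\tilde d=-q^{1/2}u_1u_0^{-1}$. Assume $ef\notin q^{\mathbb Z}$ for all $e,f\in\{a,b,c,d\}$ and for all $e,f\in\{\tilde a,\tilde b,\tilde c,\tilde d\}$ (including $e=f$). $\mathcal A=\mathbb C[x^{\pm1}]$. On $\mathcal A$ define $(T_1f)(x)=k_1f(x)+k_1^{-1}\frac{(1-k_1u_1x)(1+k_1u_1^{-1}x)}{1-x^2}\bigl(f(x^{-1})-f(x)\bigr)$ and $(T_0f)(x)=k_0f(x)+k_0^{-1}\frac{(1-q^{1/2}k_0u_0x^{-1})(1+q^{1/2}k_0u_0^{-1}x^{-1})}{1-qx^{-2}}\bigl(f(qx^{-1})-f(x)\bigr)$ (both invertible), $Y=T_1T_0$, $z=$ multiplication by $x$. $\mathcal H(S;\underline t;q)$ is the subalgebra of $\mathrm{End}_{\mathbb C}(\mathcal A)$ generated by $T_0,T_1,z^{\pm1}$; put $T_0^\vee=q^{-1/2}T_0^{-1}z$,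 $T_1^\vee=z^{-1}T_1^{-1}$. Tilded elements are the corresponding elements of $\mathcal H(S;\underline{\tilde t};q)$, built with $\underline{\tilde t}$ in place of $\underline t$. The duality isomorphism $\mu$ is the unique algebra isomorphism with $T_0\mapsto\widetilde T_1^{-1}\widetilde T_1^\vee\widetilde T_1$, $T_1\mapsto\widetilde T_1$, $T_0^\vee\mapsto\widetilde T_0\widetilde T_0^\vee\widetilde T_0^{-1}$, $T_1^\vee\mapsto\widetilde T_0$; it satisfies $\mu(Y)=\widetilde z^{-1}$. Let $\epsilon(m)=1$ for $m\ge0$, $\epsilon(m)=-1$ for $m<0$, $\gamma_m=(k_0k_1)^{\epsilon(m)}q^m$ and $\gamma_m'=\gamma_m^{-1}$. Order the monomials by $1\prec x^{-1}\prec x\prec x^{-2}\prec x^2\prec\cdots$; $P_m$ ($m\in\mathbb Z$) is the unique Laurent polynomial $x^m+$ lower order terms w.r.t. $\preceq$ with $YP_m=\gamma_mP_m$. $P_m'$ is the polynomial obtained by the same construction with $k_0,k_1,u_0,u_1,q,q^{1/2}$ replaced by their inverses, and $E'_{\gamma_m'}=P_m'/P_m'(k_1u_1)$ (the values $P_m'(k_1u_1)$ are nonzero). Let $\sigma'=\{\gamma_m'\}_{m\in\mathbb Z}$, with involutions $s_0\gamma_m'=\gamma'_{-m-1}$, $s_1\gamma_m'=\gamma'_{-m}$, and let $F$ be the space of functions $g:\sigma'\to\mathbb C$ with finite support. In the formula for $\widetilde T_1$, at $\gamma=\gamma_0'$ the last term vanishes since $s_1\gamma_0'=\gamma_0'$.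 $(y;q)_\infty=\prod_{j\ge0}(1-yq^j)$, $(y_1,\dots,y_r;q)_\infty=\prod_i(y_i;q)_\infty$, and $$\langle f,g\rangle=\frac1{2\pi i}\int_{C}f(x)g(x^{-1})\Delta(x)\frac{dx}{x},\qquad \Delta(x)=\frac{(x^2,qx^{-2};q)_\infty}{(ax,bx,cx,dx,qax^{-1},qbx^{-1},cx^{-1},dx^{-1};q)_\infty},$$ where $C$ is a counterclockwise continuous rectifiable Jordan curve with $aq^k,bq^k,cq^k,dq^k$ ($k\ge0$) (and hence $0$) in its interior and $a^{-1}q^{-k},b^{-1}q^{-k},c^{-1}q^{-k},d^{-1}q^{-k}$ ($k\ge0$) in its exterior. The non-symmetric Askey-Wilson transform is the bijective linear map $\mathcal F:\mathcal A\to F$, $(\mathcal F f)(\gamma)=\langle f,E'_\gamma\rangle$. *)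

(* Defs.v *)
From HB Require Import structures.
From mathcomp Require Import all_boot all_order all_algebra.
From mathcomp Require Import complex ring.
From mathcomp Require Import all_classical all_reals all_analysis.

Set Implicit Arguments.
Unset Strict Implicit.
Unset Printing Implicit Defensive.

Import Order.TTheory GRing.Theory Num.Theory numFieldNormedType.Exports.

Local Open Scope classical_set_scope.
Local Open Scope ring_scope.

(** * Finitely supported functions *)

Section FinSupp.
Variables (T : choiceType) (K : fieldType).

Definition has_finsupp : {pred (T -> K^o)} :=
  fun g => `[< finite_set [set x | g x != 0] >].

Lemma has_finsupp_submod : submod_closed has_finsupp.
Proof.
split=> [|a f g /asboolP hf /asboolP hg]; apply/asboolP.
  by apply: sub_finite_set (finite_set0 T) => x; rewrite /= eqxx.
have : finite_set ([set x | f x != 0] `|` [set x | g x != 0]).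
  by rewrite finite_setU.
apply: sub_finite_set => x /= ; rewrite -[(a *: f + g) x]/(a * f x + g x) => h.
have [f0|f0] := eqVneq (f x) 0; last by left.
by right; move: h; rewrite f0 mulr0 add0r.
Qed.
HB.instance Definition _ :=
  GRing.isSubmodClosed.Build K (T -> K^o) has_finsupp has_finsupp_submod.

Record finsupp := Finsupp {
  finsupp_fun :> T -> K;
  finsuppP : (finsupp_fun : T -> K^o) \in has_finsupp }.

HB.instance Definition _ := [isSub of finsupp for (finsupp_fun : finsupp -> (T -> K^o))].
HB.instance Definition _ := [Choice of finsupp by <:].
HB.instance Definition _ := [SubChoice_isSubLmodule of finsupp by <:].

End FinSupp.

Section FinSuppTheory.
Variables (T : choiceType) (K : fieldType).
Implicit Types f g : finsupp T K.

Lemma finsupp_ext f g : f =1 g -> f = g.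
Proof.
case: f g => [f hf] [g hg] /= /funext fg; rewrite {}fg in hf *.
by rewrite (Prop_irrelevance hf hg).
Qed.

Lemma finsuppDE f g x : (f + g) x = f x + g x. Proof. by []. Qed.
Lemma finsuppZE a f x : (a *: f) x = a * f x. Proof. by []. Qed.
Lemma finsupp0E x : (0 : finsupp T K) x = 0. Proof. by []. Qed.

Lemma finsupp_finite f : finite_set [set x | f x != 0].
Proof. by have /asboolP := finsuppP f. Qed.

Fact delta_subproof (x : T) :
  (fun y => (y == x)%:R : K^o) \in @has_finsupp T K.
Proof.
apply/asboolP; apply: sub_finite_set (finite_set1 x) => y /=.
by have [//|_] := eqVneq y x; rewrite mulr0n eqxx.
Qed.
Definition delta (x : T) : finsupp T K := Finsupp (delta_subproof x).

Definition linext (V : lmodType K) (D : T -> V) f : V :=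
  \sum_(x \in [set: T]) f x *: D x.

Lemma linextE (V : lmodType K) (D : T -> V) f (s : seq T) :
  uniq s -> (forall x, f x != 0 -> x \in s) ->
  linext D f = \sum_(x <- s) f x *: D x.
Proof.
move=> us hs; rewrite /linext (fsbigE s)//.
  by apply: eq_bigl => x; rewrite in_setT.
move=> x _ /negP xs; have [->|/hs //] := eqVneq (f x) 0; by rewrite scale0r.
Qed.

Fact linext_is_linear (V : lmodType K) (D : T -> V) : linear (linext D).
Proof.
move=> a f g.
have [s [us hs]] : exists s : seq T, uniq s /\
    forall x, (f x != 0) || (g x != 0) -> x \in s.
  have /finite_seqP[s hs] : finite_set ([set x | f x != 0] `|` [set x | g x != 0]).
    by rewrite finite_setU; split; apply: finsupp_finite.
  exists (undup s); split; first exact: undup_uniq.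
  move=> x /orP h; rewrite mem_undup.
  by have : [set` s] x by rewrite -hs.
have hf x : f x != 0 -> x \in s by move=> h; apply: hs; rewrite h.
have hg x : g x != 0 -> x \in s by move=> h; apply: hs; rewrite h orbT.
have hfg x : (a *: f + g) x != 0 -> x \in s.
  rewrite finsuppDE finsuppZE => h; apply: hs; apply: contraNT h.
  by rewrite negb_or !negbK => /andP[/eqP-> /eqP->]; rewrite mulr0 addr0.
rewrite (linextE D us hf) (linextE D us hg) (linextE D us hfg).
rewrite scaler_sumr -big_split /=; apply: eq_bigr => x _.
by rewrite scalerA -scalerDl.
Qed.
HB.instance Definition _ (V : lmodType K) (D : T -> V) :=
  GRing.isLinear.Build K (finsupp T K) V *:%R (linext D) (linext_is_linear D).

Lemma linext_delta (V : lmodType K) (D : T -> V) x : linext D (delta x) = D x.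
Proof.
rewrite (@linextE _ _ _ [:: x])//=; first by rewrite big_seq1 /= eqxx scale1r.
by move=> y; rewrite /= inE; have [//|_] := eqVneq y x; rewrite mulr0n eqxx.
Qed.

Lemma finsupp_seq f : exists s : seq T, uniq s /\ forall x, f x != 0 -> x \in s.
Proof.
have /finite_seqP[s hs] := finsupp_finite f.
exists (undup s); split=> [|x fx]; first exact: undup_uniq.
by rewrite mem_undup; have : [set` s] x by rewrite -hs.
Qed.

Lemma eq_linext (V : lmodType K) (D E : T -> V) : D =1 E -> linext D =1 linext E.
Proof. by move=> /funext ->. Qed.

Lemma linext_comp (V W : lmodType K) (g : {linear V -> W}) (D : T -> V) f :
  g (linext D f) = linext (g \o D) f.
Proof.
have [s [us hs]] := finsupp_seq f; rewrite !(linextE _ us hs) raddf_sum.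
apply: eq_bigr => x _. exact: linearZZ.
Qed.

Lemma linextB (V : lmodType K) (D E : T -> V) f :
  linext (fun x => D x - E x) f = linext D f - linext E f.
Proof.
have [s [us hs]] := finsupp_seq f; rewrite !(linextE _ us hs) -sumrB.
by apply: eq_bigr => x _; rewrite scalerBr.
Qed.

Lemma linextZ (V : lmodType K) a (D : T -> V) f :
  linext (fun x => a *: D x) f = a *: linext D f.
Proof.
have [s [us hs]] := finsupp_seq f; rewrite !(linextE _ us hs) scaler_sumr.
by apply: eq_bigr => x _; rewrite !scalerA mulrC.
Qed.

Lemma finsuppE f : f = linext (@delta) f.
Proof.
have [s [us hs]] := finsupp_seq f; rewrite (linextE _ us hs).
apply: finsupp_ext => y.
have -> (r : seq T) (F : T -> finsupp T K) :
    (\sum_(x <- r) F x) y = \sum_(x <- r) F x y.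
  by elim: r => [|n r IH]; rewrite ?big_nil// !big_cons finsuppDE IH.
rewrite (eq_bigr (fun x => f x * (y == x)%:R))//.
have [fy|fy] := eqVneq (f y) 0.
  rewrite fy big1_seq// => x _.
  by have [<-|_] := eqVneq y x; rewrite ?fy ?mul0r ?mulr0.
rewrite (bigD1_seq y)//=; last exact: hs.
rewrite eqxx mulr1 big1 ?addr0// => x xy.
by rewrite eq_sym (negbTE xy) mulr0.
Qed.

End FinSuppTheory.

(** * The algebra of linear endomorphisms of [finsupp T K] *)

Section Endo.
Variables (T : pointedType) (K : fieldType).
Local Notation V := (finsupp T K).

(* T is nonempty so that the ring of endomorphisms is nontrivial, as required
   by [algType]. *)
Definition endo := {linear V -> V}.
HB.instance Definition _ := Choice.on endo.

Implicit Types X Y Z : endo.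

Definition endo_zero : endo := \0.
Definition endo_opp X : endo := \- X.
Definition endo_add X Y : endo := X \+ Y.
Definition endo_one : endo := idfun.
Definition endo_mul X Y : endo := X \o Y.

Definition endo_scale_fun (a : K) X (f : V) : V := a *: X f.
Fact endo_scale_linear (a : K) X : linear (endo_scale_fun a X).
Proof.
by move=> b f g; rewrite /endo_scale_fun linearP scalerDr !scalerA (mulrC a).
Qed.
HB.instance Definition _ a X :=
  GRing.isLinear.Build K V V *:%R (endo_scale_fun a X) (endo_scale_linear a X).
Definition endo_scale (a : K) X : endo := endo_scale_fun a X.

Lemma endoP X Y : X =1 Y -> X = Y.
Proof.
case: X Y => [X [[hX1] [hX2]]] [Y [[hY1] [hY2]]] /= /funext XY.
rewrite {}XY in hX1 hX2 *.
by rewrite (Prop_irrelevance hX1 hY1) (Prop_irrelevance hX2 hY2).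
Qed.

Fact endo_addA : associative endo_add.
Proof. by move=> X Y Z; apply: endoP => f; apply: addrA. Qed.
Fact endo_addC : commutative endo_add.
Proof. by move=> X Y; apply: endoP => f; apply: addrC. Qed.
Fact endo_add0 : left_id endo_zero endo_add.
Proof. by move=> X; apply: endoP => f; apply: add0r. Qed.
Fact endo_addN : left_inverse endo_zero endo_opp endo_add.
Proof. by move=> X; apply: endoP => f; apply: addNr. Qed.
HB.instance Definition _ :=
  GRing.isZmodule.Build endo endo_addA endo_addC endo_add0 endo_addN.

Fact endo_mulA : associative endo_mul.
Proof. by move=> X Y Z; apply: endoP. Qed.
Fact endo_mul1 : left_id endo_one endo_mul.
Proof. by move=> X; apply: endoP. Qed.
Fact endo_1mul : right_id endo_one endo_mul.
Proof. by move=> X; apply: endoP. Qed.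
Fact endo_mulDl : left_distributive endo_mul +%R.
Proof. by move=> X Y Z; apply: endoP. Qed.
Fact endo_mulDr : right_distributive endo_mul +%R.
Proof. by move=> X Y Z; apply: endoP => f; apply: raddfD. Qed.
Fact endo_1neq0 : endo_one != 0.
Proof.
apply/eqP => /(congr1 (fun X : endo => X (delta K point) point))/eqP.
by rewrite /= eqxx oner_eq0.
Qed.
HB.instance Definition _ := GRing.Zmodule_isNzRing.Build endo
  endo_mulA endo_mul1 endo_1mul endo_mulDl endo_mulDr endo_1neq0.

Fact endo_scaleA a b X : endo_scale a (endo_scale b X) = endo_scale (a * b) X.
Proof. by apply: endoP => f; apply: scalerA. Qed.
Fact endo_scale1 : left_id 1 endo_scale.
Proof. by move=> X; apply: endoP => f; apply: scale1r. Qed.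
Fact endo_scaleDr : right_distributive endo_scale +%R.
Proof. by move=> a X Y; apply: endoP => f; apply: scalerDr. Qed.
Fact endo_scaleDl X : {morph endo_scale^~ X : a b / a + b}.
Proof. by move=> a b; apply: endoP => f; apply: scalerDl. Qed.
HB.instance Definition _ := GRing.Zmodule_isLmodule.Build K endo
  endo_scaleA endo_scale1 endo_scaleDr endo_scaleDl.

Fact endo_scaleAl (a : K) X Y : a *: (X * Y) = a *: X * Y.
Proof. by apply: endoP. Qed.
HB.instance Definition _ := GRing.Lmodule_isLalgebra.Build K endo endo_scaleAl.

Fact endo_scaleAr (a : K) X Y : a *: (X * Y) = X * (a *: Y).
Proof. by apply: endoP => f; apply/esym/linearZ. Qed.
HB.instance Definition _ := GRing.Lalgebra_isAlgebra.Build K endo endo_scaleAr.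

Lemma endoDE X Y f : (X + Y) f = X f + Y f. Proof. by []. Qed.
Lemma endoBE X Y f : (X - Y) f = X f - Y f. Proof. by []. Qed.
Lemma endoME X Y f : (X * Y) f = X (Y f). Proof. by []. Qed.
Lemma endoZE a X f : (a *: X) f = a *: X f. Proof. by []. Qed.
Lemma endo1E f : (1 : endo) f = f. Proof. by []. Qed.

End Endo.

(** * Generated subalgebras, inverses *)

Section GeneratedSubalgebra.
Variables (K : fieldType) (B : algType K) (S : set B).

Definition gen_subalg : {pred B} := fun X =>
  `[< forall P : {pred B}, GRing.subalg_closed P ->
        (forall Y, S Y -> Y \in P) -> X \in P >].

Lemma gen_subalg_closed : GRing.subalg_closed gen_subalg.
Proof.
split=> [|a X Y /asboolP hX /asboolP hY|X Y /asboolP hX /asboolP hY];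
  apply/asboolP => P hP SP; have [P1 Plin Pmul] := hP.
- exact: P1.
- by apply: Plin; [apply: hX|apply: hY].
- by apply: Pmul; [apply: hX|apply: hY].
Qed.
HB.instance Definition _ :=
  GRing.isSubalgClosed.Build K B gen_subalg gen_subalg_closed.

Lemma mem_gen_subalg X : S X -> X \in gen_subalg.
Proof. by move=> SX; apply/asboolP => P _; apply. Qed.

Record subalg := Subalg { subalg_val :> B; subalgP : subalg_val \in gen_subalg }.
HB.instance Definition _ := [isSub for subalg_val].
HB.instance Definition _ := [Choice of subalg by <:].
HB.instance Definition _ := [SubChoice_isSubAlgebra of subalg by <:].

End GeneratedSubalgebra.

(* the two-sided inverse of x, and x itself when x is not invertible *)
Definition rinv (B : nzRingType) (x : B) : B :=
  xget x [set y | x * y = 1 /\ y * x = 1].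

(** * Laurent polynomials *)

HB.instance Definition _ := isPointed.Build int 0.

Section Laurent.
Variable K : fieldType.

Definition laurent := finsupp int K.
Implicit Types (f : laurent) (x : K).

(* value of the Laurent polynomial f = sum_n (f n) X^n at x != 0 *)
Definition leval f x : K := \sum_(n \in [set: int]) f n * x ^ n.

Lemma levalE f x : leval f x = linext (fun n => x ^ n : K^o) f.
Proof. by []. Qed.

Lemma levalD f g x : leval (f + g) x = leval f x + leval g x.
Proof. by rewrite !levalE raddfD. Qed.
Lemma levalZ a f x : leval (a *: f) x = a * leval f x.
Proof. by rewrite !levalE linearZ. Qed.
Lemma levalB f g x : leval (f - g) x = leval f x - leval g x.
Proof. by rewrite !levalE raddfB. Qed.
Lemma levalN f x : leval (- f) x = - leval f x.
Proof. by rewrite !levalE raddfN. Qed.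
Lemma leval_delta n x : leval (delta K n) x = x ^ n.
Proof. by rewrite levalE linext_delta. Qed.

Lemma leval_linext (D : int -> laurent) f x :
  leval (linext D f) x = linext (fun n => leval (D n) x : K^o) f.
Proof. by rewrite levalE linext_comp. Qed.

Definition lshift_fun (d : int) f : int -> K := fun n => f (n - d).

Fact lshift_subproof d f : (lshift_fun d f : int -> K^o) \in @has_finsupp int K.
Proof.
apply/asboolP; have := finite_image (fun n => n + d) (finsupp_finite f).
apply: sub_finite_set => n /= fn; exists (n - d) => //; exact: subrK.
Qed.
Definition lshift d f : laurent := Finsupp (lshift_subproof d f).

Fact lshift_is_linear d : linear (lshift d).
Proof. by move=> a f g; apply: finsupp_ext. Qed.
HB.instance Definition _ d :=
  GRing.isLinear.Build K laurent laurent *:%R (lshift d) (lshift_is_linear d).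

Definition zmul : endo int K := lshift 1.
Definition zinv : endo int K := lshift (-1).

Lemma leval_lshift d f x : x != 0 -> leval (lshift d f) x = x ^ d * leval f x.
Proof.
move=> x0.
have ld n : lshift d (delta K n) = delta K (n + d).
  by apply: finsupp_ext => m; rewrite /= /lshift_fun subr_eq.
rewrite {1}[f]finsuppE linext_comp leval_linext levalE -[RHS]linextZ.
apply: eq_fsbigr => n _; rewrite /=; congr (_ * _).
by rewrite -[LHS]/(leval (lshift d (delta K n)) x) ld leval_delta expfzDr// mulrC.
Qed.

Lemma leval_zmul f x : x != 0 -> leval (zmul f) x = x * leval f x.
Proof. exact: leval_lshift. Qed.

End Laurent.

(** * Parameters and Demazure-Lusztig operators *)

(* [qh] is the fixed square root of q *)
Record params (K : Type) := Params { qh : K; k0 : K; k1 : K; u0 : K; u1 : K }.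

Section Operators.
Variable K : fieldType.
Implicit Type p : params K.

Definition qpar p : K := qh p ^+ 2.

Definition dual p : params K := Params (qh p) (u1 p) (k1 p) (u0 p) (k0 p).

Definition inv_params p : params K :=
  Params (qh p)^-1 (k0 p)^-1 (k1 p)^-1 (u0 p)^-1 (u1 p)^-1.

(* (f(1/x) - f(x)) / (1 - x^2) and (f(q/x) - f(x)) / (1 - q x^-2) are Laurent
   polynomials; over an infinite field, T1 f and T0 f are therefore determined
   by their values at the points where the denominators do not vanish.  T1P and
   T0P show that the operators exist. *)
Definition T1_spec p (X : endo int K) : Prop :=
  forall (f : laurent K) (x : K), x != 0 -> 1 - x ^+ 2 != 0 ->
  leval (X f) x = k1 p * leval f x
    + (k1 p)^-1 * ((1 - k1 p * u1 p * x) * (1 + k1 p * (u1 p)^-1 * x)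
                   / (1 - x ^+ 2)) * (leval f x^-1 - leval f x).

Definition T0_spec p (X : endo int K) : Prop :=
  forall (f : laurent K) (x : K), x != 0 -> 1 - qpar p * x ^- 2 != 0 ->
  leval (X f) x = k0 p * leval f x
    + (k0 p)^-1 * ((1 - qh p * k0 p * u0 p * x^-1)
                   * (1 + qh p * k0 p * (u0 p)^-1 * x^-1)
                   / (1 - qpar p * x ^- 2)) * (leval f (qpar p * x^-1) - leval f x).

Definition T1 p : endo int K := xget 0 [set X | T1_spec p X].
Definition T0 p : endo int K := xget 0 [set X | T0_spec p X].

(* quotient of (s/x)^n - x^n by 1 - x^2/s *)
Definition divdiff_monom (s : K) (n : int) : laurent K :=
  (if 0 <= n then s ^ n else -1) *:
    \sum_(j < `|n|%N) s ^- j *: delta K ((j.*2)%:Z - `|n|%N%:Z).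

Definition divdiff (s : K) : endo int K := linext (divdiff_monom s).

Lemma leval_divdiff s f x : s != 0 -> x != 0 ->
  (1 - x ^+ 2 / s) * leval (divdiff s f) x = leval f (s / x) - leval f x.
Proof.
move=> s0 x0.
have mono n : (1 - x ^+ 2 / s) * leval (divdiff_monom s n) x = (s / x) ^ n - x ^ n.
  have geo m : (1 - x ^+ 2 / s) *
      leval (\sum_(j < m) s ^- j *: delta K ((j.*2)%:Z - m%:Z)) x
      = x ^- m * (1 - (x ^+ 2 / s) ^+ m).
    rewrite -[X in _ = _ * (X - _)](expr1n _ m) subrXX levalE raddf_sum [RHS]mulrCA; congr (_ * _).
    rewrite big_distrr /=; apply: eq_bigr => j _.
    rewrite linearZ /= linext_delta expr1n mul1r expfzDr//.
    rewrite exprMn exprVn -exprM mul2n -exprnP -exprnN.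
    by rewrite -[LHS]/(s ^- j * (x ^+ j.*2 * x ^- m)) mulrA mulrC [s ^- j * _]mulrC.
  rewrite levalZ mulrCA geo; case: n => m.
    by rewrite /= -!exprnP !exprMn !exprVn; field; rewrite !expf_neq0.
  rewrite (_ : absz (Negz m) = m.+1)// -[(s / x) ^ Negz m]/((s / x) ^- m.+1) -[x ^ Negz m]/(x ^- m.+1) /= !exprMn !exprVn.
  by field; rewrite !expf_neq0.
rewrite leval_linext -[LHS]linextZ !levalE -[RHS]linextB.
by apply: eq_fsbigr => n _; rewrite -mono.
Qed.

Lemma T1P p : T1_spec p (T1 p).
Proof.
suff [X hX] : exists X, T1_spec p X by apply: (xgetI 0 hX).
exists (k1 p *: 1 + (k1 p)^-1 *: ((1 - (k1 p * u1 p) *: zmul K)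
  * (1 + (k1 p * (u1 p)^-1) *: zmul K) * divdiff 1)) => f x x0 x1.
rewrite endoDE endoZE endo1E endoZE !endoME endoBE endo1E endoZE.
rewrite endoDE endo1E endoZE !(levalD, levalN, levalZ, leval_zmul)//.
have := @leval_divdiff 1 f x (oner_neq0 _) x0.
rewrite divr1 div1r => <-.
move: (k1 p / u1 p) (k1 p * u1 p) (k1 p)^-1 (leval _ x) (leval _ x) => A B C d e.
by field.
Qed.

Lemma T0P p : qh p != 0 -> T0_spec p (T0 p).
Proof.
move=> q0.
suff [X hX] : exists X, T0_spec p X by apply: (xgetI 0 hX).
exists (k0 p *: 1 + (k0 p)^-1 *: (- (qpar p)^-1 *:
  ((zmul K - (qh p * k0 p * u0 p) *: 1)
  * (zmul K + (qh p * k0 p * (u0 p)^-1) *: 1) * divdiff (qpar p)))) => f x x0 x1.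
have qq0 : qpar p != 0 by rewrite expf_neq0.
have dd := @leval_divdiff (qpar p) f x qq0 x0.
rewrite endoDE endoZE endo1E endoZE endoZE !endoME endoBE !endoZE !endo1E.
rewrite endoDE endoZE endo1E !(levalD, levalN, levalZ, leval_zmul)//.
rewrite -dd.
move: (qh p * k0 p / u0 p) (qh p * k0 p * u0 p) (k0 p)^-1 (leval _ x) (leval _ x) => A B C d e.
field; rewrite qq0 x0 /=; apply: contraNN x1; rewrite subr_eq0 => /eqP ->.
by rewrite divff ?subrr.
Qed.

End Operators.

(** * The double affine Hecke algebra and the duality isomorphism *)

Section Daha.
Variable K : fieldType.
Implicit Type p : params K.

Definition daha_gens p : set (endo int K) :=
  [set T0 p; T1 p; zmul K; zinv K].

Definition daha p := subalg (daha_gens p).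

Fact daha_T0_subproof p : T0 p \in gen_subalg (daha_gens p).
Proof. by apply: mem_gen_subalg; left; left; left. Qed.
Fact daha_T1_subproof p : T1 p \in gen_subalg (daha_gens p).
Proof. by apply: mem_gen_subalg; left; left; right. Qed.
Fact daha_z_subproof p : zmul K \in gen_subalg (daha_gens p).
Proof. by apply: mem_gen_subalg; left; right. Qed.
Fact daha_zinv_subproof p : zinv K \in gen_subalg (daha_gens p).
Proof. by apply: mem_gen_subalg; right. Qed.

Definition hT0 p : daha p := Subalg (daha_T0_subproof p).
Definition hT1 p : daha p := Subalg (daha_T1_subproof p).
Definition hz p : daha p := Subalg (daha_z_subproof p).
Definition hzinv p : daha p := Subalg (daha_zinv_subproof p).

(* T_i^-1 = T_i - k_i + k_i^-1 lies in the algebra (quadratic relation),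
   so [rinv] may be computed there *)
Definition hT0v p : daha p := (qh p)^-1 *: (rinv (hT0 p) * hz p).
Definition hT1v p : daha p := hzinv p * rinv (hT1 p).

Record is_duality p (mu : {lrmorphism daha p -> daha (dual p)}) : Prop := {
  duality_bij : bijective mu;
  duality_T0 : mu (hT0 p)
    = rinv (hT1 (dual p)) * hT1v (dual p) * hT1 (dual p);
  duality_T1 : mu (hT1 p) = hT1 (dual p);
  duality_T0v : mu (hT0v p)
    = hT0 (dual p) * hT0v (dual p) * rinv (hT0 (dual p));
  duality_T1v : mu (hT1v p) = hT0 (dual p) }.

(** * Non-symmetric Askey-Wilson polynomials *)

Definition cherednikY p : endo int K := T1 p * T0 p.

Definition gam p (m : int) : K :=
  (k0 p * k1 p) ^ (if 0 <= m then 1 else -1 : int) * qpar p ^ m.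

(* position of x^m in the list 1, x^-1, x, x^-2, x^2, ... *)
Definition monom_rank (m : int) : nat := (`|m|.*2 - (m < 0)%R)%N.

Definition is_nsAW p (m : int) (P : laurent K) : Prop :=
  [/\ P m = 1,
      forall n, P n != 0 -> n != m -> (monom_rank n < monom_rank m)%N
    & cherednikY p P = gam p m *: P].

Definition nsAW p m : laurent K := xget 0 [set P | is_nsAW p m P].

Definition nsAW' p m : laurent K := nsAW (inv_params p) m.

Definition nsAWE' p m : laurent K :=
  (leval (nsAW' p m) (k1 p * u1 p))^-1 *: nsAW' p m.

(** * The dual spectrum and the action on it *)

Definition gam' p m : K := (gam p m)^-1.

Definition spectrum p : Type := set_type (range (gam' p)).
HB.instance Definition _ p := Choice.on (spectrum p).

Fact spec_subproof p m : gam' p m \in range (gam' p).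
Proof. by rewrite inE; exists m. Qed.
Definition spec p m : spectrum p := exist _ (gam' p m) (spec_subproof p m).
HB.instance Definition _ p := isPointed.Build (spectrum p) (spec p 0).

Definition specfun p := finsupp (spectrum p) K.

(* m |-> gam'_m is injective for generic parameters, and
   s_0 gam'_m = gam'_(-m-1) and s_1 gam'_m = gam'_(-m) *)
Record is_spectral_action p
    (rho : {lrmorphism daha (dual p) -> endo (spectrum p) K}) : Prop := {
  action_z : forall (g : specfun p) m,
    rho (hz (dual p)) g (spec p m) = gam' p m * g (spec p m);
  action_T0 : forall (g : specfun p) m,
    rho (hT0 (dual p)) g (spec p m) = u1 p * g (spec p m)
      + (u1 p)^-1 * ((1 - u0 p * u1 p * qh p * (gam' p m)^-1)
                     * (1 + (u0 p)^-1 * u1 p * qh p * (gam' p m)^-1)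
                     / (1 - qpar p * gam' p m ^- 2))
        * (g (spec p (- m - 1)) - g (spec p m));
  action_T1 : forall (g : specfun p) m,
    rho (hT1 (dual p)) g (spec p m) = k1 p * g (spec p m)
      + (k1 p)^-1 * ((1 - k0 p * k1 p * gam' p m)
                     * (1 + (k0 p)^-1 * k1 p * gam' p m)
                     / (1 - gam' p m ^+ 2))
        * (g (spec p (- m)) - g (spec p m)) }.

(** * Conditions on the parameters *)

Definition aw_a p : K := k1 p * u1 p.
Definition aw_b p : K := - (k1 p * (u1 p)^-1).
Definition aw_c p : K := qh p * k0 p * u0 p.
Definition aw_d p : K := - (qh p * k0 p * (u0 p)^-1).
Definition aw_params p : seq K := [:: aw_a p; aw_b p; aw_c p; aw_d p].

End Daha.

(* q ^ j with j : int ranges over q^Z *)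
Record generic (K : numFieldType) (p : params K) : Prop := {
  q_neq0 : 0 < `|qpar p|;
  q_lt1 : `|qpar p| < 1;
  params_neq0 : [/\ k0 p != 0, k1 p != 0, u0 p != 0 & u1 p != 0];
  params_sqr : forall (t : K) (j : int), t \in [:: k0 p; k1 p; u1 p] ->
    (t ^+ 2 != qpar p ^ j) && (t ^+ 2 != - qpar p ^ j);
  aw_generic : forall (e f : K) (j : int),
    e \in aw_params p -> f \in aw_params p -> e * f != qpar p ^ j;
  aw_dual_generic : forall (e f : K) (j : int),
    e \in aw_params (dual p) -> f \in aw_params (dual p) ->
    e * f != qpar p ^ j }.

(** * Integration along rectifiable Jordan curves *)

(* the topology and norm of R[i] given by the complex modulus *)
HB.instance Definition _ (R : rcfType) := GRing.ComAlgebra.copy R[i] R[i]^o.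
HB.instance Definition _ (R : rcfType) := Vector.copy R[i] R[i]^o.
HB.instance Definition _ (R : rcfType) := NormedModule.copy R[i] R[i]^o.

Section Contour.
Variable R : realType.
Implicit Type c : R -> R[i].

(* [s] lists the points 0 < s_0 < s_1 < ... = 1; the starting point 0 is implicit *)
Definition node (s : seq R) (i : nat) : R := nth 1 (0 :: s) i.

Definition rectifiable c : Prop :=
  exists M : R[i], forall s : seq R, itv_partition 0 1 s ->
    \sum_(i < size s) `|c (node s i.+1) - c (node s i)| <= M.

Record jordan_curve c : Prop := {
  curve_continuous : {within `[0, 1], continuous c};
  curve_closed : c 0 = c 1;
  curve_simple : {in `[0, 1[ &, injective c};
  curve_rectifiable : rectifiable c }.

Definition riemann_sum c (f : R[i] -> R[i]) (s : seq R) (xi : nat -> R) : R[i] :=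
  \sum_(i < size s) f (c (xi i)) * (c (node s i.+1) - c (node s i)).

(* convergence of the Riemann-Stieltjes sums as the mesh tends to 0 *)
Definition is_contour_integral c (f : R[i] -> R[i]) (I : R[i]) : Prop :=
  forall eps : R, 0 < eps -> exists2 delta : R, 0 < delta &
    forall (s : seq R) (xi : nat -> R), itv_partition 0 1 s ->
      (forall i, (i < size s)%N -> node s i.+1 - node s i < delta) ->
      (forall i, (i < size s)%N -> node s i <= xi i <= node s i.+1) ->
      `|riemann_sum c f s xi - I| < eps%:C%C.

Definition contour_integral c f : R[i] := xget 0 [set I | is_contour_integral c f I].

Definition trace c : set R[i] := c @` `[0, 1].

(* The interior consists of the bounded component of the complement; a curve is
   counterclockwise if its winding number around the points of its interior
   is +1. *)
Definition interior_of c : set R[i] :=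
  [set w | (~` trace c) w /\ bounded_set (connected_component (~` trace c) w)].
Definition exterior_of c : set R[i] :=
  [set w | (~` trace c) w /\ ~ bounded_set (connected_component (~` trace c) w)].

Definition two_pi_i : R[i] := 2 * pi%:C%C * 'i.

Definition counterclockwise c : Prop :=
  forall w, interior_of c w ->
    contour_integral c (fun x => (x - w)^-1) = two_pi_i.

Definition is_aw_contour (p : params R[i]) c : Prop :=
  [/\ jordan_curve c, counterclockwise c, interior_of c 0
    & forall (e : R[i]) (k : nat), e \in aw_params p ->
        interior_of c (e * qpar p ^+ k) /\
        exterior_of c (e^-1 * qpar p ^- k)].

(** * The non-symmetric Askey-Wilson transform *)

Definition qpoch (q y : R[i]) : R[i] :=
  lim ((fun n : nat => \prod_(0 <= j < n) (1 - y * q ^+ j)) @ \oo).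

Definition qpochs (q : R[i]) (ys : seq R[i]) : R[i] := \prod_(y <- ys) qpoch q y.

Definition aw_weight (p : params R[i]) (x : R[i]) : R[i] :=
  let: (q, a, b, c, d) := (qpar p, aw_a p, aw_b p, aw_c p, aw_d p) in
  qpochs q [:: x ^+ 2; q * x ^- 2]
  / qpochs q [:: a * x; b * x; c * x; d * x;
                 q * a * x^-1; q * b * x^-1; c * x^-1; d * x^-1].

Definition aw_pairing (p : params R[i]) c (f g : laurent R[i]) : R[i] :=
  two_pi_i^-1 *
  contour_integral c (fun x => leval f x * leval g x^-1 * aw_weight p x / x).

Definition is_aw_transform (p : params R[i]) c
    (F : {linear laurent R[i] -> specfun p}) : Prop :=
  forall f m, F f (spec p m) = aw_pairing p c f (nsAWE' p m).

End Contour.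

(* Main.v *)
(* Multiplying the weight Delta by the rational factor of T_1 (resp. T_0) gives a kernel
   that is invariant under x -> 1/x (resp. x -> q/x).  Hence T_i is adjoint to
   T_i'^{-1}, the operator with inverted parameters, once the contour integral of an
   antisymmetric function times an invariant kernel is known to vanish.  For the
   truncated kernels, which are rational, partial fractions reduce this to the winding
   numbers of the contour around the poles (1 inside, 0 outside); the kernels themselves
   are uniform limits on the contour.  It follows that F turns Y into multiplication by
   gamma_m, and biorthogonality gives finite supports.

   On the algebraic side, T_1 and T_1^vee = z^{-1} T_1^{-1} map an eigenvector of Y to a
   combination of itself and one further eigenvector; starting from 1 this produces all
   the P_m.  Both operators act on the value at the base point 1/(k_1 u_1) by a scalar,
   so for eigenvectors normalized there the two coefficients are determined by their sum.
   With adjointness this is the intertwining property for T_1 and T_1^vee, which together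
   with Y generate the algebra.

   The action exists because the formulas on the spectrum are those of the operators on
   values of Laurent polynomials, and Laurent polynomials interpolate arbitrary values on
   finite subsets of the spectrum: a relation in End(A) therefore holds on F. *)
Require Import Defs.
From HB Require Import structures.
From mathcomp Require Import all_boot all_order all_algebra.
From mathcomp Require Import complex.
From mathcomp Require Import zify ring lra.
From mathcomp Require Import all_classical all_reals all_analysis.

Set Implicit Arguments.
Unset Strict Implicit.
Unset Printing Implicit Defensive.

Import Order.TTheory GRing.Theory Num.Theory numFieldNormedType.Exports.
Import Normc.

Local Open Scope classical_set_scope.
Local Open Scope ring_scope.

(** * Evaluation of Laurent polynomials *)

(** The contour is merely rectifiable, and its orientation is known only through the value 2 pi i of
    the integral of 1/(x - w) for w inside. No deformation of the contour and no general Cauchy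
    theorem is used: powers with exact primitives integrate to 0, and partial fractions leave only
    simple poles. The contour need not be stable under x -> s/x, so that substitution cannot be made
    along it. What replaces it is the position of the poles: for each e in the pole set, 1/e lies
    outside and es inside, and x -> s/x exchanges the factors 1 - ex and 1 - es/x. Genericity gives
    efs != 1, which keeps the two kinds of poles apart. The sets for s = 1 and s = q coincide,
    because the poles are closed under multiplication by q. As [contour_integral] is total with
    default value 0, every integral must be shown to exist before the pairing can be handled
    linearly. T_1 and T_1^vee are the right pair of generators because mu sends them to the dual T_1
    and T_0, the two operators whose formulas on the spectrum are prescribed. *)

Section LaurentEvaluation.
Variable K : numFieldType.
Implicit Types (f g : laurent K) (x : K).

Lemma laurent_bounded f : exists N : nat, forall n, f n != 0 -> (`|n| <= N)%N.
Proof.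
have [s [_ hs]] := finsupp_seq f; exists (\max_(n <- s) `|n|%N) => n /hs ns.
exact: (@leq_bigmax_seq _ _ xpredT (fun n : int => `|n|%N)).
Qed.

Lemma leval_bounded f (N : nat) x : (forall n, f n != 0 -> (`|n| <= N)%N) ->
  leval f x = \sum_(i < (2 * N).+1) f (i%:Z - N%:Z) * x ^ (i%:Z - N%:Z).
Proof.
move=> hN; pose s := [seq i%:Z - N%:Z | i <- iota 0 (2 * N).+1].
rewrite levalE (@linextE _ _ _ _ _ s) ?big_map.
- by rewrite -[iota 0 _]/(index_iota 0 (2 * N).+1) big_mkord.
- rewrite map_inj_uniq ?iota_uniq// => i j; lia.
- move=> n /hN nN; apply/mapP; exists (absz ((n : int) + N%:Z)).
    by rewrite mem_iota; move: n nN => /= n nN; lia.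
  by move: n nN => /= n nN; lia.
Qed.

(** Multiplying x^N f by x and by all x - b, b in [bad], gives a polynomial that vanishes
    everywhere, in particular at more integers than its degree allows. The exceptional points are
    there because T_0 and T_1 are specified only where their denominators do not vanish. *)
Lemma leval_eq0 (bad : seq K) f :
  (forall x, x != 0 -> x \notin bad -> leval f x = 0) -> f = 0.
Proof.
move=> f0; have [N hN] := laurent_bounded f.
pose P := \poly_(i < (2 * N).+1) f (i%:Z - N%:Z).
have PE x : x != 0 -> P.[x] = x ^+ N * leval f x.
  move=> x0; rewrite horner_poly (leval_bounded _ hN) big_distrr /=.
  apply: eq_bigr => i _; rewrite mulrCA; congr (_ * _).
  by rewrite !exprnP -expfzDr//; congr (_ ^ _); lia.
pose Q := P * 'X * \prod_(b <- bad) ('X - b%:P).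
have Q0 : Q = 0.
  apply/eqP/negP => /negP Q0; pose rs := [seq k%:R : K | k <- iota 0 (size Q)].
  have : (size rs < size Q)%N.
    apply: max_poly_roots => //.
      apply/allP => _ /mapP[k _ ->]; move: (k%:R : K) => x; rewrite /root !hornerM.
      have [->|x0] := eqVneq x 0; first by rewrite hornerX mulr0 mul0r.
      have [xbad|/f0 fx] := boolP (x \in bad); last by rewrite PE// fx// !(mulr0, mul0r).
      by have := xbad; rewrite -root_prod_XsubC => /eqP ->; rewrite mulr0.
    by rewrite map_inj_uniq ?iota_uniq// => i j /eqP; rewrite eqr_nat => /eqP.
  by rewrite size_map size_iota ltnn.
have P0 : P = 0.
  move/eqP: Q0; rewrite !mulf_eq0 polyX_eq0 orbF => /orP[/eqP//|].
  by rewrite -size_poly_eq0 size_prod_XsubC.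
apply: finsupp_ext => n; have [->//|fn] := eqVneq (f n) 0.
have := congr1 (fun p : {poly K} => p`_(absz (n + N%:Z)%R)) P0.
have nN := hN _ fn; rewrite coef_poly coef0.
have -> : (absz (n + N%:Z)%R < (2 * N).+1)%N by lia.
by have -> : (absz (n + N%:Z))%:Z - N%:Z = n by lia.
Qed.

Lemma leval_inj (bad : seq K) f g :
  (forall x, x != 0 -> x \notin bad -> leval f x = leval g x) -> f = g.
Proof.
move=> fg; apply/eqP; rewrite -subr_eq0; apply/eqP/(@leval_eq0 bad) => x x0 xb.
by rewrite levalB fg// subrr.
Qed.

Lemma endo_leval_inj (bad : seq K) (X Y : endo int K) :
  (forall f x, x != 0 -> x \notin bad -> leval (X f) x = leval (Y f) x) -> X = Y.
Proof. by move=> XY; apply: endoP => f; apply: (@leval_inj bad) => x; apply: XY. Qed.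

Lemma leval_zinv f x : x != 0 -> leval (zinv K f) x = x^-1 * leval f x.
Proof. by move=> x0; rewrite leval_lshift. Qed.

(** Newton interpolation: the value at the new point is corrected by a multiple of the product of x
    - t over the earlier points. *)
Lemma laurent_interpolation (s : seq K) (v : K -> K) : uniq s -> 0 \notin s ->
  exists f, forall x, x \in s -> leval f x = v x.
Proof.
elim: s => [|x s IH]; first by exists 0.
rewrite /= inE negb_or => /andP[xs us] /andP[x0 s0].
have [f hf] := IH us s0.
have [h hh] : exists h : laurent K, forall y, y != 0 -> leval h y = \prod_(t <- s) (y - t).
  elim: s {IH xs us s0 f hf} => [|t s [h hh]].
    by exists (delta K 0) => y _; rewrite big_nil leval_delta.
  exists (zmul K h - t *: h) => y y0; rewrite levalB levalZ leval_zmul// hh//.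
  by rewrite big_cons mulrBl.
have hx : leval h x != 0.
  have x0' : x != 0 by rewrite eq_sym.
  rewrite hh//.

  rewrite prodf_seq_neq0; apply/allP => t ts /=; rewrite subr_eq0.
  by apply: contraNneq xs => ->.
exists (f + ((v x - leval f x) / leval h x) *: h) => y; rewrite levalD levalZ inE.
case/predU1P => [->|ys]; first by rewrite divfK// addrC subrK.
have y0 : y != 0 by apply: contraNneq s0 => <-.
rewrite hf// (hh y)//.
by rewrite (bigD1_seq y)//= subrr mul0r mulr0 addr0.
Qed.

End LaurentEvaluation.

(** * Hecke relations and intertwiners *)

Section EndoLinear.
Variables (T : pointedType) (K : fieldType).
Implicit Types (X : endo T K) (f g : finsupp T K).

Lemma endoEDr X f g : X (f + g) = X f + X g. Proof. exact: raddfD. Qed.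
Lemma endoEBr X f g : X (f - g) = X f - X g. Proof. exact: raddfB. Qed.
Lemma endoEZr X a f : X (a *: f) = a *: X f. Proof. exact: linearZZ. Qed.
Lemma endo_sumE X (I : Type) (s : seq I) (F : I -> finsupp T K) :
  X (\sum_(i <- s) F i) = \sum_(i <- s) X (F i).
Proof. exact: raddf_sum. Qed.

End EndoLinear.

(** * The reflection x -> s/x of Laurent polynomials *)

Section Reflection.
Variable K : fieldType.
Implicit Types (f : laurent K) (s x : K).

Definition lrefl_fun s f : int -> K := fun n => f (- n) * s ^ (- n).

Fact lrefl_subproof s f : (lrefl_fun s f : int -> K^o) \in @has_finsupp int K.
Proof.
apply/asboolP; have := finite_image (fun n => - n) (finsupp_finite f).
apply: sub_finite_set => n /= fn; exists (- n); last exact: opprK.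
by move: fn; rewrite mulf_eq0 negb_or => /andP[].
Qed.
Definition lrefl s f : laurent K := Finsupp (lrefl_subproof s f).

Fact lrefl_is_linear s : linear (lrefl s).
Proof.
by move=> a f g; apply: finsupp_ext => n; rewrite /= /lrefl_fun mulrDl -mulrA.
Qed.
HB.instance Definition _ s :=
  GRing.isLinear.Build K (laurent K) (laurent K) *:%R (lrefl s) (lrefl_is_linear s).

Lemma leval_lrefl s f x : leval (lrefl s f) x = leval f (s / x).
Proof.
have ld n : lrefl s (delta K n) = s ^ n *: delta K (- n).
  apply: finsupp_ext => m; rewrite finsuppZE /= /lrefl_fun /= eqr_oppLR mulrC.
  by have [->|] := eqVneq m (- n); rewrite ?opprK// !mulr0.
rewrite {1}[f]finsuppE linext_comp leval_linext levalE.
apply: eq_fsbigr => n _ /=; congr (_ * _).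
by rewrite ld levalZ leval_delta expfzMl exprz_inv.
Qed.

End Reflection.

(** * Quadratic relations and commutation with Y *)

Section HeckeRelations.
Variables (K : numFieldType) (p : params K).
Implicit Types f : laurent K.
Hypothesis qh0 : qh p != 0.
Hypothesis par0 : [/\ k0 p != 0, k1 p != 0, u0 p != 0 & u1 p != 0].

Let k0N0 : k0 p != 0. Proof. by case: par0. Qed.
Let k1N0 : k1 p != 0. Proof. by case: par0. Qed.
Let u0N0 : u0 p != 0. Proof. by case: par0. Qed.
Let u1N0 : u1 p != 0. Proof. by case: par0. Qed.

Let ka0 := k0 p - (k0 p)^-1.
Let ka1 := k1 p - (k1 p)^-1.
Let up0 := u0 p - (u0 p)^-1.
Let up1 := u1 p - (u1 p)^-1.

Definition T1i : endo int K := T1 p - ka1 *: 1.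
Definition T0i : endo int K := T0 p - ka0 *: 1.
(* the element T_1^vee of the paper *)
Definition Uop : endo int K := zinv K * T1i.


Lemma sqr_sub_neq0 (s x : K) : x \notin [:: s; - s] -> s ^+ 2 - x ^+ 2 != 0.
Proof.
rewrite !inE negb_or => /andP[x1 x2]; rewrite subr_sqr; apply: mulf_neq0.
  by rewrite subr_eq0 eq_sym.
by rewrite addrC addr_eq0.
Qed.

Lemma leval1_notin (x : K) : x \notin [:: 1; -1] -> 1 - x ^+ 2 != 0.
Proof. by move/sqr_sub_neq0; rewrite expr1n. Qed.

Lemma leval0_notin (x : K) : x \notin [:: qh p; - qh p] -> qpar p - x ^+ 2 != 0.
Proof. exact: sqr_sub_neq0. Qed.

Lemma T1E f x : x != 0 -> 1 - x ^+ 2 != 0 ->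
  leval (T1 p f) x = k1 p * leval f x
    + (k1 p)^-1 * ((1 - k1 p * u1 p * x) * (1 + k1 p * (u1 p)^-1 * x)
                   / (1 - x ^+ 2)) * (leval f x^-1 - leval f x).
Proof. exact: T1P. Qed.

Lemma T0E f x : x != 0 -> 1 - qpar p * x ^- 2 != 0 ->
  leval (T0 p f) x = k0 p * leval f x
    + (k0 p)^-1 * ((1 - qh p * k0 p * u0 p * x^-1)
                   * (1 + qh p * k0 p * (u0 p)^-1 * x^-1)
                   / (1 - qpar p * x ^- 2)) * (leval f (qpar p * x^-1) - leval f x).
Proof. exact: T0P. Qed.

Lemma T1_quadratic : T1 p * T1 p = ka1 *: T1 p + 1.
Proof.
apply: (@endo_leval_inj _ [:: 1; -1]) => f x x0 /leval1_notin x1.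
have x1' : x ^+ 2 - 1 != 0 by rewrite -opprB oppr_eq0.
have xi1 : 1 - x^-1 ^+ 2 != 0.
  have -> : 1 - x^-1 ^+ 2 = (x ^+ 2 - 1) / x ^+ 2 by field.
  by rewrite mulf_neq0 // invr_neq0// expf_neq0.
have xi0 : x^-1 != 0 by rewrite invr_neq0.
rewrite endoME endoDE endoZE endo1E levalD levalZ.
rewrite (T1E (T1 p f))// (T1E f x0 x1) (T1E f xi0 xi1) invrK /ka1.
move: (leval f x) (leval f x^-1) => A B; field.
by rewrite x1 x1' x0 u1N0 k1N0.
Qed.

Lemma T0_quadratic : T0 p * T0 p = ka0 *: T0 p + 1.
Proof.
apply: (@endo_leval_inj _ [:: qh p; - qh p]) => f x x0 /leval0_notin.
rewrite /qpar => x1.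
have x1' : x ^+ 2 - qh p ^+ 2 != 0 by rewrite -opprB oppr_eq0.
have y0 : qpar p / x != 0 by rewrite mulf_neq0 ?invr_neq0// expf_neq0.
have x2 : 1 - qpar p * x ^- 2 != 0.
  have -> : 1 - qpar p * x ^- 2 = (x ^+ 2 - qh p ^+ 2) / x ^+ 2 by rewrite /qpar; field.
  by rewrite mulf_neq0// invr_neq0// expf_neq0.
have y2 : 1 - qpar p * (qpar p / x) ^- 2 != 0.
  have -> : 1 - qpar p * (qpar p / x) ^- 2 = (qh p ^+ 2 - x ^+ 2) / qh p ^+ 2.
    by rewrite /qpar; field; rewrite qh0 x0.
  by rewrite mulf_neq0// invr_neq0// expf_neq0.
rewrite endoME endoDE endoZE endo1E levalD levalZ.
rewrite (T0E (T0 p f))// (T0E f x0 x2) (T0E f y0 y2) /ka0.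
have -> : qpar p / (qpar p / x) = x.
  by rewrite /qpar; field; rewrite x0 qh0.
rewrite /qpar; move: (leval f x) (leval f _) => A B; field.
by rewrite x1 x1' x0 u0N0 k0N0 qh0.
Qed.

Lemma mulT1K : T1 p * T1i = 1.
Proof. by rewrite /T1i mulrBr T1_quadratic -scalerAr mulr1 addrAC subrr add0r. Qed.
Lemma mulT1iK : T1i * T1 p = 1.
Proof. by rewrite /T1i mulrBl T1_quadratic -scalerAl mul1r addrAC subrr add0r. Qed.
Lemma mulT0K : T0 p * T0i = 1.
Proof. by rewrite /T0i mulrBr T0_quadratic -scalerAr mulr1 addrAC subrr add0r. Qed.
Lemma mulT0iK : T0i * T0 p = 1.
Proof. by rewrite /T0i mulrBl T0_quadratic -scalerAl mul1r addrAC subrr add0r. Qed.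

Lemma zmul_zinv : zmul K * zinv K = 1.
Proof.
by apply: endoP => f; apply: finsupp_ext => n; rewrite /= /lshift_fun/= opprK subrK.
Qed.
Lemma zinv_zmul : zinv K * zmul K = 1.
Proof.
by apply: endoP => f; apply: finsupp_ext => n; rewrite /= /lshift_fun/= opprK addrK.
Qed.

(* T1 z is the inverse of T_1^vee, so this is the quadratic relation of T_1^vee;
   likewise T0v_quadratic is that of T_0^vee *)
Lemma T1z_quadratic : T1 p * zmul K = Uop - up1 *: 1.
Proof.
apply: (@endo_leval_inj _ [:: 1; -1]) => f x x0 /leval1_notin x1.
have xi0 : x^-1 != 0 by rewrite invr_neq0.
rewrite endoBE endoZE endo1E !endoME endoBE endoZE endo1E levalB levalZ.
rewrite leval_zinv// levalB levalZ !T1E// !leval_zmul// /up1 /ka1.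
move: (leval f x) (leval f x^-1) => A B; field.
by rewrite x1 x0 u1N0 k1N0.
Qed.

Lemma T0v_quadratic :
  (qh p)^-1 *: (T0i * zmul K) = qh p *: (zinv K * T0 p) + up0 *: 1.
Proof.
apply: (@endo_leval_inj _ [:: qh p; - qh p]) => f x x0 /leval0_notin x1.
have x2 : 1 - qpar p * x ^- 2 != 0.
  have -> : 1 - qpar p * x ^- 2 = - (qpar p - x ^+ 2) / x ^+ 2 by rewrite /qpar; field.
  by rewrite mulf_neq0// ?oppr_eq0// invr_neq0// expf_neq0.
have y0 : qpar p / x != 0 by rewrite mulf_neq0 ?invr_neq0// expf_neq0.
rewrite endoDE !endoZE endo1E !endoME endoBE endoZE endo1E levalD !levalZ.
rewrite leval_zinv// levalB levalZ !T0E// !leval_zmul// /up0 /ka0.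
move: x1; rewrite /qpar; move: (leval f x) (leval f _) => A B x1; field.
by rewrite -opprB oppr_eq0 x1 x0 u0N0 k0N0 qh0.
Qed.

Definition Yi : endo int K := T0i * T1i.
Lemma mulYK : cherednikY p * Yi = 1.
Proof. by rewrite /Yi /cherednikY mulrA -(mulrA (T1 p)) mulT0K mulr1 mulT1K. Qed.
Lemma mulYiK : Yi * cherednikY p = 1.
Proof. by rewrite /Yi /cherednikY mulrA -(mulrA T0i) mulT1iK mulr1 mulT0iK. Qed.

(** Y^{-1} is used because T_1 cancels against it: Y^{-1} T_1 = T_0^{-1} = T_0 - k_0 + k_0^{-1}, and
    T_0 is recovered from T_1 Y by the quadratic relation of T_1. *)
Lemma Yi_T1 : Yi * T1 p = T1 p * cherednikY p - ka1 *: cherednikY p - ka0 *: 1.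
Proof.
rewrite /Yi /cherednikY -mulrA mulT1iK mulr1 [in RHS]mulrA T1_quadratic mulrDl mul1r.
by rewrite -scalerAl [_ + T0 p]addrC addrK.
Qed.

(** Here [Uop - up1 *: 1] is T_1 z, so the left side is T_0^{-1} z, a multiple of T_0^vee. The
    quadratic relation of T_0^vee leads back to z^{-1} T_0 = T_1^vee Y. *)
Lemma Yi_Uop : Yi * (Uop - up1 *: 1) =
  (qh p ^+ 2) *: (Uop * cherednikY p) + (qh p * up0) *: 1.
Proof.
rewrite -T1z_quadratic /Yi /Uop /cherednikY mulrA -(mulrA T0i) mulT1iK mulr1.
rewrite !mulrA -(mulrA _ T1i) mulT1iK mulr1.
by rewrite -[LHS]scale1r -(divff qh0) -[LHS]scalerA T0v_quadratic scalerDr !scalerA.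
Qed.

(** * Intertwiners: new eigenvectors of Y from old ones *)

Section Eigenvector.
Variables (g : K) (e : laurent K).
Hypotheses (g0 : g != 0) (Ye : cherednikY p e = g *: e).

Let Yie : Yi e = g^-1 *: e.
Proof.
have := congr1 (fun X : endo int K => X e) mulYiK.
by rewrite endoME Ye endoEZr => /(congr1 ( *:%R g^-1)); rewrite scalerA mulVf// scale1r.
Qed.

Lemma Yi_eigen (w : laurent K) (h : K) : h != 0 -> Yi w = h *: w ->
  cherednikY p w = h^-1 *: w.
Proof.
move=> h0 Yw; have := congr1 (fun X : endo int K => X w) mulYK.
by rewrite endoME Yw endoEZr => /(congr1 ( *:%R h^-1)); rewrite scalerA mulVf// scale1r.
Qed.

(** By [Yi_T1], Y^{-1} is triangular on the span of T_1 e and e, with diagonal entries g and g^{-1}.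
    The condition on [al] makes the combination an eigenvector for the entry g. *)
Lemma eigen_T1 al : al * (1 - g ^+ 2) = g * (ka1 * g + ka0) ->
  cherednikY p (T1 p e + al *: e) = g^-1 *: (T1 p e + al *: e).
Proof.
move=> hal; apply: Yi_eigen => //; rewrite endoEDr endoEZr Yie.
rewrite -[Yi (T1 p e)]endoME Yi_T1 !endoBE endoME !endoZE endo1E Ye (endoEZr (T1 p)).
rewrite !scalerDr !scalerA -!addrA; congr (_ + _).
rewrite -!scaleNr -!scalerDl; congr (_ *: _).
apply: (mulfI g0); rewrite -[- ka1 *: g]/(- ka1 * g).
have -> : g * (- ka1 * g + (- ka0 + al / g)) = al - g * (ka1 * g + ka0) by field.
by rewrite -hal; ring.
Qed.

(** The same triangularity by [Yi_Uop], now with diagonal entries q g and g^{-1}. *)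
Lemma eigen_Uop be : be * (qpar p * g ^+ 2 - 1) = qh p * up0 * g + up1 ->
  cherednikY p (Uop e + be *: e) = (qpar p * g)^-1 *: (Uop e + be *: e).
Proof.
move=> hbe; apply: Yi_eigen; first by rewrite mulf_neq0// expf_neq0.
rewrite endoEDr endoEZr Yie.
have := congr1 (fun X : endo int K => X e) Yi_Uop.
rewrite (endoME Yi) endoBE endoDE !endoZE (endoME Uop) !endo1E Ye endoEBr (endoEZr Yi) (endoEZr Uop) Yie.
move=> /eqP; rewrite subr_eq => /eqP ->.
rewrite !scalerDr !scalerA -!addrA; congr (_ + _).
rewrite -!scalerDl; congr (_ *: _).
transitivity ((qh p * up0 * g + up1 + be) / g).
  by rewrite -[LHS]/(qh p * up0 + (up1 + be) * g^-1); field.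
rewrite -hbe; apply: (mulIf g0); rewrite mulfVK//; ring.
Qed.

End Eigenvector.

(** At this point the factor 1 - k_1 u_1 x of the reflection term vanishes, while the hypothesis
    keeps 1 - x^2 away from 0. *)
Lemma leval_T1_base f : (k1 p * u1 p) ^+ 2 != 1 ->
  leval (T1 p f) (k1 p * u1 p)^-1 = k1 p * leval f (k1 p * u1 p)^-1.
Proof.
move=> a1; have a0 : k1 p * u1 p != 0 by rewrite mulf_neq0.
rewrite T1E ?invr_neq0//; first by rewrite divff// subrr !(mul0r, mulr0) addr0.
by rewrite exprVn subr_eq0 eq_sym invr_eq1.
Qed.

Lemma leval_Uop_base f : (k1 p * u1 p) ^+ 2 != 1 ->
  leval (Uop f) (k1 p * u1 p)^-1 = u1 p * leval f (k1 p * u1 p)^-1.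
Proof.
move=> a1; have a0 : k1 p * u1 p != 0 by rewrite mulf_neq0.
rewrite endoME leval_zinv ?invr_neq0// endoBE endoZE endo1E levalB levalZ leval_T1_base//.
by rewrite /ka1 -mulrBl opprB addrC subrK invrK mulrA [k1 p * u1 p]mulrC mulfK.
Qed.

(** This is division by 1 - x^2 read on coefficients. With r = f(1/x) - f(x), the coefficients of d
    = T_1 f - k_1 f satisfy a recursion of step 2 whose right side involves only r. Beyond the
    support of r, d is constant along each parity class, hence 0 by finite support. The recursion at
    m + 2 and at -m then gives the two extreme coefficients. *)
Lemma T1_support f (m : nat) : (forall n, f n != 0 -> (`|n| <= m)%N) ->
  [/\ forall n, T1 p f n != 0 -> (`|n| <= m)%N,
      T1 p f m = k1 p * f (- m%:Z)
    & T1 p f (- m%:Z) = k1 p * f (- m%:Z) + (k1 p)^-1 * (f m - f (- m%:Z))].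
Proof.
move=> fm; pose d := T1 p f - k1 p *: f; pose r := lrefl 1 f - f.
have rE n : r n = f (- n) - f n.
  by rewrite -[r n]/(lrefl_fun 1 f n - f n) /lrefl_fun exp1rz mulr1.
have r0 n : (m < `|n|)%N -> r n = 0.
  move=> mn; rewrite rE.
  have [->|/fm] := eqVneq (f n) 0; last by lia.
  by have [->|/fm] := eqVneq (f (- n)) 0; [rewrite subrr|lia].
have dE : d - zmul K (zmul K d) = (k1 p)^-1 *: (r + (k1 p / u1 p - k1 p * u1 p) *: zmul K r
    - (k1 p ^+ 2) *: zmul K (zmul K r)).
  apply: (@leval_inj _ [:: 1; -1]) => x x0 /leval1_notin x1.
  rewrite /d /r !(levalB, levalN, levalZ, levalD, leval_zmul)// leval_lrefl T1E// div1r.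
  move: (leval f x) (leval f x^-1) => A B; field.
  by rewrite x1 u1N0 k1N0.
have dn n : d n - d (n - 2) = (k1 p)^-1 * (r n + (k1 p / u1 p - k1 p * u1 p) * r (n - 1)
    - k1 p ^+ 2 * r (n - 2)).
  have := congr1 (fun g : laurent K => g n) dE.
  have e2 : n - 1 - 1 = n - 2 by lia.
  by rewrite -[LHS]/(d n - d (n - 1 - 1)) -[RHS]/((k1 p)^-1 * (r n + (k1 p / u1 p - k1 p * u1 p) * r (n - 1)
    - k1 p ^+ 2 * r (n - 1 - 1))) e2.
have [N dN] := laurent_bounded d.
have dpos (n : int) : (m%:Z < n) -> d n = 0.
  move=> mn; have step j : d (n + (2 * j)%N%:Z) = d n.
    elim: j => [|j <-]; first by rewrite muln0 addr0.
    apply/eqP; rewrite -subr_eq0; apply/eqP.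
    have := dn (n + (2 * j.+1)%N%:Z).
    have -> : n + (2 * j.+1)%N%:Z - 2 = n + (2 * j)%N%:Z by lia.
    move=> ->; rewrite !r0; first by rewrite !mulr0 addr0 subrr mulr0.
    1-3: lia.
  by rewrite -(step N.+1); apply/eqP/negP => /negP /dN; lia.
have dneg (n : int) : (n < - m%:Z) -> d n = 0.
  move=> mn; have step j : d (n - (2 * j)%N%:Z) = d n.
    elim: j => [|j <-]; first by rewrite muln0 subr0.
    apply/esym/eqP; rewrite -subr_eq0; apply/eqP.
    have := dn (n - (2 * j)%N%:Z).
    have -> : n - (2 * j)%N%:Z - 2 = n - (2 * j.+1)%N%:Z by lia.
    move=> ->; rewrite !r0; first by rewrite !mulr0 addr0 subrr mulr0.
    1-3: lia.
  by rewrite -(step N.+1); apply/eqP/negP => /negP /dN; lia.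
have TE n : T1 p f n = d n + k1 p * f n.
  by rewrite -[d n]/(T1 p f n - k1 p * f n) subrK.
have dm : d m = k1 p * (f (- m%:Z) - f m).
  have := dn (m%:Z + 2); rewrite addrK dpos ?sub0r; last lia.
  rewrite (r0 (m%:Z + 2)); last lia.
  rewrite (r0 (m%:Z + 2 - 1)); last lia.
  rewrite mulr0 addr0 sub0r mulrN => /eqP; rewrite eqr_opp => /eqP ->.
  by rewrite rE expr2 mulrA mulKf.
have dm' : d (- m%:Z) = (k1 p)^-1 * (f m - f (- m%:Z)).
  have := dn (- m%:Z); rewrite (dneg (- m%:Z - 2)) ?subr0; last lia.
  rewrite (r0 (- m%:Z - 2)); last lia.
  rewrite (r0 (- m%:Z - 1)); last lia.
  by rewrite mulr0 addr0 mulr0 subr0 rE opprK.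
split=> [n||]; rewrite TE.
- apply: contraNT => mn.
  have -> : f n = 0 by apply/eqP; apply: contraNT mn => /fm.
  rewrite mulr0 addr0; have [n0|n0] := leP 0 n.
    by rewrite dpos//; lia.
  by rewrite dneg//; lia.
- by rewrite dm mulrBr subrK.
- by rewrite dm' addrC.
Qed.

Lemma Uop_coef f n : Uop f n = T1 p f (n + 1) - ka1 * f (n + 1).
Proof.
have zc (h : laurent K) : zinv K h n = h (n + 1) by rewrite /= /lshift_fun opprK.
by rewrite /Uop endoME zc /T1i endoBE endoZE endo1E -scaleNr finsuppDE finsuppZE mulNr.
Qed.

End HeckeRelations.

(** * Eigenvectors of Y *)

(* [rank_monom r] is the exponent at position r in the list 1, x^-1, x, x^-2, x^2, ... *)
Definition rank_monom (r : nat) : int := if odd r then - (uphalf r)%:Z else (r./2)%:Z.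

Lemma rank_monomK r : monom_rank (rank_monom r) = r.
Proof.
rewrite /monom_rank /rank_monom; case: ifP => r2.
  have -> : (- (uphalf r)%:Z < 0)%R by lia.
  by lia.
have -> : ((r./2)%:Z < 0)%R = false by lia.
by lia.
Qed.

Lemma monom_rankK m : rank_monom (monom_rank m) = m.
Proof.
rewrite /monom_rank /rank_monom; case: (ltP m 0) => m0.
  have -> : odd (`|m|.*2 - true) by lia.
  by lia.
have -> : odd (`|m|.*2 - false) = false by lia.
by lia.
Qed.

Lemma monom_rank_le_double (m : nat) n : (monom_rank n <= m.*2)%N = (`|n| <= m)%N.
Proof. by rewrite /monom_rank; case: (ltP n 0) => ? /=; lia. Qed.

Lemma monom_rank_lt_double (m : nat) n :
  (monom_rank n < m.*2)%N = (`|n| <= m)%N && (n != m).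
Proof. by rewrite /monom_rank; case: (ltP n 0) => ? /=; lia. Qed.

Lemma monom_rank_le_doubleS (m : nat) (n : int) :
  (`|(n + 1)%R| <= m)%N -> n != m -> (monom_rank n <= m.*2.+1)%N.
Proof. by rewrite /monom_rank; case: (ltP n 0) => ? /=; lia. Qed.

Lemma monom_rank_oppS (m : nat) : monom_rank (- m%:Z - 1) = m.*2.+1.
Proof.
rewrite /monom_rank; have -> : (- m%:Z - 1 < 0)%R by lia.
by lia.
Qed.

Lemma odd_doubleE r : odd r -> r.+1 = (uphalf r).*2.
Proof. by move=> ?; lia. Qed.

Lemma even_doubleE r : ~~ odd r -> r = r./2.*2.
Proof. by move=> ?; lia. Qed.

Lemma rank_monom_odd r : odd r ->
  rank_monom r = - (uphalf r)%:Z /\ rank_monom r.+1 = uphalf r.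
Proof. by rewrite /rank_monom /= => r1; rewrite r1. Qed.

Lemma rank_monom_even r : ~~ odd r ->
  rank_monom r = r./2 /\ rank_monom r.+1 = - (r./2)%:Z - 1.
Proof. rewrite /rank_monom /= => r1; rewrite r1 (negbTE r1); split=> //.
by rewrite -addn1 PoszD opprD. Qed.

Lemma finsupp_sumE (T : choiceType) (K : fieldType) (I : Type) (s : seq I)
    (F : I -> finsupp T K) x : (\sum_(i <- s) F i) x = \sum_(i <- s) F i x.
Proof. by elim: s => [|i s IH]; rewrite ?big_nil// !big_cons finsuppDE IH. Qed.

(* The algebraic consequences of genericity; unlike |q| < 1, they are invariant
   under inverting the parameters. *)
Record alg_generic (K : numFieldType) (p : params K) : Prop := {
  alg_qh : qh p != 0;
  alg_neq0 : [/\ k0 p != 0, k1 p != 0, u0 p != 0 & u1 p != 0];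
  alg_root : forall j : int, qpar p ^ j = 1 -> j = 0;
  alg_k0k1 : forall j : int, (k0 p * k1 p) ^+ 2 != qpar p ^ j;
  alg_k1 : forall j : int, k1 p ^+ 2 != - qpar p ^ j;
  alg_base : (k1 p * u1 p) ^+ 2 != 1;
  alg_ac : forall j : int, k1 p * u1 p * (qh p * k0 p * u0 p) != qpar p ^ j;
  alg_ad : forall j : int, k1 p * u1 p * (qh p * k0 p / u0 p) != - qpar p ^ j }.

Lemma alg_generic_inv (K : numFieldType) (p : params K) :
  alg_generic p -> alg_generic (inv_params p).
Proof.
case=> qh0 [k00 k10 u00 u10] root k0k1 hk1 base ac ad.
have qi j : qpar (inv_params p) ^ j = (qpar p ^ j)^-1.
  by rewrite /qpar /= exprVn exprz_inv invr_expz.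
split => /=; rewrite ?invr_neq0//.
- by move=> j; rewrite qi => /(congr1 GRing.inv); rewrite invrK invr1; apply: root.
- by move=> j; rewrite qi -invfM exprVn (inj_eq invr_inj).
- by move=> j; rewrite qi exprVn -invrN (inj_eq invr_inj).
- by rewrite -invfM exprVn invr_eq1.
- by move=> j; rewrite qi -!invfM (inj_eq invr_inj).
- by move=> j; rewrite qi -!invfM -invrN (inj_eq invr_inj).
Qed.

Section Eigenbasis.
Variables (K : numFieldType) (p : params K).
Hypothesis pg : alg_generic p.
Implicit Types (f : laurent K) (m : int) (r : nat).

Let qh0 := alg_qh pg.
Let par0 := alg_neq0 pg.
Let k0N0 : k0 p != 0. Proof. by case: par0. Qed.
Let k1N0 : k1 p != 0. Proof. by case: par0. Qed.
Let u0N0 : u0 p != 0. Proof. by case: par0. Qed.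
Let u1N0 : u1 p != 0. Proof. by case: par0. Qed.
Let q0 : qpar p != 0. Proof. by rewrite expf_neq0. Qed.

Lemma gam_pos m : 0 <= m -> gam p m = k0 p * k1 p * qpar p ^ m.
Proof. by rewrite /gam => ->; rewrite expr1z. Qed.

Lemma gam_neg m : m < 0 -> gam p m = (k0 p * k1 p)^-1 * qpar p ^ m.
Proof. by rewrite /gam ltNge => /negbTE ->; rewrite exprN1. Qed.

Lemma gam_neq0 m : gam p m != 0.
Proof. by rewrite mulf_neq0// expfz_neq0// mulf_neq0. Qed.

Lemma gamN m : m != 0 -> gam p (- m) = (gam p m)^-1.
Proof.
move=> m0; have [m1|m1] := leP 0 m.
  rewrite gam_neg ?gam_pos//; last by lia.
  by rewrite [RHS]invfM invr_expz.
by rewrite (gam_neg m1) gam_pos ?[RHS]invfM ?invrK ?invr_expz//; lia.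
Qed.

Lemma gamNB1 m : gam p (- m - 1) = (qpar p * gam p m)^-1.
Proof.
have [m1|m1] := leP 0 m.
  rewrite gam_neg ?gam_pos//; last by lia.
  by rewrite expfzDr// exprN1 -invr_expz !invfM; ring.
rewrite (gam_neg m1) gam_pos; last by lia.
by rewrite expfzDr// exprN1 -invr_expz; field; rewrite q0 k0N0 k1N0 expfz_neq0.
Qed.

Lemma gam_sqr m (j : int) : gam p m ^+ 2 != qpar p ^ j.
Proof.
have sq (n : int) : (qpar p ^ n) ^+ 2 = qpar p ^ (n * 2) by rewrite -exprz_exp.
have kk : k0 p * k1 p != 0 by rewrite mulf_neq0.
apply/eqP; have [m1|m1] := leP 0 m.
  rewrite gam_pos// exprMn sq => e.
  have /eqP[] := alg_k0k1 pg (j - m * 2).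
  by rewrite expfzDr// -e -mulrA -expfzDr// subrr mulr1.
rewrite gam_neg// exprMn sq => e.
have /eqP[] := alg_k0k1 pg (m * 2 - j).
rewrite expfzDr// -invr_expz -e invfM -exprVn invrK mulrCA mulfV ?mulr1//.
by rewrite expfz_neq0.
Qed.

(** For indices of equal sign this holds because q is not a root of unity; for opposite signs a
    coincidence would make (k_0 k_1)^2 a power of q. *)
Lemma gam_inj : injective (gam p).
Proof.
have kk : k0 p * k1 p != 0 by rewrite mulf_neq0.
have qinj m n : qpar p ^ m = qpar p ^ n -> m = n.
  move=> e; apply/eqP; rewrite -subr_eq0; apply/eqP/(alg_root pg).
  by rewrite expfzDr// e -expfzDr// subrr.
have mix m n : k0 p * k1 p * qpar p ^ m <> (k0 p * k1 p)^-1 * qpar p ^ n.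
  move=> e; have /eqP[] := alg_k0k1 pg (n - m).
  rewrite expfzDr// -invr_expz; apply: (mulIf (expfz_neq0 m q0)).
  rewrite divfK ?expfz_neq0//; set k := k0 p * k1 p in kk e *.
  by transitivity (k * (k * qpar p ^ m)); [ring|rewrite e mulVKf].
move=> m n; have [m1|m1] := leP 0 m; have [n1|n1] := leP 0 n.
- by rewrite !gam_pos// => /(mulfI kk)/qinj.
- by rewrite gam_pos// gam_neg// => /mix.
- by rewrite gam_neg// gam_pos// => /esym/mix.
- by rewrite !gam_neg// => /(mulfI (invr_neq0 kk))/qinj.
Qed.

(* the constants that make T1 e + al e and Uop e + be e eigenvectors of Y when Y e = g e *)
Definition al (g : K) : K :=
  g * ((k1 p - (k1 p)^-1) * g + (k0 p - (k0 p)^-1)) / (1 - g ^+ 2).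
Definition be (g : K) : K :=
  (qh p * (u0 p - (u0 p)^-1) * g + (u1 p - (u1 p)^-1)) / (qpar p * g ^+ 2 - 1).

(** The factored form shows the zeros that genericity has to exclude, and at inverted parameters it
    becomes the coefficient of the action on the spectrum. *)
Lemma k1_al g : 1 - g ^+ 2 != 0 ->
  k1 p + al g = k1 p * ((1 + k0 p / k1 p * g) * (1 - g / (k0 p * k1 p)) / (1 - g ^+ 2)).
Proof.
by move=> g1; rewrite /al; field; rewrite k1N0 k0N0 g1.
Qed.

Lemma u1_be g : 1 - qpar p * g ^+ 2 != 0 ->
  u1 p + be g = (u1 p)^-1 * ((1 - qh p * u0 p * u1 p * g) * (1 + qh p * u1 p / u0 p * g)
                  / (1 - qpar p * g ^+ 2)).
Proof.
have -> : be g = - (qh p * (u0 p - (u0 p)^-1) * g + (u1 p - (u1 p)^-1)) / (1 - qpar p * g ^+ 2).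
  by rewrite /be -[qpar p * _ - 1]opprB invrN mulrN mulNr.
move=> g1; move: g1; rewrite /qpar => g1; field.
by rewrite exprMn g1 u1N0 u0N0.
Qed.

Lemma gam_den1 m : 1 - gam p m ^+ 2 != 0.
Proof. by rewrite subr_eq0 eq_sym; have := gam_sqr m 0; rewrite expr0z. Qed.

Lemma gam_denq m : 1 - qpar p * gam p m ^+ 2 != 0.
Proof.
rewrite subr_eq0; apply: contraNneq (gam_sqr m (-1)) => e.
by rewrite exprN1; apply/eqP/(mulfI q0); rewrite mulfV.
Qed.

Let Y := cherednikY p.
Let x0 := (k1 p * u1 p)^-1.

(** The list 1, x^{-1}, x, x^{-2}, ... is climbed by two alternating moves: T_1^vee leads from gam_m
    with m >= 0 to gam_{-m-1}, and T_1 from gam_{-m} with m > 0 to gam_m. The division keeps the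
    value at the base point equal to 1. *)
Fixpoint eig r : laurent K :=
  if r is r'.+1 then
    let g := gam p (rank_monom r') in
    if odd r' then (k1 p + al g)^-1 *: (T1 p (eig r') + al g *: eig r')
    else (u1 p + be g)^-1 *: (Uop p (eig r') + be g *: eig r')
  else delta K 0.

Let eigS r : eig r.+1 =
  if odd r then (k1 p + al (gam p (rank_monom r)))^-1 *:
    (T1 p (eig r) + al (gam p (rank_monom r)) *: eig r)
  else (u1 p + be (gam p (rank_monom r)))^-1 *:
    (Uop p (eig r) + be (gam p (rank_monom r)) *: eig r).
Proof. by []. Qed.

(** At gam_j with j < 0 the two factors vanish only for k_1^2 = -q^j and (k_0 k_1)^2 = q^j. For j >=
    0 the second factor would be 1 - q^j, zero at j = 0; odd positions avoid this. *)
Lemma k1_al_neq0 r : odd r -> k1 p + al (gam p (rank_monom r)) != 0.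
Proof.
move=> r1; rewrite k1_al ?gam_den1// mulf_neq0// mulf_neq0 ?invr_neq0 ?gam_den1//.
have rm : rank_monom r < 0 by rewrite /rank_monom r1; lia.
rewrite gam_neg//; set j := rank_monom r; rewrite mulf_neq0//.
  apply: contraNneq (alg_k1 pg j) => e; apply/eqP.
  have : k1 p ^+ 2 * (1 + k0 p / k1 p * ((k0 p * k1 p)^-1 * qpar p ^ j)) = 0.
    by rewrite e mulr0.
  have -> : k1 p ^+ 2 * (1 + k0 p / k1 p * ((k0 p * k1 p)^-1 * qpar p ^ j)) =
    k1 p ^+ 2 + qpar p ^ j by field; rewrite k1N0 k0N0.
  by move/eqP; rewrite addr_eq0 => /eqP.
apply: contraNneq (alg_k0k1 pg j) => e; apply/eqP.
have : (k0 p * k1 p) ^+ 2 * (1 - (k0 p * k1 p)^-1 * qpar p ^ j / (k0 p * k1 p)) = 0.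
  by rewrite e mulr0.
have -> : (k0 p * k1 p) ^+ 2 * (1 - (k0 p * k1 p)^-1 * qpar p ^ j / (k0 p * k1 p)) =
  (k0 p * k1 p) ^+ 2 - qpar p ^ j by field; rewrite k1N0 k0N0.
by move/eqP; rewrite subr_eq0 => /eqP.
Qed.

(** At gam_j with j >= 0 the two factors are 1 - ac q^j and 1 - ad q^j. *)
Lemma u1_be_neq0 r : ~~ odd r -> u1 p + be (gam p (rank_monom r)) != 0.
Proof.
move=> r1; rewrite u1_be ?gam_denq// mulf_neq0 ?invr_neq0// mulf_neq0 ?invr_neq0 ?gam_denq//.
have rm : 0 <= rank_monom r by rewrite /rank_monom (negbTE r1); lia.
rewrite gam_pos//; set j := rank_monom r.
have qj : qpar p ^ j != 0 by rewrite expfz_neq0.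
rewrite mulf_neq0//.
  apply: contraNneq (alg_ac pg (- j)) => e; apply/eqP.
  rewrite -invr_expz; apply: (mulIf qj); rewrite mulVf//.
  by apply/esym/eqP; rewrite -subr_eq0 -[X in _ == X]e; apply/eqP; ring.
apply: contraNneq (alg_ad pg (- j)) => e; apply/eqP.
rewrite -invr_expz; apply: (mulIf qj); rewrite mulNr mulVf//.
by apply/esym/eqP; rewrite -subr_eq0 -opprB oppr_eq0 opprK -[X in _ == X]e; apply/eqP; ring.
Qed.

(** The intertwiners give the eigenvalue, and the base point gives the normalization. By
    [T1_support], the new leading coefficient is the old one times k_1 (odd r) or k_1^{-1} (even r),
    up to the normalizing factor, because the old vector has no term at the new position. *)
Lemma eigP r : [/\ Y (eig r) = gam p (rank_monom r) *: eig r,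
  leval (eig r) x0 = 1, eig r (rank_monom r) != 0 &
  forall n, eig r n != 0 -> (monom_rank n <= r)%N].
Proof.
have a1 := alg_base pg.
elim: r => [|r [Yr er lr sr]].
  have d0 n : delta K (0 : int) n = (n == 0)%:R by [].
  have s0 n : delta K (0 : int) n != 0 -> (monom_rank n <= 0)%N.
    by rewrite d0; have [->|_] := eqVneq n 0; rewrite ?mulr0n ?eqxx.
  split; rewrite /= ?leval_delta// ?d0 ?eqxx ?oner_neq0//.
  - have T1d : T1 p (delta K 0) = k1 p *: delta K 0.
      apply: (@leval_inj _ [:: 1; -1]) => x x00 /leval1_notin x1.
      by rewrite levalZ T1E// !leval_delta !expr0z subrr mulr0 addr0.
    have T0d : T0 p (delta K 0) = k0 p *: delta K 0.
      apply: (@leval_inj _ [:: qh p; - qh p]) => x x00 /leval0_notin x1.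
      rewrite levalZ T0E// ?leval_delta ?expr0z ?subrr ?mulr0 ?addr0//.
      have -> : 1 - qpar p * x ^- 2 = - (qpar p - x ^+ 2) / x ^+ 2 by field.
      by rewrite mulf_neq0// ?oppr_eq0// invr_neq0// expf_neq0.
    rewrite -[LHS]/(T1 p (T0 p (delta K 0))) T0d (endoEZr (T1 p)) T1d scalerA.
    by rewrite gam_pos// expr0z mulr1.
set g := gam p (rank_monom r) in Yr *.
have g0 : g != 0 by apply: gam_neq0.
rewrite eigS -/g; case: ifP => r1.
  have c0 : k1 p + al g != 0 by apply: k1_al_neq0.
  have hal : al g * (1 - g ^+ 2) = g * ((k1 p - (k1 p)^-1) * g + (k0 p - (k0 p)^-1)).
    by rewrite /al mulfVK// gam_den1.
  pose m := uphalf r; have [rE rE'] := rank_monom_odd r1.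
  have rm : r.+1 = m.*2 := odd_doubleE r1.
  have supp n : eig r n != 0 -> (`|n| <= m)%N.
    by move/sr; rewrite -ltnS rm monom_rank_lt_double => /andP[].
  have em : eig r m = 0.
    by apply/eqP; apply/negP => /negP/sr; rewrite -ltnS rm monom_rank_lt_double eqxx andbF.
  have [Ts Tm _] := T1_support qh0 par0 supp.
  split.
  - rewrite (endoEZr Y) (eigen_T1 qh0 par0 g0 Yr hal) scalerA mulrC -scalerA; congr (_ *: _).
    have m0 : rank_monom r != 0 by rewrite rE oppr_eq0 -[0]/(0%:Z) eqz_nat /m; case: (r) r1.
    by rewrite rE' -[(uphalf r)%:Z]opprK -rE gamN.
  - by rewrite levalZ levalD levalZ leval_T1_base// er mulr1 mulr1 mulVf.
  - rewrite rE' finsuppZE finsuppDE finsuppZE Tm em mulr0 addr0 -rE.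
    by rewrite !mulf_neq0// invr_neq0.
  - move=> n; rewrite finsuppZE finsuppDE finsuppZE => en.
    have : (`|n| <= m)%N.
      have [Tn|/Ts//] := eqVneq (T1 p (eig r) n) 0.
      apply: supp; apply: contraNneq en => en.
      by rewrite Tn en mulr0 addr0 mulr0.
    by rewrite rm monom_rank_le_double.
have c0 : u1 p + be g != 0 by apply: u1_be_neq0; rewrite r1.
have hbe : be g * (qpar p * g ^+ 2 - 1) = qh p * (u0 p - (u0 p)^-1) * g + (u1 p - (u1 p)^-1).
  by rewrite /be mulfVK// -opprB oppr_eq0 gam_denq.
move/negbT: (r1) => r1'.
pose m := r./2; have [rE rE'] := rank_monom_even r1'.
have rm : r = m.*2 := even_doubleE r1'.
have supp n : eig r n != 0 -> (`|n| <= m)%N by move/sr; rewrite {1}rm monom_rank_le_double.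
have em : eig r (- m%:Z - 1) = 0.
  by apply/eqP; apply/negP => /negP/sr; rewrite monom_rank_oppS {1}rm ltnn.
have [Ts Tm Tm'] := T1_support qh0 par0 supp.
have UE := Uop_coef p (eig r).
split.
- rewrite (endoEZr Y) (eigen_Uop qh0 par0 g0 Yr hbe) scalerA mulrC -scalerA; congr (_ *: _).
  by rewrite rE' -rE gamNB1.
- by rewrite levalZ levalD levalZ leval_Uop_base// er mulr1 mulr1 mulVf.
- rewrite rE' finsuppZE finsuppDE finsuppZE em mulr0 addr0 UE subrK Tm'.
  have -> : k1 p * eig r (- m%:Z) + (k1 p)^-1 * (eig r m - eig r (- m%:Z)) -
    (k1 p - (k1 p)^-1) * eig r (- m%:Z) = (k1 p)^-1 * eig r m by ring.
  by rewrite -rE !mulf_neq0// invr_neq0.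
- move=> n; rewrite finsuppZE finsuppDE finsuppZE UE => en.
  have [en0|/sr] := eqVneq (eig r n) 0; last exact: leqW.
  have nm : (`|(n + 1)%R| <= m)%N.
    have [Tn|/Ts//] := eqVneq (T1 p (eig r) (n + 1)) 0.
    apply: supp; apply: contraNneq en => en.
    by rewrite Tn en en0 !mulr0 subrr addr0 mulr0.
  have nm' : n != m.
    by apply: contraNneq lr => nm'; rewrite rE -nm' en0.
  by rewrite rm monom_rank_le_doubleS.
Qed.

Lemma eig_free N (d : nat -> K) : \sum_(0 <= i < N) d i *: eig i = 0 ->
  forall i, (i < N)%N -> d i = 0.
Proof.
elim: N => [//|N IH]; rewrite big_nat_recr//= => s0.
have dN : d N = 0.
  have := congr1 (fun f : laurent K => f (rank_monom N)) s0.
  rewrite finsuppDE finsuppZE finsupp_sumE big_nat big1 ?add0r => [/eqP|i iN].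
    rewrite mulf_eq0 => /orP[/eqP//|].
    by have [_ _ /negbTE -> _] := eigP N.
  rewrite finsuppZE; have [->|e0] := eqVneq (eig i (rank_monom N)) 0; first by rewrite mulr0.
  by have [_ _ _ /(_ _ e0)] := eigP i; rewrite rank_monomK; lia.
move: s0; rewrite dN scale0r addr0 => /IH h i; rewrite ltnS leq_eqVlt => /predU1P[->//|].
exact: h.
Qed.

Lemma eig_gen f : exists N (d : nat -> K), f = \sum_(0 <= i < N) d i *: eig i.
Proof.
have [N fN] : exists N, forall n, f n != 0 -> (monom_rank n < N)%N.
  have [M fM] := laurent_bounded f; exists M.*2.+1 => n /fM.
  by rewrite ltnS monom_rank_le_double.
exists N; elim: N f fN => [|N IH] f fN.
  exists (fun=> 0); rewrite big_nil; apply: finsupp_ext => n.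
  by apply/eqP/negP => /negP/fN.
have [_ _ lN sN] := eigP N.
pose c := f (rank_monom N) / eig N (rank_monom N).
have [n|d hd] := IH (f - c *: eig N).
  have fE : (f - c *: eig N) n = f n - c * eig N n by [].
  rewrite fE => fn; have nN : (monom_rank n <= N)%N.
    have [f0|/fN//] := eqVneq (f n) 0; apply: sN.
    by apply: contraNneq fn => ->; rewrite f0 mulr0 subrr.
  rewrite ltn_neqAle nN andbT; apply: contraNneq fn => nE.
  by rewrite -[n]monom_rankK nE /c divfK// subrr.
exists (fun i => if (i < N)%N then d i else c); rewrite big_nat_recr//= ltnn.
rewrite big_nat (eq_bigr (fun i => d i *: eig i)) => [|i /andP[_ ->]//].
by rewrite -big_nat -hd subrK.
Qed.

(** At inverted parameters the base point [x0] becomes k_1 u_1, and this is the polynomial E' of the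
    transform. *)
Definition nsE m : laurent K := eig (monom_rank m).

Lemma nsE_eigen m : Y (nsE m) = gam p m *: nsE m.
Proof. by rewrite /nsE; have [-> _ _ _] := eigP (monom_rank m); rewrite monom_rankK. Qed.

Lemma nsE_base m : leval (nsE m) x0 = 1.
Proof. by have [] := eigP (monom_rank m). Qed.

(** The [eig] form a basis with pairwise distinct eigenvalues, so every eigenspace is a line, and
    the value at the base point is a coordinate on it. *)
Lemma eigenspace_nsE m f : Y f = gam p m *: f -> f = leval f x0 *: nsE m.
Proof.
have [N [d ->]] := eig_gen f; rewrite (endo_sumE Y) scaler_sumr => /eqP.
rewrite -subr_eq0 -sumrB => /eqP h.
pose d' i := (gam p (rank_monom i) - gam p m) * d i.
have /eig_free d0 : \sum_(0 <= i < N) d' i *: eig i = 0.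
  rewrite -[RHS]h; apply: eq_bigr => i _; have [Ye _ _ _] := eigP i.
  by rewrite (endoEZr Y) Ye !scalerA -scalerBl; congr (_ *: _); rewrite /d'; ring.
have -> : \sum_(0 <= i < N) d i *: eig i =
    (if (monom_rank m < N)%N then d (monom_rank m) else 0) *: nsE m.
  have dE i : (i < N)%N -> i != monom_rank m -> d i = 0.
    move=> iN im; have /eqP := d0 i iN; rewrite mulf_eq0 subr_eq0 => /orP[/eqP/gam_inj e|/eqP//].
    by case/eqP: im; rewrite -e rank_monomK.
  case: ifP => mN.
    rewrite (bigD1_seq (monom_rank m))/= ?mem_index_iota ?iota_uniq//.
    by rewrite big_nat_cond big1 ?addr0// => i /andP[/andP[_ iN] im]; rewrite dE// scale0r.
  rewrite scale0r big_nat big1// => i /andP[_ iN]; rewrite dE ?scale0r//.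
  by apply: contraFneq mN => <-.
by rewrite levalZ nsE_base mulr1.
Qed.

(** [nsAW] is a chosen witness, so a polynomial with its properties is exhibited first, by rescaling
    [nsE] to leading coefficient 1. The chosen one then lies on the same eigenline. *)
Lemma nsAW_normalized m : (leval (nsAW p m) x0)^-1 *: nsAW p m = nsE m.
Proof.
have [Ye e1 lm sm] := eigP (monom_rank m); move: Ye e1 lm sm.
rewrite monom_rankK -/(nsE m) => Ye e1 lm sm.
have [P1 P2 PY] : is_nsAW p m (nsAW p m).
  apply: (@xgetI _ 0 [set P | is_nsAW p m P] ((nsE m m)^-1 *: nsE m)); split.
  - by rewrite finsuppZE mulVf.
  - move=> n; rewrite finsuppZE mulf_eq0 negb_or => /andP[_ /sm nm nm'].
    rewrite ltn_neqAle nm andbT; apply: contraNneq nm' => e.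
    by rewrite -[n]monom_rankK e monom_rankK.
  - by rewrite -/Y (endoEZr Y) Ye !scalerA mulrC.
have PE := eigenspace_nsE PY; set c := leval (nsAW p m) x0 in PE *.
(* Value 0 at the base point would make the whole polynomial 0, against leading coefficient 1. *)
have c0 : c != 0.
  apply/eqP => c0; have := P1; rewrite PE c0 scale0r finsupp0E => /eqP.
  by rewrite eq_sym oner_eq0.
by rewrite {1}PE scalerA mulVf// scale1r.
Qed.

(** For m != 0, T_1 E + al E lies on the eigenline of gam_{-m}, and its base value k_1 + al is the
    coefficient. At m = 0 the inverse of gam_0 is not an eigenvalue of the list, and T_1 1 = k_1 is
    used instead. *)
Lemma T1_nsE m : T1 p (nsE m) =
  k1 p *: nsE m + (k1 p + al (gam p m)) *: (nsE (- m) - nsE m).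
Proof.
set g := gam p m; have hal : al g * (1 - g ^+ 2) =
    g * ((k1 p - (k1 p)^-1) * g + (k0 p - (k0 p)^-1)).
  by rewrite /al mulfVK// gam_den1.
have Yw := eigen_T1 qh0 par0 (gam_neq0 m) (nsE_eigen m) hal.
have wb : leval (T1 p (nsE m) + al g *: nsE m) x0 = k1 p + al g.
  by rewrite levalD levalZ leval_T1_base ?alg_base// nsE_base !mulr1.
have [m0|m0] := eqVneq m 0; last first.
  move: Yw; rewrite -gamN// => /eigenspace_nsE; rewrite wb => e.
  have -> : T1 p (nsE m) = (k1 p + al g) *: nsE (- m) - al g *: nsE m by rewrite -e addrK.
  rewrite scalerBr addrCA; congr (_ + _).
  by rewrite scalerDl opprD addrA subrr sub0r.
rewrite m0 oppr0 subrr scaler0 addr0.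
have : Y (T1 p (nsE 0)) = gam p 0 *: T1 p (nsE 0).
  have T1d : T1 p (delta K 0) = k1 p *: delta K 0.
    apply: (@leval_inj _ [:: 1; -1]) => x x00 /leval1_notin x1.
    by rewrite levalZ T1E// !leval_delta !expr0z subrr mulr0 addr0.
  have nsE0 : nsE 0 = delta K 0 by [].
  by rewrite nsE0 T1d -nsE0 (endoEZr Y) (nsE_eigen 0) !scalerA mulrC.
by move/eigenspace_nsE; rewrite leval_T1_base ?alg_base// nsE_base mulr1.
Qed.

Lemma Uop_nsE m : Uop p (nsE m) =
  u1 p *: nsE m + (u1 p + be (gam p m)) *: (nsE (- m - 1) - nsE m).
Proof.
set g := gam p m; have hbe : be g * (qpar p * g ^+ 2 - 1) =
    qh p * (u0 p - (u0 p)^-1) * g + (u1 p - (u1 p)^-1).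
  by rewrite /be mulfVK// -opprB oppr_eq0 gam_denq.
have Yw := eigen_Uop qh0 par0 (gam_neq0 m) (nsE_eigen m) hbe.
have wb : leval (Uop p (nsE m) + be g *: nsE m) x0 = u1 p + be g.
  by rewrite levalD levalZ leval_Uop_base ?alg_base// nsE_base !mulr1.
move: Yw; rewrite -gamNB1// => /eigenspace_nsE; rewrite wb => e.
have -> : Uop p (nsE m) = (u1 p + be g) *: nsE (- m - 1) - be g *: nsE m by rewrite -e addrK.
rewrite scalerBr addrCA; congr (_ + _).
by rewrite scalerDl opprD addrA subrr sub0r.
Qed.

End Eigenbasis.

(** * The action on the spectrum *)

Lemma subalg_ind (K : fieldType) (B : algType K) (S : set B) (Q : subalg S -> Prop) :
  (forall X : subalg S, S X -> Q X) -> Q 1 ->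
  (forall a X Y, Q X -> Q Y -> Q (a *: X + Y)) ->
  (forall X Y, Q X -> Q Y -> Q (X * Y)) -> forall X, Q X.
Proof.
move=> QS Q1 Ql Qm X.
pose P : {pred B} := fun Y => `[< exists2 Z : subalg S, subalg_val Z = Y & Q Z >].
have /asboolP gX := subalgP X.
suff /asboolP[Z ZX QZ] : subalg_val X \in P by have <- : Z = X by exact/val_inj.
apply: gX.
- split=> [|a Y Z /asboolP hY /asboolP hZ|Y Z /asboolP hY /asboolP hZ]; apply/asboolP.
  + by exists 1.
  + have [Y' eY QY] := hY; have [Z' eZ QZ] := hZ.
    by exists (a *: Y' + Z'); [rewrite /= eY eZ|exact: Ql].
  + have [Y' eY QY] := hY; have [Z' eZ QZ] := hZ.
    by exists (Y' * Z'); [rewrite /= eY eZ|exact: Qm].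
- by move=> Y SY; apply/asboolP; exists (Subalg (mem_gen_subalg SY)) => //; apply: QS.
Qed.

Section SpectralAction.
Variables (K : numFieldType) (p : params K).
Hypothesis pg : alg_generic p.
Implicit Types (f : laurent K) (g : specfun p) (m n : int).

Let qh0 := alg_qh pg.
Let k0N0 : k0 p != 0. Proof. by case: (alg_neq0 pg). Qed.
Let k1N0 : k1 p != 0. Proof. by case: (alg_neq0 pg). Qed.
Let q0 : qpar p != 0. Proof. by rewrite expf_neq0. Qed.

Lemma gam'_inj : injective (gam' p).
Proof. by move=> m n /invr_inj/(gam_inj pg). Qed.

Lemma gam'_neq0 m : gam' p m != 0.
Proof. by rewrite invr_neq0// (gam_neq0 pg). Qed.

Lemma spec_inj : injective (spec p).
Proof. by move=> m n /(congr1 (fun w : spectrum p => sval w)) /= /gam'_inj. Qed.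

Lemma specP (w : spectrum p) : exists m, spec p m = w.
Proof.
case: w => x hx; have [m _ mx] := set_mem hx; exists m; case: x / mx hx => hx.
by rewrite /spec (Prop_irrelevance (spec_subproof p m) hx).
Qed.

Definition spec_index (w : spectrum p) : int := projT1 (cid (specP w)).
Lemma spec_indexK w : spec p (spec_index w) = w.
Proof. by rewrite /spec_index; case: cid. Qed.
Lemma specK m : spec_index (spec p m) = m.
Proof. by apply: spec_inj; rewrite spec_indexK. Qed.

Lemma specfun_ext g g' : (forall m, g (spec p m) = g' (spec p m)) -> g = g'.
Proof. by move=> h; apply: finsupp_ext => w; rewrite -[w]spec_indexK. Qed.

Section SpectralOperator.
Variables (A B : int -> K) (sg : int -> int).
Hypothesis sgK : involutive sg.

Definition spec_op_fun g : spectrum p -> K := fun w =>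
  A (spec_index w) * g w + B (spec_index w) * g (spec p (sg (spec_index w))).

Fact spec_op_subproof g : (spec_op_fun g : spectrum p -> K^o) \in @has_finsupp _ K.
Proof.
apply/asboolP; pose tau (w : spectrum p) := spec p (sg (spec_index w)).
have := finite_image tau (finsupp_finite g) => fin.
have : finite_set ([set w | g w != 0] `|` tau @` [set w | g w != 0]).
  by rewrite finite_setU; split=> //; apply: finsupp_finite.
apply: sub_finite_set => w /=; rewrite /spec_op_fun => h.
have [gw|gw] := eqVneq (g w) 0; last by left.
right; exists (tau w); last by rewrite /tau specK sgK spec_indexK.
by apply: contraNneq h => gt; rewrite gw -/(tau w) gt !mulr0 addr0.
Qed.
Definition spec_op_val g : specfun p := Finsupp (spec_op_subproof g).

Fact spec_op_linear : linear spec_op_val.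
Proof.
move=> k f g; apply: finsupp_ext => w.
by rewrite finsuppDE finsuppZE /= /spec_op_fun !finsuppDE !finsuppZE; ring.
Qed.
HB.instance Definition _ :=
  GRing.isLinear.Build K (specfun p) (specfun p) *:%R spec_op_val spec_op_linear.
Definition spec_op : endo (spectrum p) K := spec_op_val.

Lemma spec_opE g m : spec_op g (spec p m) = A m * g (spec p m) + B m * g (spec p (sg m)).
Proof. by rewrite /= /spec_op_fun specK. Qed.

End SpectralOperator.

(* X and M are given by the same formula, X on the values of Laurent polynomials
   on the spectrum and M on finitely supported functions *)
Definition compatible (X : endo int K) (M : endo (spectrum p) K) := forall m,
  exists S : seq int, forall f g, (forall n, n \in S -> leval f (gam' p n) = g (spec p n)) ->
    leval (X f) (gam' p m) = M g (spec p m).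

Lemma spectral_interpolation g (S : seq int) :
  exists f, forall n, n \in S -> leval f (gam' p n) = g (spec p n).
Proof.
pose v x := xget 0 [set y | exists n, gam' p n = x /\ y = g (spec p n)].
have vE n : v (gam' p n) = g (spec p n).
  have [m [/gam'_inj mn ->]] : [set y | exists m, gam' p m = gam' p n /\
      y = g (spec p m)] (v (gam' p n)).
    by apply: (@xgetI _ 0 [set y | exists m, gam' p m = gam' p n /\ y = g (spec p m)] (g (spec p n))); exists n.
  by rewrite mn.
have [||f hf] := @laurent_interpolation K (undup [seq gam' p n | n <- S]) v.
- exact: undup_uniq.
- by rewrite mem_undup; apply/mapP => -[n _ /eqP]; rewrite eq_sym (negbTE (gam'_neq0 n)).
- by exists f => n nS; rewrite hf ?vE// mem_undup map_f.
Qed.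

Lemma compatible_unique X M N : compatible X M -> compatible X N -> M = N.
Proof.
move=> hM hN; apply: endoP => g; apply: specfun_ext => m.
have [S hS] := hM m; have [S' hS'] := hN m.
have [f hf] := spectral_interpolation g (S ++ S').
by rewrite -(hS f) ?(hS' f g)// => n nS; apply: hf; rewrite mem_cat nS ?orbT.
Qed.

Lemma compatible1 : compatible 1 1.
Proof.
by move=> m; exists [:: m] => f g h; rewrite !endo1E h// mem_head.
Qed.

Lemma compatible_lin a X Y M N : compatible X M -> compatible Y N ->
  compatible (a *: X + Y) (a *: M + N).
Proof.
move=> hX hY m; have [S hS] := hX m; have [S' hS'] := hY m; exists (S ++ S') => f g h.
rewrite !endoDE !endoZE finsuppDE finsuppZE levalD levalZ (hS f g) ?(hS' f g)// => n nS.
all: by apply: h; rewrite mem_cat nS ?orbT.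
Qed.

(** The points that matter for X Y at m are those that matter for Y at each of the finitely many
    points that matter for X. *)
Lemma compatibleM X Y M N : compatible X M -> compatible Y N -> compatible (X * Y) (M * N).
Proof.
move=> hX hY m; have [S hS] := hX m; have [S_ hS_] := choice hY.
exists (flatten [seq S_ n | n <- S]) => f g h; rewrite !endoME; apply: hS => n nS.
by apply: hS_ => k kS; apply/h/flatten_mapP; exists n.
Qed.

Definition coefT1 m : K := (k1 p)^-1 * ((1 - k0 p * k1 p * gam' p m)
  * (1 + (k0 p)^-1 * k1 p * gam' p m) / (1 - gam' p m ^+ 2)).
Definition coefT0 m : K := (u1 p)^-1 * ((1 - u0 p * u1 p * qh p * (gam' p m)^-1)
  * (1 + (u0 p)^-1 * u1 p * qh p * (gam' p m)^-1) / (1 - qpar p * gam' p m ^- 2)).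

Let oppS_invol : involutive (fun m : int => - m - 1).
Proof. by move=> m; lia. Qed.

Definition specT1 := spec_op (fun m => k1 p - coefT1 m) coefT1 (@opprK int).
Definition specT0 := spec_op (fun m => u1 p - coefT0 m) coefT0 oppS_invol.
Definition specz := spec_op (gam' p) (fun=> 0) (@opprK int).
Definition speczinv := spec_op (gam p) (fun=> 0) (@opprK int).

Lemma compatible_z : compatible (zmul K) specz.
Proof.
move=> m; exists [:: m] => f g h; rewrite spec_opE mul0r addr0 leval_zmul ?gam'_neq0//.
by rewrite h// mem_head.
Qed.

Lemma compatible_zinv : compatible (zinv K) speczinv.
Proof.
move=> m; exists [:: m] => f g h; rewrite spec_opE mul0r addr0 leval_zinv ?gam'_neq0//.
by rewrite h ?mem_head// invrK.
Qed.

Lemma compatible_T1 : compatible (T1 (dual p)) specT1.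
Proof.
move=> m; exists [:: m; - m] => f g h; rewrite spec_opE.
have hm : leval f (gam' p m) = g (spec p m) by rewrite h// mem_head.
have hm' : leval f (gam' p (- m)) = g (spec p (- m)) by rewrite h// !inE eqxx orbT.
have g1 : 1 - gam' p m ^+ 2 != 0.
  have -> : 1 - gam' p m ^+ 2 = - (1 - gam p m ^+ 2) / gam p m ^+ 2.
    by rewrite /gam'; field; rewrite (gam_neq0 pg).
  by rewrite mulf_neq0 ?oppr_eq0 ?(gam_den1 pg)// invr_neq0// expf_neq0// (gam_neq0 pg).
rewrite T1E ?gam'_neq0// hm /= -/(coefT1 m).
have -> : (k1 p)^-1 * ((1 - k1 p * k0 p * gam' p m) * (1 + k1 p / k0 p * gam' p m)
  / (1 - gam' p m ^+ 2)) = coefT1 m.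
  by rewrite /coefT1 [k1 p * k0 p]mulrC [k1 p / k0 p]mulrC.
(* The reflected point 1/gam'_0 is not gam'_0, so the two formulas agree at m = 0 only because the
   coefficient vanishes. *)
have [->|m0] := eqVneq m 0.
  have -> : coefT1 0 = 0.
    have kk : k0 p * k1 p != 0 by rewrite mulf_neq0.
    by rewrite /coefT1 /gam' gam_pos// expr0z mulr1 (mulfV kk) subrr !mul0r mulr0.
  by rewrite subr0 !mul0r.
have -> : (gam' p m)^-1 = gam' p (- m) by rewrite /gam' (gamN pg).
by rewrite hm'; ring.
Qed.

Lemma compatible_T0 : compatible (T0 (dual p)) specT0.
Proof.
move=> m; exists [:: m; - m - 1] => f g h; rewrite spec_opE.
have hm : leval f (gam' p m) = g (spec p m) by rewrite h// mem_head.
have hm' : leval f (gam' p (- m - 1)) = g (spec p (- m - 1)) by rewrite h// !inE eqxx orbT.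
have g1 : 1 - qpar (dual p) * gam' p m ^- 2 != 0.
  by rewrite /gam' exprVn invrK (gam_denq pg).
have -> : T0 (dual p) f = T0 (dual p) f by [].
rewrite (@T0E _ (dual p) qh0 f _ (gam'_neq0 m) g1) hm.
have -> : qpar (dual p) / gam' p m = gam' p (- m - 1).
  by rewrite /gam' (gamNB1 pg) !invrK.
rewrite hm' /= /coefT0.
have -> : qpar (dual p) = qpar p by [].
by ring.
Qed.

Lemma compatible_ex (X : daha (dual p)) : exists M, compatible (subalg_val X) M.
Proof.
elim/subalg_ind: X => [X [[[]|]|] /= ->|||].
- by exists specT0; apply: compatible_T0.
- by exists specT1; apply: compatible_T1.
- by exists specz; apply: compatible_z.
- by exists speczinv; apply: compatible_zinv.
- by exists 1; apply: compatible1.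
- by move=> a X Y [M hM] [N hN]; exists (a *: M + N); exact: (compatible_lin a hM hN).
- by move=> X Y [M hM] [N hN]; exists (M * N); exact: (compatibleM hM hN).
Qed.

(** The choice is forced by [compatible_unique]; linearity and multiplicativity follow from the same
    uniqueness. *)
Definition rho_fun (X : daha (dual p)) : endo (spectrum p) K :=
  projT1 (cid (compatible_ex X)).

Lemma rho_compatible X : compatible (subalg_val X) (rho_fun X).
Proof. by rewrite /rho_fun; case: cid. Qed.

Fact rho_linear : linear rho_fun.
Proof.
move=> a X Y; apply: (compatible_unique (rho_compatible _)).
exact: (compatible_lin a (rho_compatible X) (rho_compatible Y)).
Qed.
HB.instance Definition _ := GRing.isLinear.Build K (daha (dual p)) (endo (spectrum p) K)
  *:%R rho_fun rho_linear.

Fact rho_monoid : monoid_morphism rho_fun.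
Proof.
split=> [|X Y]; apply: (compatible_unique (rho_compatible _)); first exact: compatible1.
exact: (compatibleM (rho_compatible X) (rho_compatible Y)).
Qed.
HB.instance Definition _ := GRing.isMonoidMorphism.Build (daha (dual p))
  (endo (spectrum p) K) rho_fun rho_monoid.
Definition rho : {lrmorphism daha (dual p) -> endo (spectrum p) K} := rho_fun.

Lemma rho_spectral : is_spectral_action rho.
Proof.
split=> g m.
- have -> : rho (hz (dual p)) = specz.
    exact: (compatible_unique (rho_compatible (hz (dual p))) compatible_z).
  by rewrite spec_opE mul0r addr0.
- have -> : rho (hT0 (dual p)) = specT0.
    exact: (compatible_unique (rho_compatible (hT0 (dual p))) compatible_T0).
  by rewrite spec_opE -/(coefT0 m); ring.
- have -> : rho (hT1 (dual p)) = specT1.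
    exact: (compatible_unique (rho_compatible (hT1 (dual p))) compatible_T1).
  by rewrite spec_opE -/(coefT1 m); ring.
Qed.

Lemma spectral_action_unique (rho1 rho2 : {lrmorphism daha (dual p) -> endo (spectrum p) K}) :
  is_spectral_action rho1 -> is_spectral_action rho2 -> rho1 =1 rho2.
Proof.
move=> h1 h2; have ez : rho1 (hz (dual p)) = rho2 (hz (dual p)).
  by apply: endoP => g; apply: specfun_ext => m; rewrite (action_z h1) (action_z h2).
have zz : hz (dual p) * hzinv (dual p) = 1 by apply/val_inj; exact: zmul_zinv.
have zz' : hzinv (dual p) * hz (dual p) = 1 by apply/val_inj; exact: zinv_zmul.
elim/subalg_ind => [X hX|||].
- have gen (Z : daha (dual p)) : subalg_val X = subalg_val Z -> rho1 Z = rho2 Z -> rho1 X = rho2 X.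
    by move=> /val_inj ->.
  case: hX => [[[]|]|] /= e.
  + apply: (gen (hT0 (dual p))) => //; apply: endoP => g; apply: specfun_ext => m.
    by rewrite (action_T0 h1) (action_T0 h2).
  + apply: (gen (hT1 (dual p))) => //; apply: endoP => g; apply: specfun_ext => m.
    by rewrite (action_T1 h1) (action_T1 h2).
  + exact: (gen (hz (dual p))).
  (* The specification has no formula for z^{-1}; its image is forced as the inverse of the image of
     z. *)
  + apply: (gen (hzinv (dual p))) => //.
    have e1 : rho1 (hzinv (dual p)) * rho1 (hz (dual p)) = 1 by rewrite -rmorphM zz' rmorph1.
    have e2 : rho2 (hz (dual p)) * rho2 (hzinv (dual p)) = 1 by rewrite -rmorphM zz rmorph1.
    by rewrite -[LHS]mulr1 -e2 -ez mulrA e1 mul1r.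
- by rewrite !rmorph1.
- move=> a X Y hX hY; transitivity (a *: rho1 X + rho1 Y); first exact: linearP.
  by rewrite hX hY; apply/esym/linearP.
- move=> X Y hX hY; transitivity (rho1 X * rho1 Y); first exact: rmorphM.
  by rewrite hX hY; apply/esym/rmorphM.
Qed.

End SpectralAction.

(** * Contour integrals *)

Section ComplexNorm.
Variable R : realType.
Implicit Types (x y z : R[i]).

Lemma normcEr z : `|z| = (normc z)%:C%C. Proof. by case: z. Qed.
Lemma normc_ge0 z : 0 <= normc z. Proof. by case: z => a b; rewrite sqrtr_ge0. Qed.
Lemma normc_triangle x y : normc (x + y) <= normc x + normc y.
Proof. by rewrite -lecR rmorphD -!normcEr ler_normD. Qed.
Lemma normc_opp x : normc (- x) = normc x.
Proof. by case: x => a b; rewrite /= !sqrrN. Qed.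
Lemma normc_sub x y : normc (x - y) = normc (y - x).
Proof. by rewrite -normc_opp opprB. Qed.
Lemma normc_triangleB x y : normc (x - y) <= normc x + normc y.
Proof. by rewrite -(normc_opp y) normc_triangle. Qed.
Lemma normc_dist z x y : normc (x - y) <= normc (x - z) + normc (z - y).
Proof. by rewrite -{1}(subrK z x) -addrA normc_triangle. Qed.
Lemma normcr (r : R) : normc r%:C%C = `|r|.
Proof. by rewrite /= expr0n /= addr0 sqrtr_sqr. Qed.
Lemma normc_eq0 x : (normc x == 0) = (x == 0).
Proof. by apply/eqP/eqP => [/eq0_normc|->]//; rewrite normc0. Qed.
Lemma normc_gt0 x : (0 < normc x) = (x != 0).
Proof. by rewrite lt_def normc_ge0 normc_eq0 andbT. Qed.
Lemma normcX x n : normc (x ^+ n) = normc x ^+ n.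
Proof. by elim: n => [|n IH]; rewrite ?expr0 ?normc1// !exprS normcM IH. Qed.
Lemma normc_sum (I : Type) (s : seq I) (P : pred I) (F : I -> R[i]) :
  normc (\sum_(i <- s | P i) F i) <= \sum_(i <- s | P i) normc (F i).
Proof.
elim/big_rec2: _ => [|i a b _ ab]; first by rewrite normc0.
by apply: (le_trans (normc_triangle _ _)); rewrite lerD2l.
Qed.
Lemma normc_le_Re_Im z : normc z <= `|complex.Re z| + `|complex.Im z|.
Proof.
case: z => a b /=; rewrite -[leRHS]ger0_norm ?addr_ge0// -sqrtr_sqr ler_wsqrtr//.
by rewrite sqrrD !real_normK ?num_real// lerD2r lerDl mulrn_wge0// mulr_ge0.
Qed.
Lemma Re_le_normc z : `|complex.Re z| <= normc z.
Proof.
by case: z => a b /=; rewrite -sqrtr_sqr ler_wsqrtr// lerDl sqr_ge0.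
Qed.
Lemma Im_le_normc z : `|complex.Im z| <= normc z.
Proof.
by case: z => a b /=; rewrite -sqrtr_sqr ler_wsqrtr// lerDr sqr_ge0.
Qed.

End ComplexNorm.

(** * Riemann-Stieltjes integrals along a closed rectifiable curve *)

Section ContourIntegral.
Variables (R : realType) (c : R -> R[i]).
Hypotheses (c_cont : {within `[0, 1], continuous c}) (c_closed : c 0 = c 1)
  (c_rect : rectifiable c).
Implicit Types (f g F G : R[i] -> R[i]) (I J : R[i]) (s : seq R) (xi : nat -> R).

Local Notation ci := (is_contour_integral c).
Local Notation K := (trace c).

Definition tagged_partition (d : R) s xi := [/\ itv_partition 0 1 s,
  forall i, (i < size s)%N -> node s i.+1 - node s i < d
  & forall i, (i < size s)%N -> node s i <= xi i <= node s i.+1].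

Lemma contour_integralP f I : ci f I <-> forall eps, 0 < eps ->
  exists2 d, 0 < d & forall s xi, tagged_partition d s xi ->
    normc (riemann_sum c f s xi - I) < eps.
Proof.
split=> h eps eps0; have [d d0 hd] := h _ eps0; exists d => // s xi.
  by case=> s1 s2 s3; have := hd s xi s1 s2 s3; rewrite normcEr ltcR.
by move=> s1 s2 s3; rewrite normcEr ltcR; apply: hd.
Qed.

Lemma tagged_partition_le (d e : R) s xi : d <= e -> tagged_partition d s xi ->
  tagged_partition e s xi.
Proof. by move=> de [h1 h2 h3]; split=> // i /h2 /lt_le_trans; apply. Qed.

Lemma node_itv s i : itv_partition 0 1 s -> (i <= size s)%N -> 0 <= node s i <= 1.
Proof.
move=> hs i_s; apply/andP; split.
  by apply: itv_partition_nth_ge hs.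
by apply: itv_partition_nth_le hs.
Qed.

Lemma trace_node s i : itv_partition 0 1 s -> (i <= size s)%N -> K (c (node s i)).
Proof. by move=> hs i_s; exists (node s i) => //=; rewrite in_itv/= node_itv. Qed.

Lemma tag_itv d s xi i : tagged_partition d s xi -> (i < size s)%N -> 0 <= xi i <= 1.
Proof.
case=> hs _ ht i_s; have /andP[x1 x2] := ht _ i_s.
have /andP[n1 _] := node_itv hs (ltnW i_s); have /andP[_ n2] := node_itv hs i_s.
by rewrite (le_trans n1)//= (le_trans x2).
Qed.

Lemma trace_tag d s xi i : tagged_partition d s xi -> (i < size s)%N -> K (c (xi i)).
Proof. by move=> ht i_s; exists (xi i) => //=; rewrite in_itv/= (tag_itv ht). Qed.

(** Without partitions of every mesh the definition of the integral could hold vacuously, and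
    uniqueness would fail. *)
Lemma tagged_partition_ex (d : R) : 0 < d -> exists s xi, tagged_partition d s xi.
Proof.
move=> d0; pose n := (Num.truncn d^-1).+1.
have n0 : 0 < n%:R :> R by rewrite ltr0n.
have nd : (n%:R)^-1 < d.
  by rewrite -[d]invrK ltf_pV2 ?posrE ?invr_gt0//; exact: truncnS_gt.
pose s : seq R := [seq k.+1%:R / n%:R | k <- iota 0 n].
have ss : size s = n by rewrite size_map size_iota.
have nodeE i : (i <= n)%N -> node s i = i%:R / n%:R.
  case: i => [|i] i_n; first by rewrite /node /= mul0r.
  by rewrite /node /= (nth_map 0%N) ?size_iota// nth_iota.
have step i : (i < n)%N -> node s i.+1 - node s i = n%:R^-1.
  by move=> i_n; rewrite nodeE// (nodeE i (ltnW i_n)) -mulrBl -natrB// subSnn mul1r.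
have lt_step i : (i < n)%N -> node s i < node s i.+1.
  by move=> i_n; rewrite -subr_gt0 step// invr_gt0.
exists s, (node s); split=> [|i|i]; rewrite ?ss.
- split.
    apply/(pathP 1) => i; rewrite ss => i_n.
    exact: lt_step.
  rewrite (last_nth 1) ss -[nth _ _ _]/(node s n) nodeE// divff//.
  by rewrite pnatr_eq0.
- by move=> i_n; rewrite step.
- by move=> i_n; rewrite lexx /= ltW// lt_step.
Qed.

Let length_ex : exists2 M : R, 0 <= M & forall s, itv_partition 0 1 s ->
  \sum_(i < size s) normc (c (node s i.+1) - c (node s i)) <= M.
Proof.
have [M hM] := c_rect; exists (Num.max 0 (complex.Re M)); first by rewrite le_max lexx.
move=> s /hM; rewrite (eq_bigr _ (fun i _ => normcEr _)) -rmorph_sum.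
by case: (M) => a b /=; rewrite lecE /= => /andP[_ ab]; rewrite le_max ab orbT.
Qed.
Let len := projT1 (cid2 length_ex).
Let len_ge0 : 0 <= len. Proof. by rewrite /len; case: cid2. Qed.
Let lenP s : itv_partition 0 1 s ->
  \sum_(i < size s) normc (c (node s i.+1) - c (node s i)) <= len.
Proof. by move: s; rewrite /len; case: cid2. Qed.

Lemma riemann_sum_lin a b f g s xi :
  riemann_sum c (fun x => a * f x + b * g x) s xi =
  a * riemann_sum c f s xi + b * riemann_sum c g s xi.
Proof.
rewrite /riemann_sum !big_distrr -big_split; apply: eq_bigr => i _.
by rewrite /= mulrDl !mulrA.
Qed.

Lemma riemann_sum_ext d f g s xi : tagged_partition d s xi ->
  (forall x, K x -> f x = g x) -> riemann_sum c f s xi = riemann_sum c g s xi.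
Proof.
by move=> ht fg; apply: eq_bigr => i _; rewrite fg//; apply: trace_tag ht _.
Qed.

Lemma riemann_sum_le (B : R) d f s xi : tagged_partition d s xi ->
  (forall x, K x -> normc (f x) <= B) -> normc (riemann_sum c f s xi) <= B * len.
Proof.
move=> ht fB; apply: (le_trans (normc_sum _ _ _)).
have B0 : 0 <= B.
  apply: le_trans (fB (c 0) _); first exact: normc_ge0.
  by exists 0 => //=; rewrite in_itv/= lexx ler01.
have [hs _ _] := ht; apply: le_trans (ler_wpM2l B0 (lenP hs)).
rewrite big_distrr /=; apply: ler_sum => i _; rewrite normcM ler_wpM2r ?normc_ge0//.
by apply/fB/(trace_tag ht).
Qed.

Lemma ci_ext f g I : (forall x, K x -> f x = g x) -> ci f I -> ci g I.
Proof.
move=> fg /contour_integralP h; apply/contour_integralP => eps /h[d d0 hd].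
by exists d => // s xi ht; rewrite -(riemann_sum_ext ht fg); apply: hd.
Qed.

Lemma ci_approx f I : (forall eps, 0 < eps -> exists g J,
    [/\ forall x, K x -> normc (f x - g x) <= eps, normc (I - J) <= eps & ci g J]) ->
  ci f I.
Proof.
move=> h; apply/contour_integralP => eps eps0.
(* The three errors are bounded by e [len] (f against g), eps/2 (Riemann sum against J) and e (J
   against I), with total eps. *)
pose e := eps / (2 * (1 + len)).
have e0 : 0 < e by rewrite divr_gt0// mulr_gt0// ltr_pwDl.
have [g [J [fg IJ /contour_integralP/(_ (eps / 2))[]]]] := h _ e0.
  by rewrite divr_gt0.
move=> d d0 hd; exists d => // s xi ht.
apply: le_lt_trans (normc_dist (riemann_sum c g s xi) _ _) _.
have := hd _ _ ht; set A := riemann_sum c g s xi => gJ.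
have : normc (riemann_sum c f s xi - A) <= e * len.
  have -> : riemann_sum c f s xi - A = riemann_sum c (fun x => 1 * f x + (-1) * g x) s xi.
    by rewrite riemann_sum_lin mul1r mulN1r.
  by apply: riemann_sum_le ht _ => x Kx; rewrite mul1r mulN1r fg.
have : normc (A - I) <= normc (A - J) + normc (J - I) by apply: normc_dist.
rewrite (normc_sub J).
have -> : eps = eps / 2 + e * (1 + len) by rewrite /e; field; rewrite gt_eqF// ltr_pwDl.
by lra.
Qed.

Lemma ci_lin a b f g I J : ci f I -> ci g J ->
  ci (fun x => a * f x + b * g x) (a * I + b * J).
Proof.
move=> /contour_integralP fI /contour_integralP gJ.
apply/contour_integralP => eps eps0.
pose n := 1 + normc a + normc b.
have n0 : 0 < n by rewrite /n -addrA ltr_pwDl// addr_ge0 ?normc_ge0.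
have e0 : 0 < eps / n by rewrite divr_gt0.
have [d1 d10 h1] := fI _ e0; have [d2 d20 h2] := gJ _ e0.
exists (Num.min d1 d2); first by rewrite lt_min d10.
move=> s xi ht; rewrite riemann_sum_lin.
have := h1 s xi (tagged_partition_le _ ht); rewrite ge_min lexx => /(_ isT).
have := h2 s xi (tagged_partition_le _ ht); rewrite ge_min lexx orbT => /(_ isT).
move: (riemann_sum _ _ _ _) (riemann_sum _ _ _ _) => A B BJ AI.
have -> : a * A + b * B - (a * I + b * J) = a * (A - I) + b * (B - J) by ring.
apply: le_lt_trans (normc_triangle _ _) _; rewrite !normcM.
have na := normc_ge0 a; have nb := normc_ge0 b.
apply: (@le_lt_trans _ _ ((normc a + normc b) * (eps / n))).
  rewrite mulrDl lerD// ler_wpM2l// ltW//.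
rewrite -[ltRHS](@divfK _ n)// ?gt_eqF// [ltRHS]mulrC ltr_pM2r//.
by rewrite /n; lra.
Qed.

Lemma ciD f g I J : ci f I -> ci g J -> ci (fun x => f x + g x) (I + J).
Proof.
move=> hf hg; have := ci_lin 1 1 hf hg; rewrite !mul1r.
by apply: ci_ext => x _; rewrite !mul1r.
Qed.

Lemma ciZ a f I : ci f I -> ci (fun x => a * f x) (a * I).
Proof.
move=> hf; have := ci_lin a 0 hf hf; rewrite mul0r addr0.
by apply: ci_ext => x _; rewrite mul0r addr0.
Qed.

Lemma ciB f g I J : ci f I -> ci g J -> ci (fun x => f x - g x) (I - J).
Proof.
move=> hf hg; have := ci_lin 1 (-1) hf hg; rewrite !mul1r !mulN1r.
by apply: ci_ext => x _; rewrite !mul1r mulN1r.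
Qed.

Lemma ci0 : ci (fun=> 0) 0.
Proof.
apply/contour_integralP => eps e0; exists 1 => // s xi _.
by rewrite subr0 /riemann_sum big1 ?normc0// => i _; rewrite mul0r.
Qed.

Lemma ci_sum (A : Type) (r : seq A) (f : A -> R[i] -> R[i]) (I : A -> R[i]) :
  (forall i, ci (f i) (I i)) ->
  ci (fun x => \sum_(i <- r) f i x) (\sum_(i <- r) I i).
Proof.
move=> h; elim: r => [|i r IH].
  by rewrite big_nil; apply: ci_ext ci0 => x _; rewrite big_nil.
by rewrite big_cons; apply: ci_ext (ciD (h i) IH) => x _; rewrite big_cons.
Qed.

Lemma ci_le (B : R) f I : ci f I -> (forall x, K x -> normc (f x) <= B) ->
  normc I <= B * len.
Proof.
move=> /contour_integralP fI fB; apply/ler_addgt0Pr => eps /fI[d d0 hd].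
have [s [xi ht]] := tagged_partition_ex d0.
have := hd _ _ ht; have := riemann_sum_le ht fB.
have := normc_triangle (riemann_sum c f s xi) (I - riemann_sum c f s xi).
rewrite addrC subrK (normc_sub I); lra.
Qed.

Lemma ci_unique f I J : ci f I -> ci f J -> I = J.
Proof.
move=> fI fJ; apply/eqP; rewrite -subr_eq0 -normc_eq0 eq_le normc_ge0 andbT.
have := ci_le (B := 0) (ciB fI fJ); rewrite mul0r; apply=> x _.
by rewrite subrr normc0.
Qed.

Lemma contour_integralE f I : ci f I -> contour_integral c f = I.
Proof.
by move=> fI; apply: (ci_unique _ fI); apply: (@xgetI _ 0 [set J | ci f J] I).
Qed.

Lemma ci_bound_ex : exists2 L : R, 0 <= L & forall (B : R) f I, ci f I ->
  (forall x, K x -> normc (f x) <= B) -> normc I <= B * L.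
Proof. by exists len => // B f I; apply: ci_le. Qed.

(* The uniform quadratic remainder makes this notion of primitive stable under
   products, so powers of x and of 1 / (x - p) follow from two cases. *)
Definition qdiff F f := exists2 B : R, 0 <= B & forall x y z, K x -> K y -> K z ->
  [/\ normc (F x) <= B, normc (f x) <= B, normc (F y - F x) <= B * normc (y - x)
    & normc (F y - F x - f z * (y - x)) <= B * (normc (y - x) + normc (z - x)) * normc (y - x)].

Lemma curve_continuous_at (t eps : R) : 0 <= t <= 1 -> 0 < eps -> exists2 e : R, 0 < e &
  forall t', 0 <= t' <= 1 -> `|t - t'| < e -> normc (c t - c t') < eps.
Proof.
move=> t01 eps0; have /subspace_continuousP/(_ t) := c_cont.
rewrite /= in_itv/= => /(_ t01)/cvgrPdist_lt/(_ eps%:C%C).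
rewrite ltcR => /(_ eps0); rewrite near_withinE => /nbhs_ballP[e /= e0 he].
exists e => // t' t'01 te.
by have := he t' te; rewrite in_itv/= => /(_ t'01); rewrite normcEr ltcR.
Qed.

(** Compactness of [0, 1], with d tending to 0 from the right. Uniform continuity, the distance from
    a point to the trace and, with d^{-1} as the bound, boundedness of the trace are all
    instances. *)
Lemma unit_interval_covering (P : R -> R -> Prop) :
  (forall t, 0 <= t <= 1 -> exists2 e : R, 0 < e &
    forall d t', 0 < d -> d < e -> 0 <= t' <= 1 -> `|t - t'| < e -> P d t') ->
  exists2 d : R, 0 < d & forall t, 0 <= t <= 1 -> P d t.
Proof.
move=> h; pose Q (d t : R) := 0 < d -> 0 <= t <= 1 -> P d t.
have FF : Filter (0 : R)^'+ by apply: at_right_proper_filter.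
have cov := (compact_near_coveringP _).1 (@segment_compact R 0 1) R (0^'+) Q FF.
have hd : \forall d \near 0^'+, `[0, 1] `<=` Q d.
  apply: cov.
  move=> t; rewrite /= in_itv/= => /h[e e0 he].
  exists (ball t e, [set d | d < e]) => /=.
    by split; [exact: nbhsx_ballx|exact: nbhs_right_lt].
  by move=> [x d] [/= xb de] d0 x01; apply: he.
have [d' [/= d'0 hd']] := filter_ex (filterI (@nbhs_right_gt R 0) hd).
by exists d' => // t t01; apply: hd'; rewrite //= in_itv.
Qed.

Lemma curve_uniform (eps : R) : 0 < eps -> exists2 d : R, 0 < d &
  forall t t', 0 <= t <= 1 -> 0 <= t' <= 1 -> `|t - t'| < d -> normc (c t - c t') < eps.
Proof.
move=> eps0; have [t t01|d d0 hd] := @unit_interval_covering (fun d t => forall t',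
    0 <= t' <= 1 -> `|t - t'| < d -> normc (c t - c t') < eps).
  have [e e0 he] := curve_continuous_at t01 (divr_gt0 eps0 (ltr0Sn _ 1)).
  exists (e / 2); first by rewrite divr_gt0.
  move=> d x d0 de x01 tx t' t'01 xt'.
  have := he x x01; have := he t' t'01.
  have := normc_dist (c t) (c x) (c t').
  have := ler_distD x t t'.
  rewrite (normc_sub (c x) (c t)).
  lra.
by exists d => // t t' t01; apply: hd.
Qed.

Lemma trace_dist p : ~ K p -> exists2 d : R, 0 < d & forall x, K x -> d <= normc (x - p).
Proof.
move=> Kp; have [t t01|d d0 hd] := @unit_interval_covering (fun d t => d <= normc (c t - p)).
  have r0 : 0 < normc (c t - p).
    rewrite normc_gt0 subr_eq0; apply/eqP => ctp; apply: Kp.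
    by exists t => //=; rewrite in_itv.
  have [e e0 he] := curve_continuous_at t01 (divr_gt0 r0 (ltr0Sn _ 1)).
  exists (Num.min e (normc (c t - p) / 2)); first by rewrite lt_min e0 divr_gt0.
  move=> d t' d0; rewrite !lt_min => /andP[de dr] t'01 /andP[tt' _].
  have := he _ t'01 tt'; have := normc_dist (c t') (c t) p; lra.
by exists d => // _ [t /= + <-]; rewrite in_itv => /hd.
Qed.

Lemma trace_bounded : exists2 M : R, 0 < M & forall x, K x -> normc x <= M.
Proof.
have [t t01|d d0 hd] := @unit_interval_covering (fun d t => normc (c t) <= d^-1).
  have [e e0 he] := curve_continuous_at t01 ltr01.
  have n0 := normc_ge0 (c t).
  exists (Num.min e (normc (c t) + 1)^-1).
    by rewrite lt_min e0 invr_gt0 ltr_wpDl.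
  move=> d t' d0; rewrite !lt_min => /andP[de dr] t'01 /andP[tt' _].
  have dr' : normc (c t) + 1 <= d^-1.
    by rewrite -[leLHS]invrK lef_pV2 ?posrE ?invr_gt0 ?ltr_wpDl// ltW.
  have := he _ t'01 tt'; have := normc_triangle (c t) (c t' - c t).
  rewrite addrC subrK (normc_sub (c t')); lra.
exists d^-1; first by rewrite invr_gt0.
by move=> _ [t /= + <-]; rewrite in_itv => /hd.
Qed.

(** The increments of F telescope to 0 on a closed curve, so a Riemann sum is minus the sum of the
    remainders. On a fine partition each remainder is at most B (eta + eta) times the length of its
    chord. *)
Lemma ci_qdiff F f : qdiff F f -> ci f 0.
Proof.
case=> B B0 hB; apply/contour_integralP => eps eps0.
pose eta := eps / (2 * (B + 1) * (len + 1)).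
have den0 : 0 < 2 * (B + 1) * (len + 1) by rewrite !mulr_gt0// ltr_wpDl.
have eta0 : 0 < eta by rewrite divr_gt0.
have [d d0 hd] := curve_uniform eta0; exists d => // s xi ht.
have [hs mesh tags] := ht.
have -> : riemann_sum c f s xi - 0 = - \sum_(i < size s)
    (F (c (node s i.+1)) - F (c (node s i)) - f (c (xi i)) * (c (node s i.+1) - c (node s i))).
  rewrite subr0 sumrB opprB -[LHS]subr0; congr (_ - _).
  rewrite -(big_mkord xpredT (fun i => F (c (node s i.+1)) - F (c (node s i)))).
  rewrite telescope_sumr// /node (itv_partition_nth_size _ hs) -c_closed.
  by rewrite subrr.
rewrite normc_opp; apply: le_lt_trans (normc_sum _ _ _) _.
apply: (@le_lt_trans _ _ (B * (eta + eta) * len)); last first.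
  rewrite -[eps](@divfK _ (2 * (B + 1) * (len + 1))) ?gt_eqF// -/eta.
  have -> : B * (eta + eta) * len = eta * (2 * B * len) by ring.
  rewrite ltr_pM2l// -subr_gt0.
  have -> : 2 * (B + 1) * (len + 1) - 2 * B * len = 2 * (B + len + 1) by ring.
  by rewrite mulr_gt0// ltr_wpDl// addr_ge0.
have Be : 0 <= B * (eta + eta) by rewrite mulr_ge0// addr_ge0// ltW.
apply: le_trans (ler_wpM2l Be (lenP hs)); rewrite big_distrr /=.
apply: ler_sum => i _; have i_s := ltn_ord i.
have /andP[t1 t2] := tags _ i_s; have tm := mesh _ i_s.
have [_ _ _] := hB _ _ _ (trace_node hs (ltnW i_s)) (trace_node hs i_s) (trace_tag ht i_s).
move/le_trans; apply; rewrite ler_wpM2r ?normc_ge0// ler_wpM2l//.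
have n1 := node_itv hs (ltnW i_s); have n2 := node_itv hs i_s.
have n3 := tag_itv ht i_s.
apply: lerD; apply/ltW/hd => //; rewrite ger0_norm; lra.
Qed.

Lemma qdiff_ext F f F' f' : (forall x, K x -> F x = F' x) ->
  (forall x, K x -> f x = f' x) -> qdiff F f -> qdiff F' f'.
Proof.
move=> FF ff [B B0 hB]; exists B => // x y z Kx Ky Kz.
by rewrite -!FF// -!ff//; apply: hB.
Qed.

Lemma qdiffM F f G g : qdiff F f -> qdiff G g ->
  qdiff (fun x => F x * G x) (fun x => F x * g x + f x * G x).
Proof.
case=> B1 B10 h1 [B2 B20 h2]; pose B := 1 + B1 + B2.
have B1B : B1 <= B by rewrite /B; lra.
have B2B : B2 <= B by rewrite /B; lra.
have B0 : 0 <= B by rewrite /B; lra.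
have B3 : 1 <= B by rewrite /B; lra.
(* The remainder of the product splits into four terms, each bounded by B^2 times the required
   expression. *)
exists (4 * B ^+ 2); first by rewrite mulr_ge0// exprn_ge0.
move=> x y z Kx Ky Kz.
have {}h1 x' y' z' (Kx' : K x') (Ky' : K y') (Kz' : K z') :
    [/\ normc (F x') <= B, normc (f x') <= B, normc (F y' - F x') <= B * normc (y' - x')
    & normc (F y' - F x' - f z' * (y' - x')) <=
      B * (normc (y' - x') + normc (z' - x')) * normc (y' - x')].
  have [p1 p2 p3 p4] := h1 _ _ _ Kx' Ky' Kz'; split.
  - exact: le_trans B1B.
  - exact: le_trans B1B.
  - by apply: le_trans p3 _; rewrite ler_wpM2r ?normc_ge0.
  - by apply: le_trans p4 _; rewrite !ler_wpM2r ?addr_ge0 ?normc_ge0.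
have {}h2 x' y' z' (Kx' : K x') (Ky' : K y') (Kz' : K z') :
    [/\ normc (G x') <= B, normc (g x') <= B, normc (G y' - G x') <= B * normc (y' - x')
    & normc (G y' - G x' - g z' * (y' - x')) <=
      B * (normc (y' - x') + normc (z' - x')) * normc (y' - x')].
  have [p1 p2 p3 p4] := h2 _ _ _ Kx' Ky' Kz'; split.
  - exact: le_trans B2B.
  - exact: le_trans B2B.
  - by apply: le_trans p3 _; rewrite ler_wpM2r ?normc_ge0.
  - by apply: le_trans p4 _; rewrite !ler_wpM2r ?addr_ge0 ?normc_ge0.
have [Fx fx Fyx FR] := h1 _ _ _ Kx Ky Kz; have [Gx gx Gyx GR] := h2 _ _ _ Kx Ky Kz.
have [Gy _ _ _] := h2 _ _ _ Ky Ky Kz; have [Fz fz Fxz _] := h1 _ _ _ Kz Kx Kz.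
have [_ gz Gyz _] := h2 _ _ _ Kz Ky Kz.
set a := normc (y - x) in Fyx FR Gyx GR *; set b := normc (z - x) in FR GR *.
have a0 : 0 <= a by apply: normc_ge0.
have b0 : 0 <= b by apply: normc_ge0.
have BB : 0 <= B ^+ 2 by rewrite exprn_ge0.
have leM (u v : R[i]) (U V : R) : normc u <= U -> normc v <= V -> normc (u * v) <= U * V.
  by move=> uU vV; rewrite normcM ler_pM ?normc_ge0.
split.
- by apply: le_trans (leM _ _ _ _ Fx Gx) _; rewrite expr2; nra.
- apply: le_trans (normc_triangle _ _) _.
  by have := leM _ _ _ _ Fx gx; have := leM _ _ _ _ fx Gx; rewrite expr2; nra.
- have -> : F y * G y - F x * G x = (F y - F x) * G y + F x * (G y - G x) by ring.
  apply: le_trans (normc_triangle _ _) _.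
  have := leM _ _ _ _ Fyx Gy; have := leM _ _ _ _ Fx Gyx.
  have : 0 <= B ^+ 2 * a by rewrite mulr_ge0.
  by rewrite !expr2; lra.
- have -> : F y * G y - F x * G x - (F z * g z + f z * G z) * (y - x) =
    ((F y - F x - f z * (y - x)) * G y + f z * ((y - x) * (G y - G z))) +
    (F x * (G y - G x - g z * (y - x)) + (F x - F z) * (g z * (y - x))) by ring.
  apply: le_trans (normc_triangle _ _) _.
  have := normc_triangle ((F y - F x - f z * (y - x)) * G y) (f z * ((y - x) * (G y - G z))).
  have := normc_triangle (F x * (G y - G x - g z * (y - x))) ((F x - F z) * (g z * (y - x))).
  have := leM _ _ _ _ FR Gy; have := leM _ _ _ _ Fx GR.
  rewrite [normc (x - z)]normc_sub -/b in Fxz.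
  have := leM _ _ _ _ Fxz (leM _ _ _ _ gz (lexx a)).
  have yz : normc (y - z) <= a + b by rewrite /b (normc_sub z); exact: normc_dist.
  have {}Gyz : normc (G y - G z) <= B * (a + b).
    by apply: le_trans Gyz _; rewrite ler_wpM2l.
  have := leM _ _ _ _ fz (leM _ _ _ _ (lexx a) Gyz).
  have : 0 <= B ^+ 2 * a * a by rewrite !mulr_ge0.
  by rewrite !expr2; lra.
Qed.

Lemma qdiff_pow F f n : qdiff F f ->
  qdiff (fun x => F x ^+ n.+1) (fun x => n.+1%:R * (F x ^+ n * f x)).
Proof.
move=> Ff; elim: n => [|n IH].
  by apply: qdiff_ext Ff => x _; rewrite ?expr0 ?mul1r.
apply: qdiff_ext (qdiffM IH Ff) => x _; first by rewrite -exprSr.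
by rewrite [n.+2%:R]mulrSr !exprS; ring.
Qed.

Lemma ci_qdiff_pow F f n : qdiff F f -> ci (fun x => F x ^+ n * f x) 0.
Proof.
move=> /(qdiff_pow n)/ci_qdiff/(ciZ (n.+1%:R^-1)); rewrite mulr0.
by apply: ci_ext => x _; rewrite mulKf// pnatr_eq0.
Qed.

Lemma qdiff_id : qdiff id (fun=> 1).
Proof.
have [M M0 hM] := trace_bounded; have M1 : 0 <= M + 1 by lra.
exists (M + 1) => // x y z Kx Ky Kz; have := normc_ge0 (y - x); have := hM _ Kx.
rewrite normc1 mul1r subrr normc0 => hx h0; split; try lra.
- by rewrite ler_peMl//; lra.
- by rewrite !mulr_ge0// addr_ge0// normc_ge0.
Qed.

Lemma qdiff_inv p : ~ K p -> qdiff (fun x => (x - p)^-1) (fun x => - (x - p)^-1 ^+ 2).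
Proof.
move=> /trace_dist[d d0 hd]; pose i := d^-1.
have i0 : 0 <= i by rewrite invr_ge0 ltW.
have xi x : K x -> normc (x - p)^-1 <= i.
  by move=> Kx; rewrite normcV lef_pV2 ?posrE ?hd// (lt_le_trans d0)// hd.
have xp x : K x -> x - p != 0 by move=> Kx; rewrite -normc_gt0 (lt_le_trans d0)// hd.
have i1 : 0 <= i ^+ 2 by rewrite exprn_ge0.
have i2 : 0 <= i ^+ 3 by rewrite exprn_ge0.
have leM (u v : R[i]) (U V : R) : normc u <= U -> normc v <= V -> normc (u * v) <= U * V.
  by move=> uU vV; rewrite normcM ler_pM ?normc_ge0.
(* The summand i bounds the function, i^2 its derivative and its increments, and 2 i^3 the
   remainder, where |y - z| is estimated by |y - x| + |z - x|. *)
exists (i + i ^+ 2 + 2 * i ^+ 3); first by rewrite !addr_ge0// mulr_ge0.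
move=> x y z Kx Ky Kz.
have [ix iy iz] : [/\ normc (x - p)^-1 <= i, normc (y - p)^-1 <= i & normc (z - p)^-1 <= i].
  by rewrite !xi.
have [px py pz] : [/\ x - p != 0, y - p != 0 & z - p != 0] by rewrite !xp.
have a0 := normc_ge0 (y - x); have b0 := normc_ge0 (z - x).
split.
- by lra.
- by rewrite normc_opp expr2; have := leM _ _ _ _ ix ix; rewrite -expr2; lra.
- have -> : (y - p)^-1 - (x - p)^-1 = - (y - x) * ((x - p)^-1 * (y - p)^-1).
    by field; rewrite px py.
  rewrite normcM normc_opp [leRHS]mulrC ler_wpM2l//.
  by have := leM _ _ _ _ ix iy; rewrite -expr2; lra.
- have -> : (y - p)^-1 - (x - p)^-1 - - (z - p)^-1 ^+ 2 * (y - x) =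
    ((x - z) * ((z - p)^-1 * (z - p)^-1 * (x - p)^-1) +
     (y - z) * ((z - p)^-1 * (x - p)^-1 * (y - p)^-1)) * (y - x).
    by field; rewrite px py pz.
  rewrite normcM ler_wpM2r//; apply: le_trans (normc_triangle _ _) _.
  rewrite !(normcM _ (_ * _)) (normc_sub x z).
  have := leM _ _ _ _ (leM _ _ _ _ iz iz) ix.
  have := leM _ _ _ _ (leM _ _ _ _ iz ix) iy.
  rewrite -expr2 -exprSr => h1 h2.
  have := ler_wpM2l b0 h2; have := ler_wpM2l (normc_ge0 (y - z)) h1.
  have yz : normc (y - z) <= normc (y - x) + normc (z - x).
    by rewrite (normc_sub z); exact: normc_dist.
  have := ler_wpM2r i2 yz.
  have : 0 <= (i + i ^+ 2) * (normc (y - x) + normc (z - x)).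
    by rewrite mulr_ge0// addr_ge0.
  have : 0 <= i ^+ 3 * normc (y - x) by rewrite mulr_ge0.
  by lra.
Qed.

Lemma ciX n : ci (fun x => x ^+ n) 0.
Proof. by apply: ci_ext (ci_qdiff_pow n qdiff_id) => x _; rewrite mulr1. Qed.

Lemma ci_invX p n : ~ K p -> ci (fun x => (x - p)^-1 ^+ n.+2) 0.
Proof.
move=> /qdiff_inv/(ci_qdiff_pow n)/(ciZ (-1)); rewrite mulr0.
by apply: ci_ext => x _; rewrite mulN1r mulrN opprK -exprD addn2.
Qed.

(** The geometric series of chi / (1 - g) converges uniformly on the trace, and only its first term
    contributes to the integral. *)
Lemma ci_geometric (chi g : R[i] -> R[i]) (B : R) I :
  (forall x, K x -> normc (chi x) <= B) -> (forall x, K x -> normc (g x) <= 2^-1) ->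
  ci chi I -> (forall n, ci (fun x => chi x * g x ^+ n.+1) 0) ->
  ci (fun x => chi x / (1 - g x)) I.
Proof.
move=> chiB g2 hI h0; apply: ci_approx => eps eps0.
have B0 : 0 <= B.
  apply: le_trans (chiB (c 0) _); first exact: normc_ge0.
  by exists 0 => //=; rewrite in_itv/= lexx ler01.
pose N := Num.truncn (2 * B / eps).
have hN : 2 * B * 2^-1 ^+ N.+1 <= eps.
  have : 2 * B / eps < 2 ^+ N.+1.
    by apply: lt_trans (truncnS_gt _) _; rewrite -natrX ltr_nat ltn_expl.
  by rewrite exprVn ler_pdivrMr ?exprn_gt0// ltr_pdivrMr// [X in _ < X]mulrC => /ltW.
exists (fun x => chi x + \sum_(0 <= n < N) chi x * g x ^+ n.+1), (I + \sum_(0 <= n < N) 0).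
split.
- move=> x Kx; have g1 : 2^-1 <= normc (1 - g x).
    have := normc_triangle (1 - g x) (g x); rewrite subrK normc1.
    by have := g2 _ Kx; lra.
  have g10 : 1 - g x != 0 by rewrite -normc_gt0; lra.
  have -> : chi x / (1 - g x) - (chi x + \sum_(0 <= n < N) chi x * g x ^+ n.+1) =
      chi x * g x ^+ N.+1 / (1 - g x).
    have : (1 - g x ^+ N.+1) = (1 - g x) * \sum_(0 <= n < N.+1) g x ^+ n.
      rewrite -[X in X - _ = _](expr1n _ N.+1) subrXX big_mkord; congr (_ * _).
      by apply: eq_bigr => i _; rewrite expr1n mul1r.
    rewrite big_nat_recl// expr0 -big_distrr /=; set S := \sum_(_ <= _ < _) _ => hS.
    apply: (mulIf g10); rewrite mulrBl !divfK//.
    have -> : g x ^+ N.+1 = 1 - (1 - g x) * (1 + S) by rewrite -hS; ring.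
    by ring.
  rewrite !normcM normcX normcV; apply: le_trans hN.
  have gi : (normc (1 - g x))^-1 <= 2 by rewrite -[leRHS]invrK lef_pV2 ?posrE//; lra.
  have -> t : 2 * B * t = B * t * 2 by ring.
  rewrite ler_pM ?mulr_ge0 ?exprn_ge0 ?invr_ge0 ?normc_ge0//.
  by rewrite ler_pM ?exprn_ge0 ?normc_ge0 ?chiB// lerXn2r ?nnegrE ?normc_ge0 ?invr_ge0 ?g2.
- by rewrite big1 ?addr0 ?subrr ?normc0 ?ltW.
- by apply: ciD => //; apply: ci_sum.
Qed.

(** In the expansion of 1/(x - v) by powers of (v - w)/(x - w), all terms but the first are
    multiples of higher powers of 1/(x - w), whose integrals vanish. Hence the winding number is
    locally constant off the trace. *)
Lemma ci_inv_move (d : R) w v I : 0 < d -> (forall x, K x -> d <= normc (x - w)) ->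
  normc (v - w) <= d / 2 -> ci (fun x => (x - w)^-1) I -> ci (fun x => (x - v)^-1) I.
Proof.
move=> d0 hd vw hw.
have xw x : K x -> x - w != 0 by move=> Kx; rewrite -normc_gt0 (lt_le_trans d0)// hd.
have Kw : ~ K w by move=> /xw; rewrite subrr eqxx.
have := @ci_geometric (fun x => (x - w)^-1) (fun x => (v - w) * (x - w)^-1) d^-1 I.
have xi x : K x -> normc (x - w)^-1 <= d^-1.
  by move=> Kx; rewrite normcV lef_pV2 ?posrE ?hd// (lt_le_trans d0)// hd.
have xg x : K x -> normc ((v - w) * (x - w)^-1) <= 2^-1.
  move=> Kx; rewrite normcM; have -> : 2^-1 = d / 2 * d^-1 :> R by field; rewrite gt_eqF.
  by rewrite ler_pM ?normc_ge0 ?xi.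
have h0 n : ci (fun x => (x - w)^-1 * ((v - w) / (x - w)) ^+ n.+1) 0.
  have := ciZ ((v - w) ^+ n.+1) (ci_invX n Kw); rewrite mulr0; apply: ci_ext => x _.
  by rewrite exprMn [_ ^-1 ^+ n.+2]exprS; ring.
move=> /(_ xi xg hw h0); apply: ci_ext => x Kx; have xw0 := xw x Kx.
have g10 : 1 - (v - w) / (x - w) != 0.
  rewrite subr_eq0; apply/eqP => g1; have := xg _ Kx; rewrite -g1 normc1; lra.
have xv : x - v = (x - w) * (1 - (v - w) / (x - w)) by field.
by rewrite xv invfM.
Qed.

(** In the expansion by powers of x/v every term is a monomial in x, with integral 0. *)
Lemma ci_inv_far v : (forall x, K x -> normc x <= normc v / 2) -> v != 0 ->
  ci (fun x => (x - v)^-1) 0.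
Proof.
move=> hv v0; have nv : 0 < normc v by rewrite normc_gt0.
have := @ci_geometric (fun=> - v^-1) (fun x => v^-1 * x) (normc v^-1) 0.
have xi x : K x -> normc (- v^-1) <= normc v^-1 by rewrite normc_opp.
have xg x : K x -> normc (v^-1 * x) <= 2^-1.
  move=> /hv xv; rewrite normcM normcV mulrC ler_pdivrMr//; lra.
have h0 : ci (fun=> - v^-1) 0.
  by have := ciZ (- v^-1) (ciX 0); rewrite mulr0; apply: ci_ext => x _; rewrite expr0 mulr1.
have hn n : ci (fun x => - v^-1 * (v^-1 * x) ^+ n.+1) 0.
  have := ciZ (- v^-1 * v^-1 ^+ n.+1) (ciX n.+1); rewrite mulr0; apply: ci_ext => x _.
  by rewrite exprMn mulrA.
move=> /(_ xi xg h0 hn); apply: ci_ext => x Kx.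
have g10 : 1 - v^-1 * x != 0.
  by rewrite subr_eq0; apply/eqP => g1; have := xg _ Kx; rewrite -g1 normc1; lra.
have -> : x - v = - v * (1 - v^-1 * x) by field.
by rewrite invfM invrN.
Qed.

(* the points off the trace with vanishing integral form an open set, which is also
   closed off the trace and contains all large points *)
Lemma ci_inv_exterior w : exterior_of c w -> ci (fun x => (x - w)^-1) 0.
Proof.
case=> Kw unb; set A := connected_component _ w in unb.
pose W := [set v | (~` K) v /\ ci (fun x => (x - v)^-1) 0].
have Aw : A w by apply: connected_component_refl.
have AK v : A v -> ~ K v by apply: connected_component_sub.
suff AW : A `&` W = A by have [_ []] : (A `&` W) w by rewrite AW.
have hA : connected A by apply: component_connected.
apply: hA.
- have [M M0 hM] := trace_bounded.
  have [[v Av vM]|nex] := pselect (exists2 v, A v & 2 * M < normc v).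
    exists v; split=> //; split; first exact: AK.
    apply: ci_inv_far => [x /hM|]; first lra.
    by rewrite -normc_gt0; lra.
  exfalso; apply: unb; exists (2 * M)%:C%C; split.
    by apply/complex_realP; exists (2 * M).
  move=> x Mx v Av /=; apply: ltW; apply: le_lt_trans Mx.
  by rewrite normcEr lecR leNgt; apply/negP => vM; apply: nex; exists v.
- exists W => //; rewrite openE => v [Kv hv].
  have [d d0 hd] := trace_dist Kv.
  apply/nbhs_ballP; exists (d / 2)%:C%C; first by rewrite /= ltcR divr_gt0.
  move=> u; rewrite -ball_normE /= normcEr ltcR normc_sub => uv.
  split; last by apply: ci_inv_move hd _ hv; rewrite // ltW.
  move=> Ku; have := hd u Ku; lra.
- exists (closure W); first exact: closed_closure.
  apply/seteqP; split=> v [Av]; first by move=> Wv; split=> //; apply: subset_closure.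
  move=> cW; split=> //; split; first exact: AK.
  have [d d0 hd] := trace_dist (AK _ Av).
  have [|u [[Ku hu] vu]] := cW (ball v (d / 4)%:C%C).
    by apply: nbhsx_ballx; rewrite ltcR divr_gt0.
  move: vu; rewrite -ball_normE /= normcEr ltcR => vu.
  (* The nearby point u keeps distance 3d/4 from the trace, and |v - u| < d/4 is below half of
     it. *)
  apply: (@ci_inv_move (3 * d / 4) u) => //; first lra.
    by move=> x /hd; have := normc_dist u x v; rewrite (normc_sub u); lra.
  lra.
Qed.

End ContourIntegral.

(** * Integrals of rational functions under x -> s/x *)

Section SymmetricResidues.
Variables (R : realType) (c : R -> R[i]).
Hypotheses (c_cont : {within `[0, 1], continuous c}) (c_closed : c 0 = c 1)
  (c_rect : rectifiable c).
Variables (s T : R[i]) (E : set R[i]).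
Hypothesis s0 : s != 0.
Local Notation ci := (is_contour_integral c).
Local Notation K := (trace c).
Hypothesis K0 : ~ K 0.
Hypothesis ci0V : ci (fun x => (x - 0)^-1) T.
Hypothesis E0 : forall e, E e -> e != 0.
Hypothesis Eout : forall e, E e -> ~ K e^-1 /\ ci (fun x => (x - e^-1)^-1) 0.
Hypothesis Ein : forall e, E e -> ~ K (e * s) /\ ci (fun x => (x - e * s)^-1) T.
Hypothesis Eef : forall e f, E e -> E f -> e * f * s != 1.
Implicit Types (phi psi : R[i] -> R[i]) (x : R[i]).

(** Identities between integrands are proved on this set rather than on the trace because it
    contains the trace and is stable under x -> s/x. *)
Definition regular_point x :=
  x != 0 /\ forall e, E e -> 1 - e * x != 0 /\ 1 - e * (s / x) != 0.

Lemma regular_trace x : K x -> regular_point x.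
Proof.
move=> Kx; have x0 : x != 0 by apply: contra_not_neq K0 => <-.
split=> // e Ee; have e0 := E0 Ee; split.
  rewrite subr_eq0; apply: contra_not_neq (Eout Ee).1 => ex.
  by have -> : e^-1 = x by rewrite -[x](mulKf e0) -ex mulr1.
rewrite subr_eq0; apply: contra_not_neq (Ein Ee).1 => ex.
by have -> : e * s = x by rewrite -[RHS]mul1r ex -mulrA divfK.
Qed.

Lemma regular_refl x : regular_point x -> regular_point (s / x).
Proof.
case=> x0 h; split; first by rewrite mulf_neq0 ?invr_neq0.
have -> : s / (s / x) = x by field; rewrite s0 x0.
by move=> e /h[].
Qed.

(* The substitution x -> s/x is made in the integrand only: both sides are computed
   by partial fractions, and the image of the curve never occurs. *)
Definition refl_integrable phi := exists I,
  ci (fun x => phi x / x) I /\ ci (fun x => phi (s / x) / x) I.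
Local Notation SS := refl_integrable.

Lemma refl_integrable_ext phi psi : (forall x, regular_point x -> phi x = psi x) ->
  SS phi -> SS psi.
Proof.
move=> e [I [h1 h2]]; exists I; split.
  by apply: ci_ext h1 => // x /regular_trace/e ->.
by apply: ci_ext h2 => // x /regular_trace/regular_refl/e ->.
Qed.

Lemma refl_integrableD phi psi : SS phi -> SS psi -> SS (fun x => phi x + psi x).
Proof.
move=> [I [h1 h2]] [J [g1 g2]]; exists (I + J); split.
  by apply: ci_ext (ciD h1 g1) => // x _; rewrite mulrDl.
by apply: ci_ext (ciD h2 g2) => // x _; rewrite mulrDl.
Qed.

Lemma refl_integrableZ a phi : SS phi -> SS (fun x => a * phi x).
Proof.
move=> [I [h1 h2]]; exists (a * I); split.
  by apply: ci_ext (ciZ a h1) => // x _; rewrite mulrA.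
by apply: ci_ext (ciZ a h2) => // x _; rewrite mulrA.
Qed.

Lemma refl_integrableB phi psi : SS phi -> SS psi -> SS (fun x => phi x - psi x).
Proof.
move=> h1 /(refl_integrableZ (-1))/(refl_integrableD h1).
by apply: refl_integrable_ext => x _; rewrite mulN1r.
Qed.

Lemma refl_integrable_sum (A : Type) (r : seq A) (F : A -> R[i] -> R[i]) :
  (forall i, SS (F i)) -> SS (fun x => \sum_(i <- r) F i x).
Proof.
move=> h; elim: r => [|i r IH].
  have h0 : ci (fun x => 0 / x) 0 by apply: ci_ext (ci0 c) => // x _; rewrite mul0r.
  by exists 0; split; apply: ci_ext h0 => // x _; rewrite big_nil.
by apply: refl_integrable_ext (refl_integrableD (h i) IH) => x _; rewrite big_cons.
Qed.

Lemma refl_integrable_refl phi : SS (fun x => phi (s / x)) -> SS phi.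
Proof.
move=> [I [h1 h2]]; exists I; split=> //.
apply: ci_ext h2 => // x /regular_trace[x0 _].
by have -> : s / (s / x) = x by field; rewrite s0 x0.
Qed.

Let ci0Vx : ci (fun x => x^-1) T.
Proof. by apply: ci_ext ci0V => // x _; rewrite subr0. Qed.

Lemma refl_integrableX (n : int) : SS (fun x => x ^ n).
Proof.
have posX m : ci (fun x => x ^ (m.+1 : int) / x) 0.
  apply: ci_ext (ciX c_cont c_closed c_rect m) => // x /regular_trace[x0 _].
  by rewrite -exprnP exprSr mulfK.
have negX m : ci (fun x => x ^ (- (m.+1 : int)) / x) 0.
  apply: ci_ext (ci_invX c_cont c_closed c_rect m K0) => // x _.
  by rewrite subr0 -exprnN [RHS]mulrC exprS exprVn.
have refl m x : (s / x) ^ m / x = s ^ m * (x ^ (- m) / x).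
  by rewrite expfzMl exprz_inv mulrA.
case: n => [[|m]|m].
- by exists T; split; apply: ci_ext ci0Vx => // x _; rewrite expr0z mul1r.
- exists 0; split=> //; have := ciZ (s ^ m.+1) (negX m); rewrite mulr0.
  by apply: ci_ext => // x _; rewrite refl.
- exists 0; rewrite NegzE; split=> //.
  have := ciZ (s ^ (- m.+1%:Z)) (posX m); rewrite mulr0.
  by apply: ci_ext => // x _; rewrite refl opprK.
Qed.

Section OnePole.
Variable e : R[i].
Hypothesis Ee : E e.
Let e0 := E0 Ee.

(** The common value is T for all m. Raising the exponent adds e (1 - ex)^{-m-1}, whose only pole is
    outside, on one side, and (y/x^2) (1 - y/x)^{-m-1} with y = es on the other. For m = 0 the
    latter is 1/(x - y) - 1/x, with integral T - T; for m > 0 it is, up to sign, a power of x/(x -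
    y) times its derivative. *)
Lemma refl_integrable_out m : SS (fun x => (1 - e * x)^-1 ^+ m).
Proof.
exists T; split.
  elim: m => [|m IH]; first by apply: ci_ext ci0Vx => // x _; rewrite expr0 mul1r.
  have h : ci (fun x => e * (1 - e * x)^-1 ^+ m.+1) 0.
    have xe x : K x -> x - e^-1 != 0.
      by move=> Kx; rewrite subr_eq0; apply: contra_not_neq (Eout Ee).1 => <-.
    have exp x : e * (1 - e * x)^-1 ^+ m.+1 = e * (- e^-1) ^+ m.+1 * (x - e^-1)^-1 ^+ m.+1.
      have -> : 1 - e * x = - e * (x - e^-1) by rewrite mulNr mulrBr mulfV// opprB.
      by rewrite invfM invrN exprMn mulrA.
    case: m {IH} exp => [|m] exp.
      have := ciZ (e * (- e^-1) ^+ 1) (Eout Ee).2; rewrite mulr0.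
      by apply: ci_ext => // x _; rewrite exp expr1.
    have := ciZ (e * (- e^-1) ^+ m.+2) (ci_invX c_cont c_closed c_rect m (Eout Ee).1).
    by rewrite mulr0; apply: ci_ext => // x _; rewrite exp.
  have := ciD IH h; rewrite addr0; apply: ci_ext => // x /regular_trace[x0 /(_ e Ee)[u0 _]].
  by rewrite exprSr; field; rewrite u0 x0.
elim: m => [|m IH]; first by apply: ci_ext ci0Vx => // x _; rewrite expr0 mul1r.
have [Ky ciy] := Ein Ee; set y := e * s in Ky ciy.
have h : ci (fun x => y / x ^+ 2 * (1 - e * (s / x))^-1 ^+ m.+1) 0.
  have xy x : K x -> x - y != 0.
    by move=> Kx; rewrite subr_eq0; apply: contra_not_neq Ky => <-.
  have vE x : K x -> (1 - e * (s / x))^-1 = x * (x - y)^-1.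
    move=> Kx; have [x0 _] := regular_trace Kx; rewrite mulrA -/y.
    by field; rewrite x0 xy.
  case: m {IH} => [|m].
    have := ciB ciy ci0Vx; rewrite subrr; apply: ci_ext => // x Kx.
    by have [x0 _] := regular_trace Kx; rewrite vE//; field; rewrite x0 xy.
  have := ci_qdiff_pow c_cont c_closed c_rect m
    (qdiffM (qdiff_id c_cont) (qdiff_inv c_cont Ky)).
  move/(ciZ (-1)); rewrite mulr0; apply: ci_ext => // x Kx.
  have [x0 _] := regular_trace Kx; rewrite vE// !exprS.
  by move: (_ ^+ m) => A; field; rewrite x0 xy.
have := ciD IH h; rewrite addr0; apply: ci_ext => // x /regular_trace[x0 /(_ e Ee)[_ v0]].
rewrite [_^-1 ^+ m.+1]exprSr /y; move: v0; rewrite mulrA => v0.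
move: (_ ^+ m) => A.
have v0' : x - e * s != 0.
  have -> : x - e * s = x * (1 - e * s / x) by field.
  by rewrite mulf_neq0.
by field; rewrite x0 v0'.
Qed.

(** With u = 1 - ex, the relations x/u = (1/u - 1)/e and 1/(xu) = 1/x + e/u lower |n|. *)
Lemma refl_integrable_outX m (n : int) : SS (fun x => x ^ n * (1 - e * x)^-1 ^+ m).
Proof.
elim: m n => [|m IHm] n.
  by apply: refl_integrable_ext (refl_integrableX n) => x _; rewrite expr0 mulr1.
case: n => n; last rewrite NegzE.
  elim: n => [|n IHn].
    by apply: refl_integrable_ext (refl_integrable_out m.+1) => x _; rewrite expr0z mul1r.
  have := refl_integrableZ e^-1 (refl_integrableB IHn (IHm n)).
  apply: refl_integrable_ext => x [x0 /(_ e Ee)[u0 _]].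
  rewrite -!exprnP !exprS; move: (_ ^+ n) (_ ^+ m) => A B.
  by field; rewrite e0 u0.
elim: n => [|n IHn].
  have := refl_integrableD (IHm (-1)) (refl_integrableZ e (refl_integrable_out m.+1)).
  apply: refl_integrable_ext => x [x0 /(_ e Ee)[u0 _]].
  by rewrite exprN1 !exprS; move: (_ ^+ m) => B; field; rewrite x0 u0.
have := refl_integrableD (IHm (- n.+2%:Z)) (refl_integrableZ e IHn).
apply: refl_integrable_ext => x [x0 /(_ e Ee)[u0 _]].
rewrite -!exprnN -!exprVn !exprS; move: (_ ^+ n) (_ ^+ m) => A B.
by field; rewrite x0 u0.
Qed.

End OnePole.

Definition out_prod (es : seq R[i]) x := \prod_(e <- es) (1 - e * x)^-1.

(** Distinct poles are separated by 1/((1 - ex)(1 - fx)) = (e/(1 - ex) - f/(1 - fx))/(e - f). The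
    list may repeat a pole; the exponent m absorbs such repetitions. *)
Lemma refl_integrable_outs_aux (es : seq R[i]) : (forall f, f \in es -> E f) ->
  forall e m (n : int), E e -> SS (fun x => x ^ n * (1 - e * x)^-1 ^+ m * out_prod es x).
Proof.
elim: es => [|f es IH] Es e m n Ee.
  apply: refl_integrable_ext (refl_integrable_outX Ee m n) => x _.
  by rewrite /out_prod big_nil mulr1.
have Ef : E f by apply: Es; rewrite mem_head.
have {}IH e' m' n' : E e' ->
    SS (fun x => x ^ n' * (1 - e' * x)^-1 ^+ m' * out_prod es x).
  by apply: IH => g ges; apply: Es; rewrite inE ges orbT.
have opE x : out_prod (f :: es) x = (1 - f * x)^-1 * out_prod es x.
  by rewrite /out_prod big_cons.
have [fe|fe] := eqVneq e f.
  apply: refl_integrable_ext (IH e m.+1 n Ee) => x _.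
  by rewrite opE -fe exprSr !mulrA.
elim: m => [|m IHm].
  apply: refl_integrable_ext (IH f 1%N n Ef) => x _.
  by rewrite opE expr0 expr1 mulr1 mulrA.
have := refl_integrableZ (e - f)^-1 (refl_integrableB (refl_integrableZ e (IH e m.+1 n Ee))
  (refl_integrableZ f IHm)).
apply: refl_integrable_ext => x [x0 h]; have [u0 _] := h e Ee; have [v0 _] := h f Ef.
rewrite opE exprS; move: (x ^ n) (_ ^+ m) (out_prod es x) => A B C.
by field; rewrite u0 v0 subr_eq0 fe.
Qed.

Lemma refl_integrable_outs (es : seq R[i]) (n : int) : (forall f, f \in es -> E f) ->
  SS (fun x => x ^ n * out_prod es x).
Proof.
case: es => [|e es] Es.
  apply: refl_integrable_ext (refl_integrableX n) => x _.
  by rewrite /out_prod big_nil mulr1.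
have := @refl_integrable_outs_aux es _ e 1%N n _.
move=> h; apply: refl_integrable_ext (h _ _) => [x _|f fes|].
- by rewrite /out_prod big_cons expr1 mulrA.
- by apply: Es; rewrite inE fes orbT.
- by apply: Es; rewrite mem_head.
Qed.

(** An outer and an inner pole are separated by 1/(uv) = (1/u + 1/v - 1)/(1 - efs), where u = 1 - ex
    and v = 1 - fs/x satisfy (1 - u)(1 - v) = efs. This is where efs != 1 enters. *)
Lemma refl_integrable_rational (es fs : seq R[i]) (n : int) :
  (forall f, f \in es -> E f) -> (forall f, f \in fs -> E f) ->
  SS (fun x => x ^ n * out_prod es x * out_prod fs (s / x)).
Proof.
have tl (e : R[i]) (r : seq R[i]) : (forall f, f \in e :: r -> E f) ->
    E e /\ forall f, f \in r -> E f.
  by move=> h; split=> [|f fr]; apply: h; rewrite ?mem_head// inE fr orbT.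
have opE e r x : out_prod (e :: r) x = (1 - e * x)^-1 * out_prod r x.
  by rewrite /out_prod big_cons.
elim: es fs => [|e es IHe] fs Es Fs.
  apply: refl_integrable_refl.
  have := refl_integrableZ (s ^ n) (refl_integrable_outs (- n) Fs).
  apply: refl_integrable_ext => x [x0 _].
  have -> : s / (s / x) = x by field; rewrite s0 x0.
  by rewrite {2}/out_prod big_nil mulr1 expfzMl exprz_inv !mulrA.
elim: fs Fs => [|f fs IHf] Fs.
  apply: refl_integrable_ext (refl_integrable_outs n Es) => x _.
  by rewrite {3}/out_prod big_nil mulr1.
have [Ee Es'] := tl _ _ Es; have [Ef Fs'] := tl _ _ Fs.
have := refl_integrableZ (1 - e * f * s)^-1 (refl_integrableB
  (refl_integrableD (IHf Fs') (IHe _ Es' Fs)) (IHe _ Es' Fs')).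
apply: refl_integrable_ext => x [x0 h]; have [u0 _] := h e Ee; have [_ v0] := h f Ef.
rewrite !opE; move: (x ^ n) (out_prod _ _) (out_prod _ _) => A B C.
have k0 : 1 - e * f * s != 0 by rewrite subr_eq0 eq_sym Eef.
have v0' : x - f * s != 0.
  have -> : x - f * s = x * (1 - f * (s / x)) by field.
  by rewrite mulf_neq0.
by field; rewrite u0 k0 x0 v0'.
Qed.

Lemma refl_integrable_laurent (es fs : seq R[i]) (h : laurent R[i]) :
  (forall f, f \in es -> E f) -> (forall f, f \in fs -> E f) ->
  SS (fun x => leval h x * out_prod es x * out_prod fs (s / x)).
Proof.
move=> Es Fs; have [N hN] := laurent_bounded h.
have := @refl_integrable_sum _ (index_enum 'I_(2 * N).+1) (fun i x => h (i%:Z - N%:Z) *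
  (x ^ (i%:Z - N%:Z) * out_prod es x * out_prod fs (s / x))).
move=> H; apply: refl_integrable_ext (H _) => [x _|i].
  by rewrite (leval_bounded _ hN) !big_distrl /=; apply: eq_bigr => i _; rewrite !mulrA.
exact/refl_integrableZ/refl_integrable_rational.
Qed.

Lemma ci_antisym (es : seq R[i]) (h : laurent R[i]) : (forall f, f \in es -> E f) ->
  ci (fun x => (leval h x - leval h (s / x)) * out_prod es x * out_prod es (s / x) / x) 0.
Proof.
move=> Es; have [I [h1 h2]] := refl_integrable_laurent h Es Es.
have := ciB h1 h2; rewrite subrr; apply: ci_ext => // x /regular_trace[x0 _].
have -> : s / (s / x) = x by field; rewrite s0 x0.
by ring.
Qed.

End SymmetricResidues.

(** * Uniform limits and q-shifted factorials *)

Section UniformLimits.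
Variable R : realType.
Implicit Types (u : nat -> R[i]) (q x y : R[i]) (eps r B : R).

Definition tends_to u (l : R[i]) := forall eps, 0 < eps ->
  exists N, forall n, (N <= n)%N -> normc (u n - l) <= eps.

Lemma real_cauchy_limit (v : nat -> R) : (forall eps, 0 < eps ->
    exists N, forall n, (N <= n)%N -> `|v n - v N| <= eps) ->
  exists l, forall eps, 0 < eps -> exists N, forall n, (N <= n)%N -> `|v n - l| <= eps.
Proof.
move=> h; have cv : cvg (v @ \oo).
  apply/cauchy_cvgP/cauchy_exP => eps eps0.
  have [N hN] := h _ (divr_gt0 eps0 (ltr0Sn _ 1)); exists (v N); exists N => // n /= Nn.
  by rewrite -ball_normE /= distrC; apply: le_lt_trans (hN n Nn) _; lra.
exists (lim (v @ \oo)) => eps eps0.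
have /cvgrPdist_le/(_ _ eps0)[N _ hN] := cv.
by exists N => n Nn; rewrite distrC; apply: hN.
Qed.

Lemma complex_cauchy_limit u : (forall eps, 0 < eps ->
    exists N, forall n, (N <= n)%N -> normc (u n - u N) <= eps) ->
  exists l, tends_to u l.
Proof.
move=> h.
have [|a ha] := @real_cauchy_limit (fun n => complex.Re (u n)).
  move=> eps /h[N hN]; exists N => n /hN; apply: le_trans; apply: le_trans (Re_le_normc _).
  by case: (u n) (u N) => ? ? [? ?].
have [|b hb] := @real_cauchy_limit (fun n => complex.Im (u n)).
  move=> eps /h[N hN]; exists N => n /hN; apply: le_trans; apply: le_trans (Im_le_normc _).
  by case: (u n) (u N) => ? ? [? ?].
exists (a +i* b)%C => eps eps0; have e2 : 0 < eps / 2 by rewrite divr_gt0.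
have [N1 h1] := ha _ e2; have [N2 h2] := hb _ e2.
exists (maxn N1 N2) => n; rewrite geq_max => /andP[/h1 n1 /h2 n2].
apply: le_trans (normc_le_Re_Im _) _.
have -> : complex.Re (u n - (a +i* b)%C) = complex.Re (u n) - a by case: (u n).
have -> : complex.Im (u n - (a +i* b)%C) = complex.Im (u n) - b by case: (u n).
by lra.
Qed.

Lemma tends_to_cvg u l : tends_to u l -> u @ \oo --> l.
Proof.
move=> ul; apply/cvgrPdist_le => e e0.
have eE : e = (complex.Re e)%:C%C by rewrite RRe_real// realE ltW.
rewrite eE ltcR in e0; have [N hN] := ul _ e0; exists N => // n /= Nn.
by rewrite eE normcEr lecR normc_sub; apply: hN.
Qed.

Lemma tends_to_lim u l : tends_to u l -> lim (u @ \oo) = l.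
Proof. by move=> /tends_to_cvg; apply: cvg_lim. Qed.

Lemma tends_to_le u l a B : tends_to u l -> (exists N, forall n, (N <= n)%N -> normc (u n - a) <= B) ->
  normc (l - a) <= B.
Proof.
move=> ul [N hN]; apply/ler_addgt0Pr => eps /ul[M hM].
have n1 := hM (maxn N M) (leq_maxr _ _); have n2 := hN (maxn N M) (leq_maxl _ _).
have := normc_dist (u (maxn N M)) l a; rewrite (normc_sub l (u _)); lra.
Qed.

Lemma geometric_small r eps : 0 <= r -> r < 1 -> 0 < eps ->
  exists N, forall n, (N <= n)%N -> r ^+ n <= eps.
Proof.
move=> r0 r1 eps0; have : `|r| < 1 by rewrite ger0_norm.
move=> /cvg_expr/cvgrPdist_le/(_ _ eps0)[N _ hN]; exists N => n Nn.
by have := hN n Nn; rewrite /= sub0r normrN ger0_norm ?exprn_ge0.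
Qed.

(** From 1 + x <= e^x, with B (1 - r^n)/(1 - r) the partial sum of the terms B r^j. *)
Lemma prod_le_expR (w : nat -> R) B r n : 0 <= B -> 0 <= r -> r < 1 ->
  (forall j, 0 <= w j <= 1 + B * r ^+ j) -> \prod_(0 <= j < n) w j <= expR (B / (1 - r)).
Proof.
move=> B0 r0 r1 hw; have r10 : 0 < 1 - r by lra.
apply: (@le_trans _ _ (expR (B / (1 - r) * (1 - r ^+ n)))); last first.
  by rewrite ler_expR ler_piMr// ?divr_ge0 ?(ltW r10)// gerBl exprn_ge0.
elim: n => [|n IH]; first by rewrite big_nil expr0 subrr mulr0 expR0.
rewrite big_nat_recr//=; have /andP[w0 wn] := hw n.
have -> : B / (1 - r) * (1 - r ^+ n.+1) = B / (1 - r) * (1 - r ^+ n) + B * r ^+ n.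
  by rewrite exprS; field; rewrite gt_eqF.
rewrite expRD ler_pM ?prodr_ge0//; first by move=> j _; have /andP[] := hw j.
by apply: le_trans wn _; exact: expR_ge1Dx.
Qed.

Definition qpoch_trunc q y n : R[i] := \prod_(0 <= j < n) (1 - y * q ^+ j).

(** * Uniform estimates for q-shifted factorials *)

Section QPochhammer.
Variable q : R[i].
Hypothesis q1 : normc q < 1.
Let r := normc q.
Let r0 : 0 <= r. Proof. exact: normc_ge0. Qed.

Lemma normc_prod (I : Type) (s : seq I) (F : I -> R[i]) :
  normc (\prod_(i <- s) F i) = \prod_(i <- s) normc (F i).
Proof. by elim/big_ind2: _ => // [|? ? ? ? <- <-]; rewrite ?normc1// normcM. Qed.

Lemma qpoch_trunc_estimates B : 0 <= B -> exists2 C, 0 <= C & forall y, normc y <= B ->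
  forall n, normc (qpoch_trunc q y n) <= C /\
    forall k, normc (qpoch_trunc q y (n + k) - qpoch_trunc q y n) <= C * r ^+ n.
Proof.
move=> B0; have r10 : 0 < 1 - r by rewrite subr_gt0.
pose C0 := expR (B / (1 - r)); have C00 : 0 <= C0 := expR_ge0 _.
pose C1 := C0 * B / (1 - r).
have C10 : 0 <= C1 by rewrite divr_ge0 ?mulr_ge0// ltW.
exists (C0 + C1); first exact: addr_ge0.
move=> y yB n.
have hP m : normc (qpoch_trunc q y m) <= C0.
  rewrite normc_prod; apply: prod_le_expR => // j; rewrite normc_ge0 /=.
  apply: le_trans (normc_triangleB _ _) _; rewrite normc1 lerD2l normcM normcX.
  by rewrite ler_wpM2r ?exprn_ge0.
split; first by have := hP n; lra.
(* Consecutive truncations differ by at most C0 B r^m, which is exactly the growth of this bound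
   from m to m + 1. *)
move=> k; apply: (@le_trans _ _ (C1 * (r ^+ n - r ^+ (n + k)))); last first.
  have := mulr_ge0 C10 (exprn_ge0 (n + k) r0); have := mulr_ge0 C00 (exprn_ge0 n r0); lra.
elim: k => [|k IH]; first by rewrite addn0 !subrr normc0 mulr0.
rewrite addnS; set m := (n + k)%N in IH *.
apply: le_trans (normc_dist (qpoch_trunc q y m) _ _) _.
have -> : C1 * (r ^+ n - r ^+ m.+1) = C0 * B * r ^+ m + C1 * (r ^+ n - r ^+ m).
  by rewrite /C1 exprS; field; rewrite gt_eqF.
apply: lerD => //; rewrite /qpoch_trunc big_nat_recr//= -/(qpoch_trunc q y m).
have -> : qpoch_trunc q y m * (1 - y * q ^+ m) - qpoch_trunc q y m =
  - (qpoch_trunc q y m * (y * q ^+ m)) by ring.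
rewrite normc_opp !normcM normcX -mulrA ler_pM ?mulr_ge0 ?normc_ge0 ?exprn_ge0//.
by rewrite ler_wpM2r ?exprn_ge0.
Qed.

Lemma qpoch_tends_to y : tends_to (qpoch_trunc q y) (qpoch q y).
Proof.
have [C C0 hC] := qpoch_trunc_estimates (normc_ge0 y).
have [|l hl] := @complex_cauchy_limit (qpoch_trunc q y).
  move=> eps eps0; have C1 : 0 < C + 1 by lra.
  have [N hN] := geometric_small r0 q1 (divr_gt0 eps0 C1); exists N => n Nn.
  have [_ /(_ (n - N)%N)] := hC y (lexx _) N; rewrite subnKC// => /le_trans; apply.
  have := hN N (leqnn _); rewrite ler_pdivlMr// mulrDr mulr1 mulrC => h.
  by apply: le_trans h; rewrite lerDl exprn_ge0.
by rewrite /qpoch (tends_to_lim hl).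
Qed.

Lemma qpoch_estimates B : 0 <= B -> exists2 C, 0 <= C & forall y, normc y <= B ->
  normc (qpoch q y) <= C /\
  forall n, normc (qpoch_trunc q y n - qpoch q y) <= C * r ^+ n.
Proof.
move=> /qpoch_trunc_estimates[C C0 hC]; exists C => // y yB.
have ht := qpoch_tends_to y; split.
  have := tends_to_le (a := 0) (B := C) ht; rewrite subr0; apply.
  by exists 0%N => n _; rewrite subr0; have [] := hC _ yB n.
move=> n; rewrite normc_sub; apply: (tends_to_le ht).
by exists n => m nm; have [_ /(_ (m - n)%N)] := hC _ yB n; rewrite subnKC.
Qed.

Lemma qpoch_shift y : qpoch q y = (1 - y) * qpoch q (q * y).
Proof.
apply/eqP; rewrite -subr_eq0 -normc_eq0 eq_le normc_ge0 andbT.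
apply/ler_addgt0Pr => eps eps0; rewrite add0r.
pose e := eps / (1 + normc (1 - y)).
have k0 := normc_ge0 (1 - y); have d0 : 0 < 1 + normc (1 - y) by lra.
have e0 : 0 < e by rewrite divr_gt0.
have [N hN] := qpoch_tends_to y e0; have [M hM] := qpoch_tends_to (q * y) e0.
have := hN (maxn N M).+1 (leqW (leq_maxl _ _)); have := hM (maxn N M) (leq_maxr _ _).
set m := maxn N M.
have -> : qpoch_trunc q y m.+1 = (1 - y) * qpoch_trunc q (q * y) m.
  rewrite /qpoch_trunc big_nat_recl// expr0 mulr1; congr (_ * _).
  by apply: eq_bigr => j _; rewrite exprS; ring.
move=> h1 h2; have -> : eps = e + normc (1 - y) * e by rewrite /e; field; rewrite gt_eqF.
apply: le_trans (normc_dist ((1 - y) * qpoch_trunc q (q * y) m) _ _) _.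
rewrite normc_sub lerD// -mulrBr normcM ler_wpM2l//.
Qed.

(** From some J on, t = B r^j is at most 1/2 and 1/(1 - t) <= 1 + 2t, so the reciprocals have the
    form required by [prod_le_expR]. The finitely many earlier factors are bounded by hypothesis and
    absorbed by enlarging D. *)
Lemma qpoch_trunc_inv_bound B (Y : set R[i]) : 0 <= B -> 0 < r ->
  (forall y, Y y -> normc y <= B) ->
  (forall j, exists2 d : R, 0 < d & forall y, Y y -> d <= normc (1 - y * q ^+ j)) ->
  exists2 C, 0 < C & forall y, Y y -> forall n, normc (qpoch_trunc q y n)^-1 <= C.
Proof.
move=> B0 rr0 YB hd; have B2 : 0 < 2 * B + 1 by lra.
have [J hJ] := geometric_small r0 q1 (divr_gt0 (ltr01 : (0 : R) < 1) B2).
have small j : (J <= j)%N -> B * r ^+ j <= 2^-1.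
  by move=> /hJ; rewrite ler_pdivlMr//; have := exprn_ge0 j r0; lra.
have [D D0 hD] : exists2 D, 0 <= D & forall j y, Y y ->
    normc (1 - y * q ^+ j)^-1 <= 1 + D * r ^+ j.
  have : exists2 D, 2 * B <= D & forall j, (j < J)%N -> forall y, Y y ->
      normc (1 - y * q ^+ j)^-1 <= 1 + D * r ^+ j.
    elim: J {hJ small} => [|J [D DB hD]]; first by exists (2 * B).
    have [d d0 hdJ] := hd J; exists (D + d^-1 / r ^+ J).
      by rewrite (le_trans DB)// lerDl divr_ge0 ?exprn_ge0// invr_ge0 ltW.
    have extra j : 0 <= d^-1 / r ^+ J * r ^+ j.
      by rewrite mulr_ge0 ?exprn_ge0// divr_ge0 ?exprn_ge0// invr_ge0 ltW.
    move=> j; rewrite ltnS leq_eqVlt => /predU1P[->|jJ] y Yy; rewrite mulrDl.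
      rewrite divfK ?expf_neq0 ?gt_eqF// normcV.
      have h1 : (normc (1 - y * q ^+ J))^-1 <= d^-1.
        by rewrite lef_pV2 ?posrE ?hdJ// (lt_le_trans d0)// hdJ.
      have : 0 <= D * r ^+ J by rewrite mulr_ge0 ?exprn_ge0//; lra.
      lra.
    by have := hD j jJ y Yy; have := extra j; lra.
  move=> [D DB hD]; exists D; first lra.
  move=> j y Yy; have [/hD/(_ y Yy)//|Jj] := ltnP j J.
  have t1 := small j Jj; set t := B * r ^+ j in t1.
  have t0 : 0 <= t by rewrite mulr_ge0 ?exprn_ge0.
  have yt : normc (y * q ^+ j) <= t.
    by rewrite normcM normcX ler_wpM2r ?exprn_ge0// YB.
  have low : 1 - t <= normc (1 - y * q ^+ j).
    by have := normc_triangle (1 - y * q ^+ j) (y * q ^+ j); rewrite subrK normc1; lra.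
  have t10 : 0 < 1 - t by lra.
  rewrite normcV; apply: (@le_trans _ _ (1 - t)^-1).
    by rewrite lef_pV2 ?posrE//; lra.
  apply: (@le_trans _ _ (1 + 2 * t)).
    by rewrite -div1r ler_pdivrMr//; have := mulr_ge0 t0 t0; nra.
  by rewrite lerD2l mulrA ler_wpM2r ?exprn_ge0.
exists (expR (D / (1 - r))); first exact: expR_gt0.
move=> y Yy n; rewrite normcV normc_prod.
rewrite -prodfV; apply: prod_le_expR => // j; rewrite invr_ge0 normc_ge0 /=.
by have := hD j y Yy; rewrite normcV.
Qed.

End QPochhammer.

(** * Uniform convergence on a set *)

Section UniformConvergence.
Variable K : set R[i].
Implicit Types (f g : nat -> R[i] -> R[i]) (F G : R[i] -> R[i]).

Definition bounded_on F := exists2 B : R, 0 <= B & forall x, K x -> normc (F x) <= B.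

Definition ucvg f F := bounded_on F /\ forall eps, 0 < eps ->
  exists N, forall n, (N <= n)%N -> forall x, K x -> normc (f n x - F x) <= eps.

Lemma bounded_onM F G : bounded_on F -> bounded_on G -> bounded_on (fun x => F x * G x).
Proof.
move=> [A A0 hA] [B B0 hB]; exists (A * B); first exact: mulr_ge0.
by move=> x Kx; rewrite normcM ler_pM ?normc_ge0 ?hA ?hB.
Qed.

Lemma bounded_on_cst a : bounded_on (fun=> a).
Proof. by exists (normc a); rewrite ?normc_ge0. Qed.

Lemma ucvg_cst F : bounded_on F -> ucvg (fun=> F) F.
Proof.
by move=> hF; split=> // eps eps0; exists 0%N => n _ x _; rewrite subrr normc0 ltW.
Qed.

Lemma ucvgM f F g G : ucvg f F -> ucvg g G -> ucvg (fun n x => f n x * g n x) (fun x => F x * G x).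
Proof.
move=> [bF fF] [bG gG]; split; first exact: bounded_onM.
have [A A0 hA] := bF; have [B B0 hB] := bG => eps eps0.
pose e := Num.min 1 (eps / (A + B + 1)).
have d0 : 0 < A + B + 1 by lra.
have e0 : 0 < e by rewrite lt_min ltr01 divr_gt0.
have e1 : e <= 1 by rewrite ge_min lexx.
have e2 : e * (A + B + 1) <= eps by rewrite -ler_pdivlMr// ge_min lexx orbT.
have [N hN] := fF _ e0; have [M hM] := gG _ e0.
exists (maxn N M) => n; rewrite geq_max => /andP[Nn Mn] x Kx.
have hf := hN n Nn x Kx; have hg := hM n Mn x Kx.
have -> : f n x * g n x - F x * G x =
  (f n x - F x) * G x + (F x * (g n x - G x) + (f n x - F x) * (g n x - G x)) by ring.
have leM (u v : R[i]) (U V : R) : normc u <= U -> normc v <= V -> normc (u * v) <= U * V.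
  by move=> uU vV; rewrite normcM ler_pM ?normc_ge0.
have := normc_triangle ((f n x - F x) * G x)
  (F x * (g n x - G x) + (f n x - F x) * (g n x - G x)).
have := normc_triangle (F x * (g n x - G x)) ((f n x - F x) * (g n x - G x)).
have := leM _ _ _ _ hf (hB x Kx); have := leM _ _ _ _ (hA x Kx) hg.
have := leM _ _ _ _ hf hg; have : e * e <= e by rewrite ler_piMr// ltW.
lra.
Qed.

Lemma ucvg_ext f F g G : (forall n x, K x -> f n x = g n x) ->
  (forall x, K x -> F x = G x) -> ucvg f F -> ucvg g G.
Proof.
move=> fg FG [[B B0 hB] h]; split; first by exists B => // x Kx; rewrite -FG// hB.
by move=> eps /h[N hN]; exists N => n Nn x Kx; rewrite -fg// -FG// hN.
Qed.

Lemma ucvg_prod (f : R[i] -> nat -> R[i] -> R[i]) (F : R[i] -> R[i] -> R[i]) (s : seq R[i]) :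
  (forall b, b \in s -> ucvg (f b) (F b)) ->
  ucvg (fun n x => \prod_(b <- s) f b n x) (fun x => \prod_(b <- s) F b x).
Proof.
elim: s => [|b s IH] h.
  apply: ucvg_ext (ucvg_cst (bounded_on_cst 1)) => [n x _|x _]; by rewrite big_nil.
have hb : ucvg (f b) (F b) by apply: h; rewrite mem_head.
have hs : ucvg (fun n x => \prod_(b <- s) f b n x) (fun x => \prod_(b <- s) F b x).
  by apply: IH => d ds; apply: h; rewrite inE ds orbT.
by apply: ucvg_ext (ucvgM hb hs) => [n x _|x _]; rewrite big_cons.
Qed.

Variable q : R[i].
Hypothesis q1 : normc q < 1.

Lemma ucvg_qpoch (y : R[i] -> R[i]) : bounded_on y ->
  ucvg (fun n x => qpoch_trunc q (y x) n) (fun x => qpoch q (y x)).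
Proof.
move=> [B B0 yB]; have [C C0 hC] := qpoch_estimates q1 B0; split.
  by exists C => // x /yB/hC[].
move=> eps eps0; have C1 : 0 < C + 1 by lra.
have [N hN] := geometric_small (normc_ge0 q) q1 (divr_gt0 eps0 C1).
exists N => n Nn x /yB/hC[_ /(_ n)] /le_trans; apply.
have := hN n Nn; rewrite ler_pdivlMr// mulrDr mulr1 mulrC => h.
by apply: le_trans h; rewrite lerDl exprn_ge0// normc_ge0.
Qed.

(** A common bound C for the reciprocals of the truncations passes to the limit as the lower bound
    1/C. This yields both the nonvanishing of the infinite product and the uniform convergence of
    the reciprocals. *)
Lemma ucvg_qpochV (y : R[i] -> R[i]) : bounded_on y -> q != 0 ->
  (forall j, exists2 d : R, 0 < d & forall x, K x -> d <= normc (1 - y x * q ^+ j)) ->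
  ucvg (fun n x => (qpoch_trunc q (y x) n)^-1) (fun x => (qpoch q (y x))^-1).
Proof.
move=> yb q0 hd; have [B B0 yB] := yb; have [_ hcv] := ucvg_qpoch yb.
have [|_ [x Kx <-]|j|C C0 hC] := @qpoch_trunc_inv_bound q q1 B (y @` K) B0.
- by rewrite normc_gt0.
- exact: yB.
- by have [d d0 hdj] := hd j; exists d => // _ [x Kx <-]; apply: hdj.
have {}hC x n : K x -> normc (qpoch_trunc q (y x) n)^-1 <= C.
  by move=> Kx; apply: hC; exists x.
have nz x n : K x -> qpoch_trunc q (y x) n != 0.
  move=> Kx; rewrite prodf_seq_neq0; apply/allP => j _ /=.
  by have [d d0 /(_ x Kx) h] := hd j; rewrite -normc_gt0 (lt_le_trans d0).
have low x : K x -> C^-1 <= normc (qpoch q (y x)).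
  move=> Kx; apply/ler_addgt0Pr => eps /hcv[N /(_ N (leqnn _) x Kx)].
  have : C^-1 <= normc (qpoch_trunc q (y x) N).
    rewrite -[leRHS]invrK lef_pV2 ?posrE// ?invr_gt0 ?normc_gt0 ?nz//.
    by rewrite -normcV hC.
  have := normc_triangle (qpoch_trunc q (y x) N - qpoch q (y x)) (qpoch q (y x)).
  rewrite subrK; lra.
have Ci0 : 0 < C^-1 by rewrite invr_gt0.
have nzl x : K x -> qpoch q (y x) != 0.
  by move=> /low h; rewrite -normc_gt0 (lt_le_trans Ci0).
have up x : K x -> normc (qpoch q (y x))^-1 <= C.
  by move=> Kx; rewrite normcV -[leRHS]invrK lef_pV2 ?posrE ?low// normc_gt0 nzl.
split; first by exists C => //; apply: ltW.
move=> eps eps0; have [N hN] := hcv _ (divr_gt0 eps0 (mulr_gt0 C0 C0)).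
exists N => n Nn x Kx.
have -> : (qpoch_trunc q (y x) n)^-1 - (qpoch q (y x))^-1 =
  - (qpoch_trunc q (y x) n - qpoch q (y x)) *
    ((qpoch_trunc q (y x) n)^-1 * (qpoch q (y x))^-1).
  by field; rewrite nz// nzl.
rewrite normcM normc_opp; have := hN n Nn x Kx; rewrite ler_pdivlMr ?mulr_gt0// => h.
apply: le_trans h; rewrite ler_wpM2l ?normc_ge0// normcM.
by rewrite ler_pM ?normc_ge0 ?hC ?up.
Qed.

End UniformConvergence.

(** * Uniform limits under the contour integral *)

Section ContourLimits.
Variable c : R -> R[i].
Hypothesis c_rect : rectifiable c.
Local Notation ci := (is_contour_integral c).
Local Notation K := (trace c).

Lemma ci_limit f F (I : nat -> R[i]) : ucvg K f F -> (forall n, ci (f n) (I n)) ->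
  exists J, tends_to I J /\ ci F J.
Proof.
move=> [_ fF] fI; have [L L0 hL] := ci_bound_ex c_rect.
have [eps eps0|J hJ] := @complex_cauchy_limit I.
  have d0 : 0 < 2 * (L + 1) by lra.
  have [N hN] := fF _ (divr_gt0 eps0 d0); exists N => n Nn.
  apply: le_trans (hL (eps / (2 * (L + 1)) * 2) _ _ (ciB (fI n) (fI N)) _) _.
    move=> x Kx; have := hN n Nn x Kx; have := hN N (leqnn _) x Kx.
    have := normc_dist (F x) (f n x) (f N x); rewrite (normc_sub (F x)); lra.
  have -> : eps / (2 * (L + 1)) * 2 * L = eps * (L / (L + 1)) by field; rewrite gt_eqF//; lra.
  by rewrite ler_piMr// ?(ltW eps0)// ler_pdivrMr; lra.
exists J; split=> //; apply: ci_approx => // eps eps0.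
have [N hN] := fF _ eps0; have [M hM] := hJ _ eps0.
exists (f (maxn N M)), (I (maxn N M)); split=> //.
  by move=> x Kx; rewrite normc_sub; apply: hN => //; apply: leq_maxl.
by rewrite normc_sub; apply: hM; apply: leq_maxr.
Qed.

Lemma ci_limit0 f F : ucvg K f F -> (forall n, ci (f n) 0) -> ci F 0.
Proof.
move=> fF /(ci_limit fF)[J [h hJ]]; suff -> : 0 = J by [].
apply/eqP; rewrite eq_sym -normc_eq0 eq_le normc_ge0 andbT.
rewrite -[J]subr0; apply: (tends_to_le h).
by exists 0%N => n _; rewrite subr0 normc0.
Qed.

End ContourLimits.

End UniformLimits.

(** * Kernels invariant under x -> s/x *)

Section LaurentProduct.
Variable K : fieldType.
Implicit Types (f g : laurent K) (x : K).

Definition lmul f g : laurent K := linext (fun n => Defs.lshift n g) f.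

Lemma leval_lmul f g x : x != 0 -> leval (lmul f g) x = leval f x * leval g x.
Proof.
move=> x0; rewrite leval_linext levalE mulrC -[RHS]linextZ; apply: eq_fsbigr => n _ /=.
by congr (_ * _); rewrite leval_lshift// mulrC.
Qed.

End LaurentProduct.

Section Kernel.
Variables (R : realType) (c : R -> R[i]).
Hypotheses (c_cont : {within `[0, 1], continuous c}) (c_closed : c 0 = c 1)
  (c_rect : rectifiable c).
Local Notation ci := (is_contour_integral c).
Local Notation K := (trace c).
Variables (s T : R[i]) (E : set R[i]).
Hypothesis s0 : s != 0.
Hypothesis K0 : ~ K 0.
Hypothesis ci0V : ci (fun x => (x - 0)^-1) T.
Hypothesis E0 : forall e, E e -> e != 0.
Hypothesis Eout : forall e, E e -> ~ K e^-1 /\ ci (fun x => (x - e^-1)^-1) 0.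
Hypothesis Ein : forall e, E e -> ~ K (e * s) /\ ci (fun x => (x - e * s)^-1) T.
Hypothesis Eef : forall e f, E e -> E f -> e * f * s != 1.
Variable q : R[i].
Hypotheses (q1 : normc q < 1) (q0 : q != 0).

Let Kx0 x : K x -> x != 0. Proof. by move=> Kx; apply: contra_not_neq K0 => <-. Qed.

Lemma bounded_on_id : bounded_on K id.
Proof. by have [M M0 hM] := trace_bounded c_cont; exists M => //; apply: ltW. Qed.

Lemma bounded_on_inv : bounded_on K (fun x => x^-1).
Proof.
have [d d0 hd] := trace_dist c_cont K0; exists d^-1; first by rewrite invr_ge0 ltW.
move=> x Kx; have := hd x Kx; rewrite subr0 => dx.
by rewrite normcV lef_pV2 ?posrE// (lt_le_trans d0).
Qed.

Lemma bounded_onX (F : R[i] -> R[i]) n : bounded_on K F -> bounded_on K (fun x => F x ^+ n).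
Proof.
move=> [B B0 hB]; exists (B ^+ n); first exact: exprn_ge0.
by move=> x Kx; rewrite normcX lerXn2r ?nnegrE ?normc_ge0 ?hB.
Qed.

Lemma bounded_onXz (n : int) : bounded_on K (fun x => x ^ n).
Proof.
case: n => n; first exact: (bounded_onX n bounded_on_id).
have [B B0 hB] := bounded_onX n.+1 bounded_on_inv; exists B => // x Kx.
by rewrite NegzE -exprnN -exprVn hB.
Qed.

Lemma bounded_on_leval (h : laurent R[i]) : bounded_on K (leval h).
Proof.
have [N hN] := laurent_bounded h.
have [B B0 hB] : bounded_on K (fun x => \sum_(i <- index_enum 'I_(2 * N).+1)
    h (i%:Z - N%:Z) * x ^ (i%:Z - N%:Z)).
  elim: (index_enum _) => [|i r [B B0 hB]].
    by exists 0 => // x _; rewrite big_nil normc0.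
  have [A A0 hA] := bounded_onM (bounded_on_cst K (h (i%:Z - N%:Z))) (bounded_onXz (i%:Z - N%:Z)).
  exists (A + B) => [|x Kx]; first exact: addr_ge0.
  by rewrite big_cons; apply: le_trans (normc_triangle _ _) _; rewrite lerD ?hA ?hB.
by exists B => // x Kx; rewrite (leval_bounded _ hN) hB.
Qed.

Variables (A1 A2 : R[i]) (Bs Fs : seq R[i]).
Hypothesis BsE : forall b j, b \in Bs -> E (b * q ^+ j).
Hypothesis FsE : forall b j, b \in Fs -> E (b * q ^+ j).

(** One shape for three functions: the weight itself, and the kernels [S1] (s = 1) and [S0] (s = q).
    It is invariant under x -> s/x when the two lists agree and A2 = A1 s^2. *)
Definition qkernel x : R[i] := qpoch q (A1 * x ^+ 2) * qpoch q (A2 * x ^- 2) *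
  \prod_(b <- Bs) (qpoch q (b * x))^-1 * \prod_(b <- Fs) (qpoch q (b * (s / x)))^-1.

Let pole_list (B : seq R[i]) n := [seq b * q ^+ j | b <- B, j <- index_iota 0 n].

Let out_prodE B n x :
  out_prod (pole_list B n) x = \prod_(b <- B) (qpoch_trunc q (b * x) n)^-1.
Proof.
rewrite /out_prod /pole_list big_allpairs_dep; apply: eq_bigr => b _.
rewrite /qpoch_trunc -prodfV; apply: eq_bigr => j _.
by rewrite mulrAC.
Qed.

Let numer_trunc x n := qpoch_trunc q (A1 * x ^+ 2) n * qpoch_trunc q (A2 * x ^- 2) n.

Let numer_laurent (h : laurent R[i]) n : exists h' : laurent R[i], forall x, x != 0 ->
  leval h' x = leval h x * numer_trunc x n.
Proof.
elim: n => [|n [h1 hh1]].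
  by exists h => x _; rewrite /numer_trunc /qpoch_trunc !big_nil !mulr1.
pose h2 := h1 - (A1 * q ^+ n) *: Defs.lshift 2 h1.
exists (h2 - (A2 * q ^+ n) *: Defs.lshift (- 2) h2) => x x0.
rewrite !(levalB, levalN, levalZ, leval_lshift)// hh1//.
rewrite /numer_trunc /qpoch_trunc !big_nat_recr//= -!/(qpoch_trunc _ _ _).
rewrite -[x ^ (- 2)]/(x ^- 2) -[x ^ 2]/(x ^+ 2).
by ring.
Qed.

Let kernel_trunc n x :=
  numer_trunc x n * out_prod (pole_list Bs n) x * out_prod (pole_list Fs n) (s / x).

Let pole_listE (B : seq R[i]) n : (forall b j, b \in B -> E (b * q ^+ j)) ->
  forall e, e \in pole_list B n -> E e.
Proof. by move=> hB e /allpairsP[[b j] /= [bB _ ->]]; apply: hB. Qed.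

Lemma kernel_ucvg : ucvg K kernel_trunc qkernel.
Proof.
have bid := bounded_on_id; have bV := bounded_on_inv.
have out b : b \in Bs -> ucvg K (fun n x => (qpoch_trunc q (b * x) n)^-1)
    (fun x => (qpoch q (b * x))^-1).
  move=> bB; apply: ucvg_qpochV => //; first exact: bounded_onM (bounded_on_cst K b) bid.
  move=> j; have Ee := BsE j bB; have e0 := E0 Ee.
  have [d d0 hd] := trace_dist c_cont (Eout Ee).1.
  exists (normc (b * q ^+ j) * d); first by rewrite mulr_gt0// normc_gt0.
  move=> x Kx; have -> : 1 - b * x * q ^+ j = - (b * q ^+ j) * (x - (b * q ^+ j)^-1).
    by rewrite mulrBr mulNr mulNr mulfV// opprK mulrAC addrC.
  by rewrite (normcM (- _)) normc_opp ler_wpM2l ?normc_ge0 ?hd.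
have inn b : b \in Fs -> ucvg K (fun n x => (qpoch_trunc q (b * (s / x)) n)^-1)
    (fun x => (qpoch q (b * (s / x)))^-1).
  move=> bB; apply: ucvg_qpochV => //.
    exact: bounded_onM (bounded_on_cst K b) (bounded_onM (bounded_on_cst K s) bV).
  move=> j; have Ee := FsE j bB; have e0 := E0 Ee.
  have [d d0 hd] := trace_dist c_cont (Ein Ee).1.
  have [M M0 hM] := trace_bounded c_cont.
  exists (d / M); first by rewrite divr_gt0.
  move=> x Kx; have x0 := Kx0 Kx.
  have -> : 1 - b * (s / x) * q ^+ j = (x - (b * q ^+ j) * s) / x by field.
  rewrite normcM normcV ler_pM ?hd ?invr_ge0 ?(ltW d0) ?(ltW M0)//.
  by rewrite lef_pV2 ?posrE ?hM// normc_gt0.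
have bA1 : bounded_on K (fun x => A1 * x ^+ 2).
  exact: bounded_onM (bounded_on_cst K A1) (bounded_onX 2 bid).
have bA2 : bounded_on K (fun x => A2 * x ^- 2).
  have [B B0 hB] := bounded_onM (bounded_on_cst K A2) (bounded_onX 2 bV).
  by exists B => // x Kx; rewrite -exprVn hB.
have := ucvgM (ucvgM (ucvgM (ucvg_qpoch q1 bA1) (ucvg_qpoch q1 bA2)) (ucvg_prod out)) (ucvg_prod inn).
by apply: ucvg_ext => [n x _|x _] //; rewrite /kernel_trunc !out_prodE.
Qed.

Let integrand_ucvg (h : R[i] -> R[i]) : bounded_on K h ->
  ucvg K (fun n x => h x * kernel_trunc n x / x) (fun x => h x * qkernel x / x).
Proof.
move=> bh; have bV := bounded_on_inv.
exact: ucvgM (ucvgM (ucvg_cst bh) kernel_ucvg) (ucvg_cst bV).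
Qed.

(** The two lists may differ here, so the lemma covers the weight, which is not invariant. *)
Lemma kernel_integrable (h : laurent R[i]) :
  exists J, ci (fun x => leval h x * qkernel x / x) J.
Proof.
have cn n : exists J, ci (fun x => leval h x * kernel_trunc n x / x) J.
  have [h' hh'] := numer_laurent h n.
  have [J [hJ _]] := refl_integrable_laurent c_cont c_closed c_rect s0 K0 ci0V E0 Eout Ein Eef
    h' (pole_listE (n := n) BsE) (pole_listE (n := n) FsE).
  exists J; apply: ci_ext hJ => x Kx.
  by rewrite hh' ?Kx0// /kernel_trunc !mulrA.
have [J hJ] := choice cn.
by have [I [_ hI]] := ci_limit c_rect (integrand_ucvg (bounded_on_leval h)) hJ; exists I.
Qed.

Lemma kernel_antisym (h : laurent R[i]) : Bs = Fs -> A2 = A1 * s ^+ 2 ->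
  ci (fun x => (leval h x - leval h (s / x)) * qkernel x / x) 0.
Proof.
move=> BF AA.
have bh : bounded_on K (fun x => leval h x - leval h (s / x)).
  have [B B0 hB] := bounded_on_leval (h - lrefl s h); exists B => // x Kx.
  by have := hB x Kx; rewrite levalB leval_lrefl.
apply: (ci_limit0 c_rect (integrand_ucvg bh)) => n.
have [h' hh'] := numer_laurent h n.
have := ci_antisym c_cont c_closed c_rect s0 K0 ci0V E0 Eout Ein Eef h' (pole_listE (n := n) BsE).
apply: ci_ext => x Kx; have x0 := Kx0 Kx.
have sx0 : s / x != 0 by rewrite mulf_neq0 ?invr_neq0.
rewrite !hh'// /kernel_trunc -BF.
(* Truncating all factors at the same n preserves the invariance exactly: the two numerator factors
   are exchanged. *)
have -> : numer_trunc (s / x) n = numer_trunc x n.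
  rewrite /numer_trunc AA mulrC; congr (qpoch_trunc q _ n * qpoch_trunc q _ n).
    by field; rewrite s0 x0.
  by field; rewrite x0.
by ring.
Qed.

End Kernel.

(** * Adjointness *)

Lemma quotient_of_products (F : fieldType) (z1 z2 z3 z4 z5 z6 z7 z8 z9 z10 : F) :
  z1 * (z2 * 1) / (z3 * (z4 * (z5 * (z6 * (z7 * (z8 * (z9 * (z10 * 1)))))))) =
  z1 * z2 * (z3^-1 * (z4^-1 * (z5^-1 * (z6^-1 * 1)))) * (z7^-1 * (z8^-1 * (z9^-1 * (z10^-1 * 1)))).
Proof. by rewrite !invfM invr1; ring. Qed.

Section AskeyWilsonPairing.
Variables (R : realType) (p : params R[i]) (c : R -> R[i]).
Hypotheses (hp : generic p) (hc : is_aw_contour p c).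
Local Notation ci := (is_contour_integral c).
Local Notation K := (trace c).
Implicit Types (f g h : laurent R[i]) (x : R[i]).

Let q := qpar p.
Let a := aw_a p.
Let b := aw_b p.
Let cc := aw_c p.
Let d := aw_d p.

Let c_cont : {within `[0, 1], continuous c}. Proof. by case: hc => -[]. Qed.
Let c_closed : c 0 = c 1. Proof. by case: hc => -[]. Qed.
Let c_rect : rectifiable c. Proof. by case: hc => -[]. Qed.

Lemma two_pi_i_neq0 : two_pi_i R != 0.
Proof.
rewrite /two_pi_i mulf_neq0 ?mulf_neq0 ?pnatr_eq0 ?neq0Ci//.
by rewrite -normc_eq0 normcr normr_eq0 gt_eqF// pi_gt0.
Qed.

(** The orientation hypothesis only gives the value of [contour_integral], whose default is 0. As 2
    pi i is not 0, the integral must really exist. *)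
Lemma ci_inv_interior w : interior_of c w ->
  ~ K w /\ ci (fun x => (x - w)^-1) (two_pi_i R).
Proof.
move=> hw; case: (hw) => Kw _; split=> //.
case: hc => _ /(_ w hw) hI _ _; move: hI; rewrite /contour_integral.
have [[I hI]|nex] := pselect (exists I, ci (fun x => (x - w)^-1) I).
  by move=> <-; apply: (@xgetI _ 0 [set J | ci (fun x => (x - w)^-1) J] I).
rewrite xgetPN; last by move=> I hI; apply: nex; exists I.
by move=> /esym/eqP; rewrite (negbTE two_pi_i_neq0).
Qed.

Lemma qpar_neq0 : q != 0. Proof. by rewrite -normr_gt0; case: hp. Qed.
Lemma qpar_lt1 : normc q < 1.
Proof. by have := q_lt1 hp; rewrite normcEr -[1]/(1%:C%C) ltcR. Qed.
Let qh0 : qh p != 0. Proof. by have := qpar_neq0; rewrite /q /qpar expf_eq0. Qed.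
Let k0N0 : k0 p != 0. Proof. by case: (params_neq0 hp). Qed.
Let k1N0 : k1 p != 0. Proof. by case: (params_neq0 hp). Qed.
Let u0N0 : u0 p != 0. Proof. by case: (params_neq0 hp). Qed.
Let u1N0 : u1 p != 0. Proof. by case: (params_neq0 hp). Qed.
Let q0 := qpar_neq0.
Let q1 := qpar_lt1.

(** For e in this set 1/e lies outside the contour, and both e and eq lie inside, so that it serves
    for s = 1 and for s = q. *)
Definition aw_poles : set R[i] :=
  [set e | exists2 t, t \in aw_params p & exists k : nat, e = t * q ^+ k].
Local Notation E := aw_poles.

Lemma aw_params_neq0 t : t \in aw_params p -> t != 0.
Proof.
rewrite !inE /aw_a /aw_b /aw_c /aw_d.
by case/or4P => /eqP ->; rewrite ?oppr_eq0 !mulf_neq0 ?invr_neq0.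
Qed.

Let E0 e : E e -> e != 0.
Proof. by case=> t /aw_params_neq0 t0 [k ->]; rewrite mulf_neq0// expf_neq0. Qed.

Let Eout e : E e -> ~ K e^-1 /\ ci (fun x => (x - e^-1)^-1) 0.
Proof.
case=> t ht [k ->]; case: hc => _ _ _ /(_ t k ht)[_ ext].
rewrite invfM; split; first by case: ext.
exact: (ci_inv_exterior c_cont c_closed c_rect ext).
Qed.

Let E1 e : E e -> ~ K (e * 1) /\ ci (fun x => (x - e * 1)^-1) (two_pi_i R).
Proof.
case=> t ht [k ->]; case: hc => _ _ _ /(_ t k ht)[int _].
by rewrite mulr1; apply: ci_inv_interior.
Qed.

Let Eq e : E e -> ~ K (e * q) /\ ci (fun x => (x - e * q)^-1) (two_pi_i R).
Proof.
case=> t ht [k ->]; case: hc => _ _ _ /(_ t k.+1 ht)[int _].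
by rewrite -mulrA -exprSr; apply: ci_inv_interior.
Qed.

Let Eefq e e' (n : nat) : E e -> E e' -> e * e' * q ^+ n != 1.
Proof.
case=> t ht [k ->] [t' ht' [k' ->]].
have := aw_generic hp (- (k + k' + n)%N%:Z) ht ht'; apply: contra_neq => e1.
rewrite -exprnN; apply: (mulIf (expf_neq0 (k + k' + n) q0)); rewrite mulVf ?expf_neq0//.
by rewrite -e1 !exprD; ring.
Qed.

Let Eef1 e e' : E e -> E e' -> e * e' * 1 != 1.
Proof. exact: (@Eefq e e' 0). Qed.

Let K0 : ~ K 0. Proof. by case: hc => _ _ [K0 _] _. Qed.
Let ci0V : ci (fun x => (x - 0)^-1) (two_pi_i R).
Proof. by case: hc => _ _ /ci_inv_interior[]. Qed.
Let Kx0 x : K x -> x != 0. Proof. by move=> Kx; apply: contra_not_neq K0 => <-. Qed.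

Let inE4 t : t \in aw_params p -> forall j, E (t * q ^+ j).
Proof. by move=> ht j; exists t => //; exists j. Qed.

Let Bs0 := [:: a; b; cc; d].
Let Bs1 := [:: q * a; q * b; cc; d].

Let Bs0E t j : t \in Bs0 -> E (t * q ^+ j).
Proof. by move=> ht; exact: inE4. Qed.

Let Bs1E t j : t \in Bs1 -> E (t * q ^+ j).
Proof.
have sh e : e \in aw_params p -> E (q * e * q ^+ j).
  by move=> he; exists e => //; exists j.+1; rewrite exprS; ring.
rewrite !inE => /or4P[] /eqP ->.
- by apply: sh; rewrite mem_head.
- by apply: sh; rewrite !inE eqxx orbT.
- by apply: inE4; rewrite !inE eqxx !orbT.
- by apply: inE4; rewrite !inE eqxx !orbT.
Qed.

(** Removing 1 - x^2, 1 - ax and 1 - bx from the weight leaves a function symmetric in x and 1/x;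
    removing 1 - q/x^2, 1 - c/x and 1 - d/x leaves one symmetric in x and q/x. *)
Let S1 := qkernel 1 q q q Bs1 Bs1.
Let S0 := qkernel q q 1 (q ^+ 2) Bs0 Bs0.

Lemma aw_weightE x : aw_weight p x = qkernel 1 q 1 q Bs0 Bs1 x.
Proof.
rewrite /aw_weight /qkernel (mul1r (x ^+ 2)) (mul1r x^-1) /qpochs !big_cons !big_nil.
exact: quotient_of_products.
Qed.

Let fac1 x : K x -> 1 - a * x != 0 /\ 1 - b * x != 0.
Proof.
move=> Kx; have h t : t \in aw_params p -> 1 - t * x != 0.
  move=> ht; have /E0 t0 := inE4 ht 0; have [Kt _] := Eout (inE4 ht 0).
  rewrite expr0 mulr1 in t0 Kt; rewrite subr_eq0; apply: contra_not_neq Kt => e1.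
  by have -> : t^-1 = x by rewrite -[x](mulKf t0) -e1 mulr1.
by rewrite !h// ?mem_head// !inE eqxx orbT.
Qed.

Let fac0 x : K x -> 1 - cc / x != 0 /\ 1 - d / x != 0.
Proof.
move=> Kx; have x0 := Kx0 Kx; have h t : t \in aw_params p -> 1 - t / x != 0.
  move=> ht; have [Kt _] := E1 (inE4 ht 0).
  rewrite expr0 !mulr1 in Kt; rewrite subr_eq0; apply: contra_not_neq Kt => e1.
  by have -> : t = x by rewrite -[t](divfK x0) -e1 mul1r.
by rewrite !h// !inE eqxx !orbT.
Qed.

Lemma aw_weight_S1 x : K x ->
  aw_weight p x = (1 - x ^+ 2) / ((1 - a * x) * (1 - b * x)) * S1 x.
Proof.
move=> Kx; have [a1 b1] := fac1 Kx; rewrite aw_weightE /S1 /qkernel (mul1r (x ^+ 2)).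
rewrite (mul1r x^-1) !big_cons !big_nil.
rewrite (qpoch_shift q1 (x ^+ 2)) (qpoch_shift q1 (a * x)) (qpoch_shift q1 (b * x)).
rewrite (mulrA q a x) (mulrA q b x).
move: (qpoch q (q * x ^+ 2)) (qpoch q (q * x ^- 2)) (qpoch q (q * a * x))
  (qpoch q (q * b * x)) (qpoch q (cc * x)) (qpoch q (d * x)) (qpoch q (q * a / x))
  (qpoch q (q * b / x)) (qpoch q (cc / x)) (qpoch q (d / x)) => z1 z2 z3 z4 z5 z6 z7 z8 z9 z10.
rewrite (invfM _ z3) (invfM _ z4) (invfM (1 - a * x)).
by ring.
Qed.

Lemma aw_weight_S0 x : K x ->
  aw_weight p x = (1 - q * x ^- 2) / ((1 - cc / x) * (1 - d / x)) * S0 x.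
Proof.
move=> Kx; have [c1 d1] := fac0 Kx; have x0 := Kx0 Kx.
rewrite aw_weightE /S0 /qkernel (mul1r (x ^+ 2)) (mul1r x^-1) !big_cons !big_nil.
rewrite (qpoch_shift q1 (q * x ^- 2)) (qpoch_shift q1 (cc / x)) (qpoch_shift q1 (d / x)).
have sw t : t * (q / x) = q * (t / x) by ring.
rewrite !sw -(mulrA q a) -(mulrA q b) (mulrA q q) -expr2.
move: (qpoch q (x ^+ 2)) (qpoch q (q ^+ 2 * x ^- 2)) (qpoch q (a * x))
  (qpoch q (b * x)) (qpoch q (cc * x)) (qpoch q (d * x)) (qpoch q (q * (a / x)))
  (qpoch q (q * (b / x))) (qpoch q (q * (cc / x))) (qpoch q (q * (d / x)))
  => z1 z2 z3 z4 z5 z6 z7 z8 z9 z10.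
rewrite (invfM _ z9) (invfM _ z10) (invfM (1 - cc / x)).
by ring.
Qed.

Let itg f g x := leval f x * leval g x^-1 * aw_weight p x / x.

Lemma aw_pairing_ci f g : ci (itg f g) (two_pi_i R * aw_pairing p c f g).
Proof.
have [J hJ] := kernel_integrable c_cont c_closed c_rect (oner_neq0 _) K0 ci0V E0 Eout E1 Eef1
  q1 q0 1 q Bs0E Bs1E (lmul f (lrefl 1 g)).
have {}hJ : ci (itg f g) J.
  apply: ci_ext hJ => x Kx.
  by rewrite /itg leval_lmul ?Kx0// leval_lrefl div1r aw_weightE.
rewrite /aw_pairing -/(itg f g) (contour_integralE c_rect hJ).
by rewrite mulrA mulfV ?two_pi_i_neq0// mul1r.
Qed.

Lemma aw_pairing_unique f g J : ci (itg f g) J -> aw_pairing p c f g = (two_pi_i R)^-1 * J.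
Proof.
move=> hJ; rewrite -(ci_unique c_rect (aw_pairing_ci f g) hJ) mulrA mulVf ?mul1r//.
exact: two_pi_i_neq0.
Qed.

Lemma aw_pairing_linl k f f' g :
  aw_pairing p c (k *: f + f') g = k * aw_pairing p c f g + aw_pairing p c f' g.
Proof.
have := ci_lin k 1 (aw_pairing_ci f g) (aw_pairing_ci f' g).
move=> h; rewrite (@aw_pairing_unique _ _ (k * (two_pi_i R * aw_pairing p c f g) +
  1 * (two_pi_i R * aw_pairing p c f' g))).
  move: (two_pi_i R) two_pi_i_neq0 (aw_pairing p c f g) (aw_pairing p c f' g) => t t0 A B.
  by field.
apply: ci_ext h => x _; rewrite /itg levalD levalZ.
move: (leval f x) (leval f' x) (leval g x^-1) (aw_weight p x) => z1 z2 z3 z4.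
by ring.
Qed.

Lemma aw_pairing_linr k f g g' :
  aw_pairing p c f (k *: g + g') = k * aw_pairing p c f g + aw_pairing p c f g'.
Proof.
have := ci_lin k 1 (aw_pairing_ci f g) (aw_pairing_ci f g').
move=> h; rewrite (@aw_pairing_unique _ _ (k * (two_pi_i R * aw_pairing p c f g) +
  1 * (two_pi_i R * aw_pairing p c f g'))).
  move: (two_pi_i R) two_pi_i_neq0 (aw_pairing p c f g) (aw_pairing p c f g') => t t0 A B.
  by field.
apply: ci_ext h => x _; rewrite /itg levalD levalZ.
move: (leval f x) (leval g x^-1) (leval g' x^-1) (aw_weight p x) => z1 z2 z3 z4.
by ring.
Qed.

Lemma aw_pairing_eq f g f' g' : ci (fun x => itg f g x - itg f' g' x) 0 ->
  aw_pairing p c f g = aw_pairing p c f' g'.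
Proof.
move=> h; have := ci_unique c_rect h (ciB (aw_pairing_ci f g) (aw_pairing_ci f' g')).
move=> /esym/eqP; rewrite -mulrBr mulf_eq0 (negbTE two_pi_i_neq0) subr_eq0 => /eqP.
exact.
Qed.

Lemma aw_pairing_zmul f g :
  aw_pairing p c (zmul R[i] f) g = aw_pairing p c f (zinv R[i] g).
Proof.
apply: aw_pairing_eq; apply: ci_ext (ci0 c) => x /Kx0 x0.
rewrite /itg leval_zmul// leval_zinv ?invr_neq0// invrK.
move: (leval f x) (leval g x^-1) (aw_weight p x) => z1 z2 z3.
by ring.
Qed.

(** Subtracting the scalars isolates the reflection terms. The mixed products f(x) g(1/x) cancel,
    and the difference of the integrands is -k_1^{-1} (h(x) - h(1/x)) S1(x)/x with h = f g. *)
Lemma aw_pairing_T1 f g :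
  aw_pairing p c (T1 p f - k1 p *: f) g =
  aw_pairing p c f (T1 (inv_params p) g - (k1 p)^-1 *: g).
Proof.
apply: aw_pairing_eq; pose h := lmul f g.
have := kernel_antisym c_cont c_closed c_rect (oner_neq0 _) K0 ci0V E0 Eout E1 Eef1
  q1 q0 (A1 := q) (A2 := q) Bs1E Bs1E h (erefl _).
rewrite expr1n mulr1 => /(_ (erefl _)) /(ciZ (- (k1 p)^-1)); rewrite mulr0.
apply: ci_ext => x Kx; have x0 := Kx0 Kx; have [a1 b1] := fac1 Kx.
have xi0 : x^-1 != 0 by rewrite invr_neq0.
rewrite /itg -/S1 (aw_weight_S1 Kx) div1r /h !leval_lmul//.
have [x2|x2] := eqVneq (x ^+ 2) 1.
  have -> : x^-1 = x by rewrite -[x^-1]mul1r -x2 expr2 mulfK.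
  by rewrite x2 !subrr !(mul0r, mulr0) subrr.
have x1 : 1 - x ^+ 2 != 0 by rewrite subr_eq0 eq_sym.
have x1' : x ^+ 2 - 1 != 0 by rewrite subr_eq0.
have xi1 : 1 - x^-1 ^+ 2 != 0.
  have -> : 1 - x^-1 ^+ 2 = (x ^+ 2 - 1) / x ^+ 2 by field.
  by rewrite mulf_neq0 // invr_neq0// expf_neq0.
rewrite !levalB !levalZ (T1E p f x0 x1) (T1E (inv_params p) g xi0 xi1) invrK /= !invrK.
move: a1 b1; rewrite /a /b /aw_a /aw_b => a1 b1.
have b1' : u1 p + k1 p * x != 0.
  have -> : u1 p + k1 p * x = u1 p * (1 - - (k1 p / u1 p) * x) by field.
  by rewrite mulf_neq0.
move: (S1 x) (leval f x) (leval f x^-1) (leval g x) (leval g x^-1) => z1 z2 z3 z4 z5.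
field.
by rewrite mulNr opprK a1 b1' x1 x1' x0 u1N0 k1N0.
Qed.


(** As for T_1, with x -> q/x and h(x) = f(q/x) g(1/x): the inverted operator evaluated at 1/x
    involves g(x/q), and h(q/x) = f(x) g(x/q). *)
Lemma aw_pairing_T0 f g :
  aw_pairing p c (T0 p f - k0 p *: f) g =
  aw_pairing p c f (T0 (inv_params p) g - (k0 p)^-1 *: g).
Proof.
apply: aw_pairing_eq; pose h := lmul (lrefl q f) (lrefl 1 g).
have := kernel_antisym c_cont c_closed c_rect q0 K0 ci0V E0 Eout Eq (fun e e' => @Eefq e e' 1)
  q1 q0 (A1 := 1) (A2 := q ^+ 2) Bs0E Bs0E h (erefl _).
rewrite mul1r => /(_ (erefl _)) /(ciZ ((k0 p)^-1)); rewrite mulr0.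
apply: ci_ext => x Kx; have x0 := Kx0 Kx; have [c1 d1] := fac0 Kx.
have xi0 : x^-1 != 0 by rewrite invr_neq0.
have qx0 : q / x != 0 by rewrite mulf_neq0.
rewrite /itg -/S0 (aw_weight_S0 Kx) /h !leval_lmul// !leval_lrefl !div1r.
(* The weight also vanishes at the fixed points of x -> q/x, where T_0 f has no explicit formula. *)
have [x2|x2] := eqVneq (x ^+ 2) q.
  have qx : q / x = x by rewrite -x2 expr2 mulfK.
  have z : 1 - q * x ^- 2 = 0 by rewrite -x2 mulfV ?subrr// expf_neq0.
  by rewrite !qx z subrr !mul0r !mulr0 !mul0r subrr.
have x1 : x ^+ 2 - q != 0 by rewrite subr_eq0.
have x1' : 1 - q * x ^- 2 != 0.
  have -> : 1 - q * x ^- 2 = (x ^+ 2 - q) / x ^+ 2 by field.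
  by rewrite mulf_neq0 // invr_neq0// expf_neq0.
have qi : qpar (inv_params p) = q^-1 by rewrite /q /qpar /= exprVn.
have xi1 : 1 - qpar (inv_params p) * x^-1 ^- 2 != 0.
  have -> : 1 - qpar (inv_params p) * x^-1 ^- 2 = - (x ^+ 2 - q) / q.
    by rewrite qi exprVn invrK; field.
  by rewrite mulf_neq0 // ?oppr_eq0// invr_neq0.
have qhi : qh (inv_params p) != 0 by rewrite /= invr_neq0.
rewrite !levalB !levalZ (T0E qh0 f x0 x1') (T0E qhi g xi0 xi1) -/q.
have -> : qpar (inv_params p) / x^-1 = (q / x)^-1.
  by rewrite qi [RHS]invfM.
have -> : q / (q / x) = x by field; rewrite q0 x0.
have -> : k0 (inv_params p) = (k0 p)^-1 by [].
have -> : u0 (inv_params p) = (u0 p)^-1 by [].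
have -> : qh (inv_params p) = (qh p)^-1 by [].
rewrite qi exprVn !invrK.
move: c1 d1 x1 x1' xi1; rewrite /q /qpar /cc /d /aw_c /aw_d => c1 d1 x1 x1' xi1.
have c1' : x - qh p * k0 p * u0 p != 0.
  have -> : x - qh p * k0 p * u0 p = x * (1 - qh p * k0 p * u0 p / x) by field.
  by rewrite mulf_neq0.
have d1' : u0 p * x + qh p * k0 p != 0.
  have -> : u0 p * x + qh p * k0 p = u0 p * x * (1 - - (qh p * k0 p / u0 p) / x).
    by field; rewrite u0N0 x0.
  by rewrite !mulf_neq0.
have x1o : qh p ^+ 2 - x ^+ 2 != 0 by rewrite -opprB oppr_eq0.
move: (S0 x) (leval f x) (leval f _) (leval g x^-1) (leval g _) => z1 z2 z3 z4 z5.
field.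
by rewrite ?mulNr ?opprK d1' c1' x1 x1o x0 u0N0 k0N0 qh0.
Qed.


End AskeyWilsonPairing.

(** * The transform *)

(** As |q| < 1, q is not a root of unity. (k_0 k_1)^2 is the square of the dual parameter a, (k_1
    u_1)^2 that of a itself, and the last two conditions concern ac and ad. *)
Lemma generic_alg (K : numFieldType) (p : params K) : generic p -> alg_generic p.
Proof.
move=> hp; have q0 : qpar p != 0 by rewrite -normr_gt0; apply: q_neq0.
have qh0 : qh p != 0 by move: q0; rewrite /qpar expf_eq0.
have ma : aw_a p \in aw_params p by rewrite mem_head.
have mc : aw_c p \in aw_params p by rewrite !inE eqxx !orbT.
have md : aw_d p \in aw_params p by rewrite !inE eqxx !orbT.
have ma' : aw_a (dual p) \in aw_params (dual p) by rewrite mem_head.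
split=> //; first exact: params_neq0.
- have pos n : qpar p ^+ n.+1 != 1.
    apply/eqP => /(congr1 (@Num.norm _ _)); rewrite normrX normr1 => e1.
    have := exprn_ilt1 n.+1 (normr_ge0 (qpar p)) (q_lt1 hp).
    by rewrite e1 ltxx.
  case=> [[//|n]|n] => [/eqP|]; first by rewrite -exprnP (negbTE (pos n)).
  rewrite NegzE -exprnN => /(congr1 GRing.inv)/eqP.
  by rewrite invrK invr1 (negbTE (pos n)).
- move=> j; have := aw_dual_generic hp j ma' ma'; rewrite /aw_a /= -expr2.
  by rewrite [k1 p * k0 p]mulrC.
- move=> j; have mk1 : k1 p \in [:: k0 p; k1 p; u1 p] by rewrite !inE eqxx orbT.
  by have /andP[] := params_sqr hp j mk1.
- by have := aw_generic hp 0 ma ma; rewrite expr0z -expr2.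
- by move=> j; apply: (aw_generic hp j ma mc).
- move=> j; have := aw_generic hp j ma md; apply: contra_neq => e.
  by rewrite /aw_d mulrN e opprK.
Qed.

(** * Inverses inside the Hecke algebra *)

Section InverseInDaha.
Variables (K : numFieldType) (p : params K).
Hypothesis par0 : [/\ k0 p != 0, k1 p != 0, u0 p != 0 & u1 p != 0].

Definition hT1i : daha p := hT1 p - (k1 p - (k1 p)^-1) *: 1.

Lemma hT1K : hT1 p * hT1i = 1. Proof. by apply/val_inj; exact: mulT1K. Qed.
Lemma hT1iK : hT1i * hT1 p = 1. Proof. by apply/val_inj; exact: mulT1iK. Qed.
Lemma hzK : hz p * hzinv p = 1. Proof. by apply/val_inj; exact: zmul_zinv. Qed.
Lemma hzinvK : hzinv p * hz p = 1. Proof. by apply/val_inj; exact: zinv_zmul. Qed.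

Lemma rinvE (B : nzRingType) (x y : B) : x * y = 1 -> y * x = 1 -> rinv x = y.
Proof.
move=> xy yx; have [_ xi] : [set z | x * z = 1 /\ z * x = 1] (rinv x).
  by apply: (@xgetI _ x [set z | x * z = 1 /\ z * x = 1] y).
by rewrite -[rinv x]mulr1 -xy mulrA xi mul1r.
Qed.

Lemma rinv_hT1 : rinv (hT1 p) = hT1i. Proof. exact: rinvE hT1K hT1iK. Qed.

Lemma hT1v_val f : subalg_val (hT1v p) f = Uop p f.
Proof. by rewrite /hT1v rinv_hT1. Qed.

End InverseInDaha.

Section Transform.
Variables (R : realType) (p : params R[i]) (c : R -> R[i]).
Hypotheses (hp : generic p) (hc : is_aw_contour p c).
Implicit Types (f g : laurent R[i]) (m n : int).

Let p' := inv_params p.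
Let pg := generic_alg hp.
Let pg' := alg_generic_inv pg.
Let qh0 := alg_qh pg.
Let qh0' := alg_qh pg'.
Let par0 := alg_neq0 pg.
Let par0' := alg_neq0 pg'.
Local Notation "<< f , g >>" := (aw_pairing p c f g).

Lemma aw_pairing0r f : << f, 0 >> = 0.
Proof.
have := aw_pairing_linr hp hc 1 f 0 0; rewrite scale1r addr0 mul1r => /eqP.
by rewrite -subr_eq0 opprD addrA subrr sub0r oppr_eq0 => /eqP.
Qed.

Lemma aw_pairing0l g : << 0, g >> = 0.
Proof.
have := aw_pairing_linl hp hc 1 0 0 g; rewrite scale1r addr0 mul1r => /eqP.
by rewrite -subr_eq0 opprD addrA subrr sub0r oppr_eq0 => /eqP.
Qed.

Lemma aw_pairingZr k f g : << f, k *: g >> = k * << f, g >>.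
Proof. by have := aw_pairing_linr hp hc k f g 0; rewrite !addr0 aw_pairing0r addr0. Qed.

Lemma aw_pairingZl k f g : << k *: f, g >> = k * << f, g >>.
Proof. by have := aw_pairing_linl hp hc k f 0 g; rewrite !addr0 aw_pairing0l addr0. Qed.

Lemma aw_pairingDr f g g' : << f, g + g' >> = << f, g >> + << f, g' >>.
Proof. by have := aw_pairing_linr hp hc 1 f g g'; rewrite scale1r mul1r. Qed.

Lemma aw_pairingDl f f' g : << f + f', g >> = << f, g >> + << f', g >>.
Proof. by have := aw_pairing_linl hp hc 1 f f' g; rewrite scale1r mul1r. Qed.

Lemma aw_pairingBr f g g' : << f, g - g' >> = << f, g >> - << f, g' >>.
Proof. by rewrite aw_pairingDr -scaleN1r aw_pairingZr mulN1r. Qed.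

Lemma aw_pairingBl f f' g : << f - f', g >> = << f, g >> - << f', g >>.
Proof. by rewrite aw_pairingDl -scaleN1r aw_pairingZl mulN1r. Qed.

Lemma aw_pairing_T1_inv f g : << T1 p f, g >> = << f, T1i p' g >>.
Proof.
have := aw_pairing_T1 hp hc f g; rewrite aw_pairingBl aw_pairingBr aw_pairingZl aw_pairingZr.
move=> /eqP; rewrite subr_eq => /eqP ->.
rewrite /T1i endoBE endoZE endo1E aw_pairingBr aw_pairingZr.
have -> : k1 p' = (k1 p)^-1 by [].
by rewrite invrK; move: (<< f, T1 p' g >>) (<< f, g >>) => A B; ring.
Qed.

Lemma aw_pairing_T0_inv f g : << T0 p f, g >> = << f, T0i p' g >>.
Proof.
have := aw_pairing_T0 hp hc f g; rewrite aw_pairingBl aw_pairingBr aw_pairingZl aw_pairingZr.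
move=> /eqP; rewrite subr_eq => /eqP ->.
rewrite /T0i endoBE endoZE endo1E aw_pairingBr aw_pairingZr.
have -> : k0 p' = (k0 p)^-1 by [].
by rewrite invrK; move: (<< f, T0 p' g >>) (<< f, g >>) => A B; ring.
Qed.

Lemma aw_pairing_T1i f g : << T1i p f, g >> = << f, T1 p' g >>.
Proof.
have e : T1i p' (T1 p' g) = g.
  by rewrite -[LHS]/((T1i p' * T1 p') g) (mulT1iK par0').
rewrite -{1}e -aw_pairing_T1_inv.
by rewrite -[T1 p (T1i p f)]/((T1 p * T1i p) f) (mulT1K par0).
Qed.

Lemma aw_pairing_zinv f g : << zinv R[i] f, g >> = << f, zmul R[i] g >>.
Proof.
have e : zinv R[i] (zmul R[i] g) = g by rewrite -[LHS]/((zinv R[i] * zmul R[i]) g) zinv_zmul.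
rewrite -{1}e -(aw_pairing_zmul hp hc).
by rewrite -[zmul R[i] (zinv R[i] f)]/((zmul R[i] * zinv R[i]) f) zmul_zinv.
Qed.

Lemma aw_pairing_Y f g : << cherednikY p f, g >> = << f, Yi p' g >>.
Proof. by rewrite /cherednikY endoME aw_pairing_T1_inv aw_pairing_T0_inv. Qed.

(** The adjoint of z^{-1} T_1^{-1} is T_1 z at inverted parameters, the inverse of T_1^vee there.
    Its quadratic relation returns to [Uop], whose action on the eigenvectors is known. *)
Lemma aw_pairing_Uop f g :
  << Uop p f, g >> = << f, Uop p' g >> - ((u1 p)^-1 - u1 p) * << f, g >>.
Proof.
rewrite /Uop endoME aw_pairing_zinv aw_pairing_T1i.
rewrite -[T1 p' (zmul R[i] g)]/((T1 p' * zmul R[i]) g) (T1z_quadratic par0').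
rewrite endoBE endoZE endo1E aw_pairingBr aw_pairingZr.
by have -> : u1 p' - (u1 p')^-1 = (u1 p)^-1 - u1 p by rewrite /= invrK.
Qed.

Lemma gam_inv m : gam p' m = gam' p m.
Proof.
rewrite /gam' /gam invfM; congr (_ * _); first by rewrite -invfM exprz_inv invr_expz.
by rewrite /qpar /= exprVn exprz_inv invr_expz.
Qed.

Lemma nsAWE'E m : nsAWE' p m = nsE p' m.
Proof.
rewrite -(nsAW_normalized pg') /nsAWE' /nsAW'.
by have -> : k1 p * u1 p = (k1 p' * u1 p')^-1 by rewrite /= -invfM invrK.
Qed.

Definition transform_coef f m : R[i] := << f, nsE p' m >>.
Local Notation phi := transform_coef.

(** T_1^{-1} at inverted parameters is T_1 - k_1^{-1} + k_1, which changes the diagonal entry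
    k_1^{-1} of [T1_nsE] to k_1 and leaves the other coefficient, identified with [coefT1]. *)
Lemma transform_T1 f m : phi (T1 p f) m =
  k1 p * phi f m + coefT1 p m * (phi f (- m) - phi f m).
Proof.
rewrite /phi aw_pairing_T1_inv /T1i endoBE endoZE endo1E (T1_nsE pg') gam_inv.
rewrite aw_pairingBr aw_pairingDr !aw_pairingZr aw_pairingBr.
have -> : k1 p' + al p' (gam' p m) = coefT1 p m.
  rewrite (k1_al pg') /coefT1; last by rewrite -gam_inv (gam_den1 pg').
  have -> : k1 p' = (k1 p)^-1 by [].
  have -> : k0 p' = (k0 p)^-1 by [].
  rewrite !invrK [((k0 p)^-1 * _)^-1]invfM !invrK; congr (_ * (_ / _)).
  by ring.
have -> : k1 p' = (k1 p)^-1 by [].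
rewrite invrK; move: (<< f, nsE p' m >>) (<< f, nsE p' (- m) >>) (coefT1 p m) => A B C.
by ring.
Qed.

Lemma transform_Uop f m : phi (Uop p f) m =
  u1 p * phi f m + coefT0 p m * (phi f (- m - 1) - phi f m).
Proof.
rewrite /phi aw_pairing_Uop (Uop_nsE pg') gam_inv.
rewrite aw_pairingDr !aw_pairingZr aw_pairingBr.
have -> : u1 p' + be p' (gam' p m) = coefT0 p m.
  have [k00 k10 u00 u10] := par0.
  have g0 := gam_neq0 pg m.
  have den : 1 - qpar p' * gam' p m ^+ 2 != 0 by rewrite -gam_inv (gam_denq pg').
  have den' := gam_denq pg m.
  have den2 : qpar p * gam p m ^+ 2 - 1 != 0 by rewrite -opprB oppr_eq0.
  rewrite (u1_be pg') // /coefT0 /gam'.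
  have -> : u1 p' = (u1 p)^-1 by [].
  have -> : u0 p' = (u0 p)^-1 by [].
  have -> : qh p' = (qh p)^-1 by [].
  have -> : qpar p' = (qh p)^-1 ^+ 2 by [].
  move: den' den2; rewrite /qpar !exprVn !invrK.
  move: (gam p m) g0 => g g0 den' den2.
  field.
  by rewrite -?exprMn in den' den2 *; rewrite ?den' ?den2 ?g0 ?u00 ?u10 ?qh0.
have -> : u1 p' = (u1 p)^-1 by [].
move: (<< f, nsE p' m >>) (<< f, nsE p' (- m - 1) >>) (coefT0 p m) => A B C.
by ring.
Qed.

Lemma Yi_nsE m : Yi p' (nsE p' m) = gam p m *: nsE p' m.
Proof.
have gg : gam p m * gam p' m = 1 by rewrite gam_inv mulfV// (gam_neq0 pg).
have h : gam p' m *: Yi p' (nsE p' m) = nsE p' m.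
  rewrite -(endoEZr (Yi p')) -(nsE_eigen pg').
  by rewrite -[LHS]/((Yi p' * cherednikY p') (nsE p' m)) (mulYiK qh0' par0').
by rewrite -[in RHS]h scalerA gg scale1r.
Qed.

Lemma transform_Y f m : phi (cherednikY p f) m = gam p m * phi f m.
Proof. by rewrite /phi aw_pairing_Y Yi_nsE aw_pairingZr. Qed.

Lemma transform_linear k f g m : phi (k *: f + g) m = k * phi f m + phi g m.
Proof. exact: aw_pairing_linl. Qed.

Lemma transform_eig i m : rank_monom i != m -> phi (eig p i) m = 0.
Proof.
move=> im; have [Ye _ _ _] := eigP pg i.
have := transform_Y (eig p i) m; rewrite Ye {1}/phi aw_pairingZl -/(phi _ _) => /eqP.
rewrite -subr_eq0 -mulrBl mulf_eq0 subr_eq0 => /orP[/eqP/(gam_inj pg) e|/eqP//].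
by rewrite e eqxx in im.
Qed.

Fact transform_subproof f :
  (fun w : spectrum p => phi f (spec_index w) : R[i]^o) \in @has_finsupp _ R[i].
Proof.
apply/asboolP; have [N [d ->]] := eig_gen pg f.
have := finite_image (fun i => spec p (rank_monom i)) (finite_II N).
apply: sub_finite_set => w /=.
elim: N => [|N IH] h.
  by move: h; rewrite big_nil /phi aw_pairing0l eqxx.
have e : \sum_(0 <= i < N.+1) d i *: eig p i =
    d N *: eig p N + \sum_(0 <= i < N) d i *: eig p i.
  by rewrite (big_nat_recr N 0 _ (leq0n N)) addrC.
rewrite e in h.
rewrite transform_linear in h.
move: h.
have [wN|wN] := eqVneq (rank_monom N) (spec_index w).
  by exists N => //=; rewrite wN spec_indexK.
rewrite (transform_eig wN) mulr0 add0r => /IH[i /= iN <-].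
by exists i => //=; apply: leq_trans iN _.
Qed.
Definition transform f : specfun p := Finsupp (transform_subproof f).

Fact transform_is_linear : linear transform.
Proof.
move=> k f g; apply: finsupp_ext => w.
by rewrite finsuppDE finsuppZE /= transform_linear.
Qed.
HB.instance Definition _ := GRing.isLinear.Build R[i] (laurent R[i]) (specfun p) *:%R
  transform transform_is_linear.

Lemma transformE f m : transform f (spec p m) = phi f m.
Proof. by rewrite /= (specK pg). Qed.

Lemma transform_is_aw : is_aw_transform c (transform : {linear laurent R[i] -> specfun p}).
Proof. by move=> f m; rewrite transformE nsAWE'E. Qed.

Local Notation F := (transform : {linear laurent R[i] -> specfun p}).

(** * Intertwining with the duality isomorphism *)

Section Intertwining.
Variable mu : {lrmorphism daha p -> daha (dual p)}.
Hypothesis hmu : is_duality mu.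
Variable act : {lrmorphism daha (dual p) -> endo (spectrum p) R[i]}.
Hypothesis hact : is_spectral_action act.

Let pard0 : [/\ k0 (dual p) != 0, k1 (dual p) != 0, u0 (dual p) != 0 & u1 (dual p) != 0].
Proof. by case: par0 => *; split. Qed.

Definition intertwines (X : daha p) := forall f, F (subalg_val X f) = act (mu X) (F f).

Let nu1 : act (mu 1) = 1.
Proof. by transitivity (act 1); [congr (act _); exact: rmorph1|exact: rmorph1]. Qed.

Let nuM X Y : act (mu (X * Y)) = act (mu X) * act (mu Y).
Proof. by transitivity (act (mu X * mu Y)); [congr (act _); exact: rmorphM|exact: rmorphM]. Qed.

Let nu_lin a X Y : act (mu (a *: X + Y)) = a *: act (mu X) + act (mu Y).
Proof. by transitivity (act (a *: mu X + mu Y)); [congr (act _); exact: linearP|exact: linearP]. Qed.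

Lemma intertwines1 : intertwines 1.
Proof. by move=> f; rewrite nu1. Qed.

Lemma intertwines_lin a X Y : intertwines X -> intertwines Y -> intertwines (a *: X + Y).
Proof.
move=> hX hY f; rewrite nu_lin.
transitivity (a *: F (subalg_val X f) + F (subalg_val Y f)); first exact: linearP.
by rewrite hX hY.
Qed.

Lemma intertwinesM X Y : intertwines X -> intertwines Y -> intertwines (X * Y).
Proof.
move=> hX hY f; rewrite nuM.
transitivity (F (subalg_val X (subalg_val Y f))); first by [].
by rewrite hX hY.
Qed.

(** Since mu and the action are morphisms, Z acts through the inverse of the action of X; no formula
    for the image of Z is required. *)
Lemma intertwines_inv X Z : X * Z = 1 -> Z * X = 1 -> intertwines X -> intertwines Z.
Proof.
move=> XZ ZX hX f; have e : act (mu Z) * act (mu X) = 1 by rewrite -nuM ZX nu1.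
have Xf : subalg_val X (subalg_val Z f) = f by rewrite -[LHS]/(subalg_val (X * Z) f) XZ.
have := congr1 (act (mu Z)) (hX (subalg_val Z f)); rewrite Xf => ->.
by rewrite -[RHS]/((act (mu Z) * act (mu X)) (F (subalg_val Z f))) e.
Qed.

Lemma intertwines_T1 : intertwines (hT1 p).
Proof.
move=> f; apply: (eq_trans _ (congr1 (fun Z => act Z (F f)) (esym (duality_T1 hmu)))).
apply: specfun_ext => m.
by rewrite (action_T1 hact) !transformE transform_T1.
Qed.

Lemma intertwines_T1v : intertwines (hT1v p).
Proof.
move=> f; apply: (eq_trans _ (congr1 (fun Z => act Z (F f)) (esym (duality_T1v hmu)))).
apply: specfun_ext => m.
by rewrite (action_T0 hact) !transformE (hT1v_val par0) transform_Uop.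
Qed.

Lemma act_zinv (g : specfun p) m :
  act (hzinv (dual p)) g (spec p m) = gam p m * g (spec p m).
Proof.
have e : act (hz (dual p)) * act (hzinv (dual p)) = 1.
  transitivity (act (hz (dual p) * hzinv (dual p))); first exact/esym/rmorphM.
  by rewrite hzK; exact: rmorph1.
have h : act (hz (dual p)) (act (hzinv (dual p)) g) = g.
  exact: (congr1 (fun M : endo (spectrum p) R[i] => M g) e).
have := action_z hact (act (hzinv (dual p)) g) m; rewrite h => ->.
by rewrite mulrA /gam' mulfV ?mul1r// (gam_neq0 pg).
Qed.

(** Here mu(Y) is computed from the images of T_1 and T_0: the conjugation in mu(T_0) cancels the
    leading dual T_1, and the dual T_1^vee T_1 is z^{-1}. *)
Let mu_Y : mu (hT1 p * hT0 p) = hzinv (dual p).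
Proof.
transitivity (mu (hT1 p) * mu (hT0 p)); first exact: rmorphM.
have hv : hT1v (dual p) = hzinv (dual p) * hT1i (dual p) by rewrite /hT1v (rinv_hT1 pard0).
have e0 : mu (hT0 p) = hT1i (dual p) * (hzinv (dual p) * hT1i (dual p)) * hT1 (dual p).
  by rewrite -hv -(rinv_hT1 pard0); exact: duality_T0.
transitivity (hT1 (dual p) * (hT1i (dual p) * (hzinv (dual p) * hT1i (dual p)) * hT1 (dual p))).
  by congr (_ * _); [exact: duality_T1|exact: e0].
by rewrite -[_ * hT1 _]mulrA -mulrA (hT1iK pard0) mulr1 mulrA (hT1K pard0) mul1r.
Qed.

Lemma intertwines_Y : intertwines (hT1 p * hT0 p).
Proof.
move=> f; apply: (eq_trans _ (congr1 (fun Z => act Z (F f)) (esym mu_Y))).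
apply: specfun_ext => m.
rewrite act_zinv -[subalg_val (hT1 p * hT0 p) f]/(cherednikY p f).
by rewrite !transformE transform_Y.
Qed.

(** The generators are recovered as T_0 = T_1^{-1} Y and z^{-1} = T_1^vee T_1. *)
Lemma intertwines_all X : intertwines X.
Proof.
have i1 := intertwines_T1; have T1K := hT1K par0; have T1iK := hT1iK par0.
have iT1i : intertwines (hT1i p) by apply: intertwines_inv i1.
have iT0 : intertwines (hT0 p).
  have -> : hT0 p = hT1i p * (hT1 p * hT0 p) by rewrite mulrA T1iK mul1r.
  exact: intertwinesM iT1i intertwines_Y.
have izinv : intertwines (hzinv p).
  have -> : hzinv p = hT1v p * hT1 p.
    by rewrite /hT1v (rinv_hT1 par0) -mulrA T1iK mulr1.
  exact: intertwinesM intertwines_T1v i1.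
have iz : intertwines (hz p) by apply: intertwines_inv izinv; [exact: hzinvK|exact: hzK].
elim/subalg_ind: X => [X hX|||]; last exact: intertwinesM.
- have gen (Z : daha p) : subalg_val X = subalg_val Z -> intertwines Z -> intertwines X.
    by move=> /val_inj ->.
  case: hX => [[[]|]|] /= e.
  + exact: (gen (hT0 p)).
  + exact: (gen (hT1 p)).
  + exact: (gen (hz p)).
  + exact: (gen (hzinv p)).
- exact: intertwines1.
- exact: intertwines_lin.
Qed.

End Intertwining.

End Transform.

Theorem proposition11p2 (R : realType) (p : params R[i]) (hp : generic p) :
  exists rho : {lrmorphism daha (dual p) -> endo (spectrum p) R[i]},
    [/\ is_spectral_action rho,
        forall rho' : {lrmorphism daha (dual p) -> endo (spectrum p) R[i]},
          is_spectral_action rho' -> rho' =1 rho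
      & forall (mu : {lrmorphism daha p -> daha (dual p)}) (c : R -> R[i]),
          is_duality mu -> is_aw_contour p c ->
          exists F : {linear laurent R[i] -> specfun p},
            is_aw_transform c F /\
            forall (X : daha p) (f : laurent R[i]),
              F (subalg_val X f) = rho (mu X) (F f)].
Proof.
have pg := generic_alg hp; have rhoP := rho_spectral pg.
exists (rho pg); split=> // [rho' hrho'|mu c hmu hc].
  exact: (spectral_action_unique hrho' rhoP).
exists (transform hp hc : {linear laurent R[i] -> specfun p}).
split; first exact: transform_is_aw.
by move=> X f; apply: intertwines_all.
Qed.
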